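(* Let $n\ge 3$. Let $X_1=\{(x,y)\in\mathbf{R}^{n+1}\times\mathbf{R}^{n+1} : \langle x,y\rangle=1\}$, with coordinates $(x_1,x',y_1,y')$, where $x_1,y_1\in\mathbf{R}$ and $x',y'\in\mathbf{R}^n$. Let $GL^+(n,\mathbf{R})$ act on $X_1$ by $h\cdot(x_1,x',y_1,y')=(x_1,hx',y_1,{}^t h^{-1}y')$, and let $\tilde H=SO_0(Q_1)$ act on $X_1$ by fixing $x_1,y_1$ and acting linearly on $(x',y')\in\mathbf{R}^{2n}$. Then every $GL^+(n,\mathbf{R})$-invariant distribution on $X_1$ is $\tilde H$-invariant.
   Context: Vectors in $\mathbf{R}^{n+1}$ are columns: $x={}^t(x_1,x_2,\dots,x_{n+1})={}^t(x_1,x')$ with $x'=(x_2,\dots,x_{n+1})\in\mathbf{R}^n$, and similarly $y={}^t(y_1,y')$. Here $\langle x,y\rangle=\sum_{i=1}^{n+1}x_iy_i$, so $X_1$ is a smooth hypersurface in $\mathbf{R}^{2(n+1)}$. $GL^+(n,\mathbf{R})$ is the group of real $n\times n$ matrices with positive determinant. $Q_1$ is the quadratic form $Q_1(x',y')=x_2y_2+\cdots+x_{n+1}y_{n+1}$ on $\mathbf{R}^{2n}$ (of signature $(n,n)$), $O(Q_1)$ is its orthogonal group, and $\tilde H=SO_0(Q_1)$ is the identity component of $O(Q_1)$; since $x_1y_1+Q_1(x',y')=1$ on $X_1$, the described action of $\tilde H$ preserves $X_1$. ''Distribution'' on a manifold means a function of distribution class (generalized function), i.e. a continuous linear functional on the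 space of compactly supported smooth densities; smooth functions embed in distributions and diffeomorphisms act by pullback. A distribution $f$ is invariant under a group acting by diffeomorphisms if its pullback by every group element equals $f$. *)

(* Defs.v *)
From HB Require Import structures.
From mathcomp Require Import all_boot all_order all_algebra.
From mathcomp Require Import all_classical all_reals all_analysis.
From mathcomp Require Import complex.

Set Implicit Arguments.
Unset Strict Implicit.
Unset Printing Implicit Defensive.

Import Order.TTheory GRing.Theory Num.Theory.
Import numFieldNormedType.Exports.

Local Open Scope classical_set_scope.
Local Open Scope complex_scope.
Local Open Scope ring_scope.

Section Smooth.
Variables (R : realType) (d : nat) (W : normedModType R).
Implicit Types (f : 'rV[R]_d -> W) (V : set 'rV[R]_d).

Definition partial (i : 'I_d) f : 'rV[R]_d -> W :=
  fun t => 'D_(delta_mx 0 i) f t.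

(** A multi-index is given as the list of the variables of differentiation. *)
Fixpoint iter_partial (s : seq 'I_d) f : 'rV[R]_d -> W :=
  if s is i :: s' then partial i (iter_partial s' f) else f.

(** Meant for [V] open: then only the values of [f] on [V] matter. *)
Definition smooth_on V f : Prop :=
  forall (s : seq 'I_d) (t : 'rV[R]_d), V t ->
    {for t, continuous (iter_partial s f)} /\
    (forall i, derivable (iter_partial s f) t (delta_mx 0 i)).

End Smooth.

(** [X] stands for a [d]-dimensional embedded smooth submanifold of [E], whose
    tangent space at [p] is [TX p]. *)
Section Distributions.
Variables (R : realType) (E : normedModType R) (d : nat).
Variables (X : set E) (TX : E -> set E).
Implicit Types (V L : set 'rV[R]_d) (sigma : 'rV[R]_d -> E).

Definition coord_frame sigma (t : 'rV[R]_d) : 'I_d -> E :=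
  fun i => partial i sigma t.

(** Inverse charts of [X]: smooth injective immersions of an open set [V] into
    [X] that are homeomorphisms onto a relatively open subset of [X]. *)
Definition local_param V sigma : Prop :=
  [/\ open V,
      smooth_on V sigma,
      (forall t, V t -> X (sigma t)),
      (forall t1 t2, V t1 -> V t2 -> sigma t1 = sigma t2 -> t1 = t2) &
      (forall t, V t -> forall c : 'I_d -> R,
         \sum_i c i *: coord_frame sigma t i = 0 -> forall i, c i = 0) /\
      (forall U, open U -> U `<=` V ->
         exists2 O : set E, open O & sigma @` U = X `&` O)].

(** A complex density assigns a number to each point of [X] and each [d]-tuple
    of tangent vectors at that point. The value 0 on all other arguments is a
    normalization which makes the representation of a density unique. *)
Definition predensity := E -> ('I_d -> E) -> R[i].

Definition tangent_frame (p : E) (A : 'I_d -> E) : Prop :=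
  X p /\ forall i, TX p (A i).

Definition is_density (mu : predensity) : Prop :=
  (forall p A, ~ tangent_frame p A -> mu p A = 0) /\
  (forall p A (B : 'M[R]_d), tangent_frame p A ->
     mu p (fun i => \sum_j B i j *: A j) = `|\det B|%:C * mu p A).

Definition density_coord (mu : predensity) sigma : 'rV[R]_d -> R[i] :=
  fun t => mu (sigma t) (coord_frame sigma t).

Definition density_coord_re mu sigma : 'rV[R]_d -> R :=
  fun t => complex.Re (density_coord mu sigma t).

Definition density_coord_im mu sigma : 'rV[R]_d -> R :=
  fun t => complex.Im (density_coord mu sigma t).

Definition smooth_density (mu : predensity) : Prop :=
  is_density mu /\
  forall V sigma, local_param V sigma ->
    smooth_on V (density_coord_re mu sigma) /\
    smooth_on V (density_coord_im mu sigma).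

Definition supported_in (K : set E) (mu : predensity) : Prop :=
  forall p A, ~ K p -> mu p A = 0.

Definition test_density (mu : predensity) : Prop :=
  smooth_density mu /\
  exists K : set E, [/\ compact K, K `<=` X & supported_in K mu].

(** All derivatives of order at most [k] of the coordinate expression of [mu]
    are bounded by [M] on [L]. *)
Definition coord_bounded (mu : predensity) sigma L (k : nat) (M : R) : Prop :=
  forall (s : seq 'I_d) (t : 'rV[R]_d), (size s <= k)%N -> L t ->
    `|iter_partial s (density_coord_re mu sigma) t| <= M /\
    `|iter_partial s (density_coord_im mu sigma) t| <= M.

Definition test_linear (T : predensity -> R[i]) : Prop :=
  forall (a : R[i]) (mu nu : predensity), test_density mu -> test_density nu ->
    T (fun p A => a * mu p A + nu p A) = a * T mu + T nu.

(** Continuity for the inductive limit topology: on the test densities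
    supported in a given compact set, [T] is bounded by finitely many of the
    seminorms "supremum, over a compact subset of a chart, of the derivatives
    of order at most [k] of the coordinate expression". *)
Definition test_continuous (T : predensity -> R[i]) : Prop :=
  forall K : set E, compact K -> K `<=` X ->
  exists (m k : nat) (V L : 'I_m -> set 'rV[R]_d)
         (sigma : 'I_m -> 'rV[R]_d -> E) (C : R),
    (forall j, [/\ local_param (V j) (sigma j), compact (L j) & L j `<=` V j]) /\
    (forall (mu : predensity) (M : R),
       test_density mu -> supported_in K mu -> 0 <= M ->
       (forall j, coord_bounded mu (sigma j) (L j) k M) ->
       `|T mu| <= (C * M)%:C).

(** Only the values of [T] on test densities matter. *)
Definition distribution (T : predensity -> R[i]) : Prop :=
  test_linear T /\ test_continuous T.

Definition density_pullback (g : E -> E) (mu : predensity) : predensity :=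
  fun p A => mu (g p) (fun i => 'D_(A i) g p).

(** Pullback of [T] by the diffeomorphism with inverse [ginv]: it extends the
    composition [f \o g] of functions because the integral of [(f \o g) mu] is
    that of [f] against the pullback of [mu] by [ginv]. *)
Definition distribution_pullback (ginv : E -> E) (T : predensity -> R[i]) :
    predensity -> R[i] :=
  fun mu => T (density_pullback ginv mu).

(** [G] is a group of invertible matrices acting by [act]. *)
Definition invariant_under (k : nat) (G : set 'M[R]_k)
    (act : 'M[R]_k -> E -> E) (T : predensity -> R[i]) : Prop :=
  forall h, G h -> forall mu, test_density mu ->
    distribution_pullback (act (invmx h)) T mu = T mu.

End Distributions.

Section Hyperboloid.
Variables (R : realType) (n : nat).

Definition dotv (m : nat) (x y : 'cV[R]_m) : R := \sum_i x i 0 * y i 0.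

(** Pairs [(x, y)], where [x] is split as [x_1 = usubmx x], [x' = dsubmx x]. *)
Definition ambient : normedModType R := ('cV[R]_(1 + n) * 'cV[R]_(1 + n))%type.

Definition X1 : set ambient := [set p | dotv p.1 p.2 = 1].

(** The kernel of the differential of [(x, y) |-> dotv x y] at [p]. *)
Definition TX1 (p : ambient) : set ambient :=
  [set v | dotv v.1 p.2 + dotv p.1 v.2 = 0].

Definition dimX1 : nat := (n.*2).+1.

Definition GLplus : set 'M[R]_n := [set h | 0 < \det h].

Definition actGL (h : 'M[R]_n) (p : ambient) : ambient :=
  (col_mx (usubmx p.1) (h *m dsubmx p.1),
   col_mx (usubmx p.2) ((invmx h)^T *m dsubmx p.2)).

Definition Q1 (z : 'cV[R]_(n + n)) : R := dotv (usubmx z) (dsubmx z).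

Definition O_Q1 : set 'M[R]_(n + n) :=
  [set M | M \in unitmx /\ forall z, Q1 (M *m z) = Q1 z].

Definition SO0_Q1 : set 'M[R]_(n + n) := connected_component O_Q1 1%:M.

Definition actSO (M : 'M[R]_(n + n)) (p : ambient) : ambient :=
  let z := M *m col_mx (dsubmx p.1) (dsubmx p.2) in
  (col_mx (usubmx p.1) (usubmx z), col_mx (usubmx p.2) (dsubmx z)).

Definition distribution_X1 (T : predensity ambient dimX1 -> R[i]) : Prop :=
  distribution X1 TX1 T.

Definition GLplus_invariant (T : predensity ambient dimX1 -> R[i]) : Prop :=
  invariant_under X1 TX1 GLplus actGL T.

Definition SO0_invariant (T : predensity ambient dimX1 -> R[i]) : Prop :=
  invariant_under X1 TX1 SO0_Q1 actSO T.

End Hyperboloid.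

(* Main.v *)
(** Let q = <x,y> on R^(2n+2), so that X_1 = {q = 1}.  The density
    |det(p, A_1, ..., A_(2n+1))| on X_1 is invariant under the linear maps that
    preserve q, so a distribution becomes a functional T on functions on X_1, on
    which the linear vector fields of so(q) act.  Index coordinates from 0, so
    that x_0, y_0 are the fixed ones, and put
      E_ij = x_i d/dx_j - y_j d/dy_i,     D = y_2 d/dx_1 - y_1 d/dx_2,
      A_j = x_0 d/dy_j - x_j d/dy_0,      B_j = x_0 d/dx_j - y_j d/dy_0.
    Invariance under GL^+ means that T kills the image of E_ij for i, j >= 1.
    Modulo these images:
    - D(x_k f) = E_k1(y_2 f) - E_k2(y_1 f) vanishes for k >= 1;
    - D = D E_11 - E_11 D and x_0 E_11 = x_1 B_1 - y_1 A_1, so that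
      D(x_0 f) is equivalent to - D(y_1 A_1 f);
    - x_0 y_1 g = x_3 B_1(y_3 g) - E_31(x_0 y_3 g) - x_3 B_3(y_1 g) + E_33(x_0 y_1 g),
      and E_31, E_33 commute with D, so that D(x_0 y_1 g) vanishes; this is where
      n >= 3 is used.
    Hence D(x_k^2 f) vanishes for every k >= 0, and so does D f, since |x|^2 has no
    zero on X_1.  Thus T is invariant under the unipotent groups
    x' -> x' + B y' and, exchanging x and y, y' -> y' + C x' (B, C antisymmetric).
    Their product with GL^+ is open in O(Q_1), and an open subgroup contains the
    identity component. *)
Require Import Defs.
From HB Require Import structures.
From mathcomp Require Import all_boot all_order all_algebra.
From mathcomp Require Import all_classical all_reals all_analysis.
From mathcomp Require Import complex ring lra.

Set Implicit Arguments.
Unset Strict Implicit.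
Unset Printing Implicit Defensive.

Import Order.TTheory GRing.Theory Num.Theory.
Import numFieldNormedType.Exports.

Local Open Scope classical_set_scope.
Local Open Scope complex_scope.
Local Open Scope ring_scope.


(** Functions on X_1 are extended to the open set q != 0 through (x, y) -> (x, y / q), and the
    identities between vector fields are proved there, with commuting partial derivatives; the
    functional sees only values on X_1. Since |x|^2 has no zero on that open set either, dividing by
    it stays inside the class of extended functions. Explicit curves of matrices take the place of
    flows, and the continuity of T enters through one estimate: T is O(s^2) on the first-order
    Taylor remainder of a smooth family of test functions with common compact support. If T is
    constant along such a family, it kills the velocity at s = 0; this gives the vanishing on the
    images of E_ij. Conversely, if T kills the velocity field of P for every test function and P^2 =
    0, then the group law for 1 + s P shows that s -> T(f o (1 + s P)) has derivative zero at every
    s, so it is constant; this gives the unipotent groups. T is complex valued; its real and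
    imaginary parts are treated separately as real functionals. *)

Lemma continuous_sum (R : realType) (T : topologicalType) (I : Type) (r : seq I)
    (f : I -> T -> R) (x : T) :
  (forall i, {for x, continuous (f i)}) ->
  {for x, continuous (fun t => \sum_(i <- r) f i t)}.
Proof.
move=> cf; elim: r => [|i r IH].
  rewrite (_ : (fun t => _) = cst 0); first exact: cst_continuous.
  by apply/funext => t; rewrite big_nil.
rewrite (_ : (fun t => _) = (f i : T -> R) \+ (fun t => \sum_(j <- r) f j t)).
  by apply: continuousD.
by apply/funext => t; rewrite big_cons.
Qed.

(** * Mean values along lines, and differentiability from continuous partial derivatives *)

Section MeanValue.
Variables (R : realType) (V : normedModType R).

Lemma is_derive_line (f : V -> R) (p v : V) (s : R) :
  derivable f (p + s *: v) v ->
  is_derive s 1 (fun r : R => f (p + r *: v)) ('D_v f (p + s *: v)).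
Proof.
move=> df.
have E : (fun h : R => h^-1 *: (((fun r : R => f (p + r *: v)) \o shift s) (h *: 1) - f (p + s *: v)))
   = (fun h : R => h^-1 *: ((f \o shift (p + s *: v)) (h *: v) - f (p + s *: v))).
  apply/funext => h /=; congr (_ *: (f _ - _)).
  by rewrite /= [h *: 1]mulr1 scalerDl addrCA.
apply: DeriveDef.
  by rewrite /derivable E.
by rewrite /derive E.
Qed.

Lemma mvt_line (f : V -> R) (p v : V) (a : R) :
  (forall s, `|s| <= `|a| -> derivable f (p + s *: v) v) ->
  exists2 c, `|c| <= `|a| & f (p + a *: v) - f p = a * 'D_v f (p + c *: v).
Proof.
move=> df; set g := fun r : R => f (p + r *: v).
have dg (s : R) : `|s| <= `|a| -> is_derive s 1 g ('D_v f (p + s *: v)).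
  by move=> /df; exact: is_derive_line.
have cg (s : R) : `|s| <= `|a| -> {for s, continuous g}.
  move=> /dg [h _]; exact/differentiable_continuous/derivable1_diffP.
have g0 : g 0 = f p by rewrite /g scale0r addr0.
have [a0|a0] := leP 0 a.
  have sub (s : R) : s \in `[0, a] -> `|s| <= `|a|.
    by rewrite in_itv /= => /andP[s0 sa]; rewrite !ger0_norm.
  have [|c cI E] := MVT_segment a0 (fun s H => dg s (sub s (subset_itv_oo_cc H))).
    apply/continuous_in_subspaceT => s /set_mem; rewrite set_itvE /= => /andP[s0 sa].
    by apply/cg/sub; rewrite in_itv /= s0.
  exists c; first exact: sub.
  by rewrite -g0 -/(g a) E subr0 mulrC.
have sub (s : R) : s \in `[a, 0] -> `|s| <= `|a|.
  rewrite in_itv /= => /andP[s0 sa]; rewrite !ler0_norm //; last exact: ltW.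
  by rewrite lerN2.
have [|c cI E] := MVT_segment (ltW a0) (fun s H => dg s (sub s (subset_itv_oo_cc H))).
  apply/continuous_in_subspaceT => s /set_mem; rewrite set_itvE /= => /andP[s0 sa].
  by apply/cg/sub; rewrite in_itv /= s0.
exists c; first exact: sub.
by rewrite -g0 -/(g a) -opprB E sub0r mulrN opprK mulrC.
Qed.

End MeanValue.

Lemma differentiable_near (K : numFieldType) (V W : normedModType K) (f : V -> W)
    (L : {linear V -> W}) (x : V) : continuous L ->
  (forall eps, 0 < eps ->
     \forall h \near 0, `|f (h + x) - f x - L h| <= eps * `|h|) ->
  differentiable f x.
Proof.
move=> cL fL.
have expn : f \o shift x = cst (f x) + L +o_ 0 id.
  apply/eqaddoP => eps e0; apply: filterS (fL _ e0) => h /=.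
  by rewrite opprD addrA.
by apply/diff_locallyP; rewrite (diff_unique cL expn).
Qed.

Section Smoothness.
Variables (R : realType) (d : nat).
Implicit Types (V : set 'rV[R]_d) (f g : 'rV[R]_d -> R).

Local Notation e_ i := (delta_mx 0 i : 'rV[R]_d).

(** The increment is telescoped along a path that switches on the coordinates of [h] one at a time.
    Each step is a one-variable mean value, and continuity of the partial derivatives at [t]
    controls the error of each step. *)
Lemma differentiable_partials V f t : open V -> V t ->
  (forall s i, V s -> derivable f s (e_ i)) ->
  (forall i, {for t, continuous (partial i f)}) ->
  differentiable f t.
Proof.
move=> oV Vt df cf.
pose L0 (h : 'rV[R]_d) : R := \sum_i h 0 i * partial i f t.
have L0lin : linear L0.
  move=> a u v; rewrite /L0 scaler_sumr -big_split /=.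
  by apply: eq_bigr => i _; rewrite !mxE mulrDl scalerAl.
pose L0M := GRing.isLinear.Build _ _ _ _ _ L0lin.
pose L : {linear 'rV[R]_d -> R} := HB.pack L0 L0M.
have cL : continuous L.
  rewrite -[L : _ -> _]/(fun h : 'rV[R]_d => \sum_i h 0 i * partial i f t).
  move=> h; apply: continuous_sum => i.
  by apply: continuousM; [exact: coord_continuous | exact: cst_continuous].
apply: (differentiable_near cL) => eps eps0.
(* The [d] steps share the error; dividing by [d + 1] keeps the denominator nonzero when [d = 0]. *)
have eps' : 0 < eps / d.+1%:R by rewrite divr_gt0.
have : \forall s \near t, V s /\ forall i, `|partial i f t - partial i f s| <= eps / d.+1%:R.
  have A : \forall s \near t, forall i, `|partial i f t - partial i f s| <= eps / d.+1%:R.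
    apply: (@filter_forall _ 'I_d (fun i s => `|partial i f t - partial i f s| <= eps / d.+1%:R)
      _ (nbhs_filter t)) => i.
    by have /cvgrPdist_le := cf i; apply.
  have B : \forall s \near t, V s by exact: open_nbhs_nbhs.
  exact: filterI B A.
move=> /nbhs_ballP [r r0 Hr].
apply/nbhs_ballP; exists r => // h; rewrite -ball_normE /= sub0r normrN => hr.
(* [tr k] keeps the first [k] coordinates of [h], so consecutive truncations differ along a single
   axis. *)
pose tr k : 'rV[R]_d := \row_j (if (j < k)%N then h 0 j else 0).
have ntr (k : 'I_d) (c : R) : `|c| <= `|h 0 k| -> `|tr k + c *: e_ k| <= `|h|.
  move=> hc; rewrite [leLHS]/Num.Def.normr /= mx_normrE.
  apply: bigmax_le => //= -[i j] _ /=; rewrite !mxE !ord1 eqxx /=.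
  have hj : `|h 0 j| <= `|h|.
    rewrite [leRHS]/Num.Def.normr /= mx_normrE.
    exact: (le_bigmax _ (fun ij : 'I_1 * 'I_d => `|h ij.1 ij.2|) (0, j)).
  have hk : `|h 0 k| <= `|h|.
    rewrite [leRHS]/Num.Def.normr /= mx_normrE.
    exact: (le_bigmax _ (fun ij : 'I_1 * 'I_d => `|h ij.1 ij.2|) (0, k)).
  case: (eqVneq j k) => [->|jk]; first by rewrite ltnn add0r mulr1 (le_trans hc).
  by rewrite mulr0 addr0; case: ifP => // _; rewrite normr0.
have step (k : 'I_d) : `|f (t + tr k.+1) - f (t + tr k) - h 0 k * partial k f t|
    <= `|h| * (eps / d.+1%:R).
  have Etr : t + tr k.+1 = t + tr k + h 0 k *: e_ k.
    rewrite -addrA; congr (_ + _); apply/rowP => j; rewrite !mxE eqxx /= ltnS leq_eqVlt.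
    case: (eqVneq j k) => [->|jk]; first by rewrite eqxx ltnn add0r mulr1.
    by rewrite (negbTE (_ : val j != k)) //= mulr0 addr0.
  have inV (c : R) : `|c| <= `|h 0 k| -> ball t r (t + tr k + c *: e_ k).
    move=> hc; rewrite -ball_normE /= -addrA opprD addrA subrr sub0r normrN.
    exact: le_lt_trans (ntr _ _ hc) hr.
  have [|c hc E] := @mvt_line R _ f (t + tr k) (e_ k) (h 0 k).
    by move=> s hs; apply: df; have [] := Hr _ (inV _ hs).
  rewrite Etr E -mulrBr normrM.
  apply: ler_pM => //.
    rewrite [leRHS]/Num.Def.normr /= mx_normrE.
    exact: (le_bigmax _ (fun ij : 'I_1 * 'I_d => `|h ij.1 ij.2|) (0, k)).
  by rewrite distrC; have [_] := Hr _ (inV _ hc); exact.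
have tel : f (h + t) - f t = \sum_(k < d) (f (t + tr k.+1) - f (t + tr k)).
  rewrite -(big_mkord xpredT (fun k => f (t + tr k.+1) - f (t + tr k))).
  rewrite telescope_sumr // [h + t]addrC; congr (f _ - f _).
    by congr (_ + _); apply/rowP => j; rewrite !mxE ltn_ord.
  rewrite -[LHS]addr0; congr (_ + _).
  by apply/rowP => j; rewrite !mxE ltn0.
rewrite tel; change (`|\sum_(k < d) (f (t + tr k.+1) - f (t + tr k)) - \sum_i h 0 i * partial i f t| <= eps * `|h|); rewrite -sumrB.
apply: le_trans (ler_norm_sum _ _ _) _.
apply: le_trans (ler_sum _ (fun i _ => step i)) _.
rewrite sumr_const card_ord -[leLHS]mulr_natr -mulrA [leRHS]mulrC.
apply: ler_wpM2l => //; rewrite -mulrA ler_piMr //; first exact: ltW.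
by rewrite mulrC ler_pdivrMr // mul1r ler_nat.
Qed.
End Smoothness.

(** * Smooth functions on open sets *)

Section Ck.
Variables (R : realType) (d : nat).
Implicit Types (V : set 'rV[R]_d) (f g : 'rV[R]_d -> R).

Local Notation e_ i := (delta_mx 0 i : 'rV[R]_d).

(** [smooth_on] quantifies over all iterated derivatives at once. This form peels off the innermost
    derivative, so the product, quotient and chain rules can be proved by induction on the order. *)
Fixpoint Ck (k : nat) V f : Prop :=
  (forall t, V t -> {for t, continuous f}) /\
  if k is k'.+1 then
    (forall t i, V t -> derivable f t (e_ i)) /\ (forall i, Ck k' V (partial i f))
  else True.

Lemma Ck_continuous k V f t : Ck k V f -> V t -> {for t, continuous f}.
Proof. by case: k => [|k] [cf _]; exact: cf. Qed.

Lemma CkW k V f : Ck k.+1 V f -> Ck k V f.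
Proof.
elim: k f => [|k IH] f [cf [df pf]]; split=> //.
by split=> // i; apply: IH.
Qed.

Lemma iter_partial_rcons (W : normedModType R) (s : seq 'I_d) i (f : 'rV[R]_d -> W) :
  iter_partial (rcons s i) f = iter_partial s (partial i f).
Proof. by elim: s => //= j s ->. Qed.

Lemma smooth_onP V f : smooth_on V f <-> forall k, Ck k V f.
Proof.
split=> [sf k|Cf s].
  elim: k f sf => [|k IH] f sf.
    by split=> // t Vt; have [] := sf [::] t Vt.
  split; first by move=> t Vt; have [] := sf [::] t Vt.
  split; first by move=> t i Vt; have [_] := sf [::] t Vt; apply.
  move=> i; apply: IH => s t Vt.
  by rewrite -iter_partial_rcons; exact: sf.
elim/last_ind: s f Cf => [|s i IH] f Cf t Vt.
  by have [cf [df _]] := Cf 1%N; split; [exact: cf | move=> i; exact: df].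
rewrite iter_partial_rcons; apply: IH => // k.
by have [_ [_]] := Cf k.+1; apply.
Qed.

(** Each clause of [Ck] is a condition at the points of the set on [f] and its own derivatives, so
    the order may be checked one point at a time. *)
Lemma Ck_local k V f :
  (forall t, V t -> exists V', V' t /\ Ck k V' f) -> Ck k V f.
Proof.
elim: k f => [|k IH] f H.
  by split=> // t /H[V' [V't [cf _]]]; exact: cf.
split; first by move=> t /H[V' [V't [cf _]]]; exact: cf.
split; first by move=> t i /H[V' [V't [_ [df _]]]]; exact: df.
move=> i; apply: IH => t /H[V' [V't [_ [_ pf]]]].
by exists V'; split=> //; exact: pf.
Qed.

Lemma near_open V (P : 'rV[R]_d -> Prop) t : open V -> V t ->
  (forall s, V s -> P s) -> \forall s \near t, P s.
Proof. by move=> oV Vt VP; apply: filterS VP _; exact: open_nbhs_nbhs. Qed.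

Lemma partial_eq V f g i t : open V -> V t -> (forall s, V s -> f s = g s) ->
  partial i f t = partial i g t.
Proof. move=> oV Vt fg; rewrite /partial; apply: near_eq_derive; exact: near_open fg. Qed.

Lemma Ck_eq k V f g : open V -> (forall t, V t -> f t = g t) ->
  Ck k V f -> Ck k V g.
Proof.
move=> oV; elim: k f g => [|k IH] f g fg [cf H].
  split=> // t Vt; have fgn : \forall s \near t, f s = g s by exact: near_open fg.
  rewrite /prop_for /continuous_at -fg //.
  exact: cvg_trans (near_eq_cvg fgn) (cf t Vt).
have [df pf] := H; split.
  move=> t Vt; have fgn : \forall s \near t, f s = g s by exact: near_open fg.
  rewrite /prop_for /continuous_at -fg //.
  exact: cvg_trans (near_eq_cvg fgn) (cf t Vt).
split=> [t i Vt|i].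
  by apply: near_eq_derivable (df t i Vt); exact: near_open fg.
by apply: IH (pf i) => t Vt; exact: partial_eq fg.
Qed.

Lemma Ck_differentiable k V f t : open V -> Ck k.+1 V f -> V t -> differentiable f t.
Proof.
move=> oV [cf [df pf]] Vt; apply: (differentiable_partials oV) => //.
by move=> i; exact: Ck_continuous (pf i) Vt.
Qed.

Lemma Ck_cst k V (a : R) : Ck k V (cst a).
Proof.
elim: k a => [|k IH] a; first by split=> // t _; exact: cst_continuous.
split; first by move=> t _; exact: cst_continuous.
split=> [t i _|i]; first exact: derivable_cst.
rewrite (_ : partial i (cst a) = cst (0 : R)) //.
by apply/funext => t; exact: derive_cst.
Qed.

Lemma partial_coord i j (t : 'rV[R]_d) :
  partial i (fun s : 'rV[R]_d => s 0 j) t = (i == j)%:R.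
Proof.
rewrite /partial deriveE; last exact: differentiable_coord.
rewrite (_ : 'd _ _ = (fun s : 'rV[R]_d => s 0 j) :> ('rV[R]_d -> R)).
  by rewrite mxE eqxx eq_sym.
pose L0 := (fun s : 'rV[R]_d => s 0 j) : 'rV[R]_d -> R.
have L0lin : linear L0 by move=> a u v; rewrite /L0 !mxE.
pose L0M := GRing.isLinear.Build _ _ _ _ _ L0lin.
pose L : {linear 'rV[R]_d -> R} := HB.pack L0 L0M.
by apply: (@diff_lin _ _ _ L); exact: coord_continuous.
Qed.

Lemma Ck_coord k V j : Ck k V (fun t => t 0 j).
Proof.
case: k => [|k]; first by split=> // t _; exact: coord_continuous.
split; first by move=> t _; exact: coord_continuous.
split=> [t i _|i].
  by apply: diff_derivable; exact: differentiable_coord.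
rewrite (_ : partial i _ = cst ((i == j)%:R : R)); first exact: Ck_cst.
by apply/funext => t; exact: partial_coord.
Qed.

Lemma Ck_add k V f g : open V -> Ck k V f -> Ck k V g -> Ck k V (fun t => f t + g t).
Proof.
move=> oV; elim: k f g => [|k IH] f g [cf Hf] [cg Hg].
  by split=> // t Vt; apply: continuousD; [exact: cf | exact: cg].
split; first by move=> t Vt; apply: continuousD; [exact: cf | exact: cg].
have [df pf] := Hf; have [dg pg] := Hg.
split=> [t i Vt|i]; first by apply: derivableD; [exact: df | exact: dg].
apply: (Ck_eq oV _ (IH _ _ (pf i) (pg i))) => t Vt.
by rewrite /partial [RHS]deriveD //; [exact: df | exact: dg].
Qed.

Lemma Ck_mul k V f g : open V -> Ck k V f -> Ck k V g -> Ck k V (fun t => f t * g t).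
Proof.
move=> oV; elim: k f g => [|k IH] f g Cf Cg.
  have [cf _] := Cf; have [cg _] := Cg.
  by split=> // t Vt; apply: continuousM; [exact: cf | exact: cg].
have [cf [df pf]] := Cf; have [cg [dg pg]] := Cg.
split; first by move=> t Vt; apply: continuousM; [exact: cf | exact: cg].
split=> [t i Vt|i]; first by apply: derivableM; [exact: df | exact: dg].
have := Ck_add oV (IH _ _ (CkW Cf) (pg i)) (IH _ _ (CkW Cg) (pf i)).
apply: (Ck_eq oV) => t Vt.
by rewrite /partial [RHS]deriveM //; [exact: df | exact: dg].
Qed.

Lemma Ck_opp k V f : open V -> Ck k V f -> Ck k V (fun t => - f t).
Proof.
move=> oV Cf; apply: (Ck_eq oV _ (Ck_mul oV (Ck_cst k V (-1)) Cf)) => t _.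
by rewrite /= mulN1r.
Qed.

Lemma Ck_inv k V f : open V -> (forall t, V t -> f t != 0) -> Ck k V f ->
  Ck k V (fun t => (f t)^-1).
Proof.
move=> oV f0; elim: k => [|k IH] Cf.
  have [cf _] := Cf.
  by split=> // t Vt; apply: continuousV; [exact: f0 | exact: cf].
have [cf [df pf]] := Cf.
split; first by move=> t Vt; apply: continuousV; [exact: f0 | exact: cf].
split=> [t i Vt|i]; first by apply: derivableV; [exact: f0 | exact: df].
have Ci := IH (CkW Cf).
apply: (Ck_eq oV _ (Ck_opp oV (Ck_mul oV (Ck_mul oV Ci Ci) (pf i)))) => t Vt.
rewrite /partial [RHS]deriveV //; [|exact: f0 | exact: df].
by rewrite /GRing.scale /= expr2 invfM mulNr.
Qed.

Lemma Ck_sum k V (I : Type) (r : seq I) (f : I -> 'rV[R]_d -> R) : open V ->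
  (forall i, Ck k V (f i)) -> Ck k V (fun t => \sum_(i <- r) f i t).
Proof.
move=> oV Cf; elim: r => [|i r IH].
  by apply: (Ck_eq oV _ (Ck_cst k V 0)) => t _; rewrite big_nil.
by apply: (Ck_eq oV _ (Ck_add oV (Cf i) IH)) => t _; rewrite big_cons.
Qed.

Lemma Ck_prod k V (I : Type) (r : seq I) (f : I -> 'rV[R]_d -> R) : open V ->
  (forall i, Ck k V (f i)) -> Ck k V (fun t => \prod_(i <- r) f i t).
Proof.
move=> oV Cf; elim: r => [|i r IH].
  by apply: (Ck_eq oV _ (Ck_cst k V 1)) => t _; rewrite big_nil.
by apply: (Ck_eq oV _ (Ck_mul oV (Cf i) IH)) => t _; rewrite big_cons.
Qed.

(** Near each point [f] has a constant sign, so the absolute value is locally [f] or [- f]. Volume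
    factors |det| of frames are treated in this way. *)
Lemma Ck_norm k V f : open V -> (forall t, V t -> f t != 0) -> Ck k V f ->
  Ck k V (fun t => `|f t|).
Proof.
move=> oV f0 Cf; apply: Ck_local => t Vt.
have ct := Ck_continuous Cf Vt.
have sub V' : V' `<=` V -> Ck k V' f.
  by move=> V'V; apply: Ck_local => s /V'V Vs; exists V.
have opn (P : set R) : open P -> open (V `&` f @^-1` P).
  move=> oP; rewrite openE => s [Vs Ps]; apply: filterI; first exact: open_nbhs_nbhs.
  by apply: (Ck_continuous Cf Vs); exact: open_nbhs_nbhs.
have [fn|fp|f00] := ltgtP (f t) 0; last by have := f0 _ Vt; rewrite f00 eqxx.
- exists (V `&` f @^-1` [set x | x < 0]); split=> //.
  have oV' := opn [set x : R | x < 0] (@open_lt _ _).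
  apply: (Ck_eq oV' _ (Ck_opp oV' (sub _ _))); last exact: subIsetl.
  by move=> s [_ /ltW /ler0_norm].
- exists (V `&` f @^-1` [set x | x > 0]); split=> //.
  have oV' := opn [set x : R | x > 0] (@open_gt _ _).
  apply: (Ck_eq oV' _ (sub _ _)); last exact: subIsetl.
  by move=> s [_ /ltW /ger0_norm].
Qed.

End Ck.

Lemma mx_continuous (R : realType) (T : topologicalType) (m n : nat)
    (M : T -> 'M[R]_(m, n)) (x : T) :
  (forall i j, {for x, continuous (fun t => M t i j)}) -> {for x, continuous M}.
Proof.
move=> cM A [P nP sPA].
have H : \forall t \near x, forall ij : 'I_m * 'I_n, P ij.1 ij.2 (M t ij.1 ij.2).
  apply: (@filter_forall _ _ (fun (ij : 'I_m * 'I_n) t => P ij.1 ij.2 (M t ij.1 ij.2))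
    _ (nbhs_filter x)) => -[i j] /=.
  by apply: cM; exact: nP.
by apply: filterS H => t Pt; apply: sPA => i j; exact: (Pt (i, j)).
Qed.

(** * Chain rule and symmetry of second derivatives *)

Section Chain.
Variables (R : realType).

Lemma derive_line0 (V W : normedModType R) (f : V -> W) (t v : V) :
  'D_v f t = 'D_1 (fun h : R => f (h *: v + t)) 0.
Proof.
rewrite /derive.
have -> : (fun h : R => h^-1 *: (((fun h : R => f (h *: v + t)) \o shift 0) (h *: 1)
    - f (0 *: v + t))) = (fun h : R => h^-1 *: ((f \o shift t) (h *: v) - f t)).
  by apply/funext => h /=; rewrite addr0 scale0r add0r [h *: 1]mulr1.
by [].
Qed.

(** Only a directional derivative of [tau] is available. Restricting to the line through [t] makes
    it a function of one real variable, for which derivability is differentiability and the chain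
    rule for differentials applies. *)
Lemma is_derive_comp_diff (V W : normedModType R) (m : nat)
    (F : 'rV[R]_m -> W) (tau : V -> 'rV[R]_m) (t v : V) :
  differentiable F (tau t) -> derivable tau t v ->
  is_derive t v (F \o tau) ('d F (tau t) ('D_v tau t)).
Proof.
move=> dF dtau; pose c (h : R) := tau (h *: v + t).
have c0 : c 0 = tau t by rewrite /c scale0r add0r.
have dc : differentiable c 0 by exact: (derivable1_diffP c 0).1 ((derivable1P tau t v).1 dtau).
have dF' : differentiable F (c 0) by rewrite c0.
have dFc : differentiable (F \o c) 0 by exact: differentiable_comp.
have D1 : derivable (F \o c) 0 1 by exact: (derivable1_diffP (F \o c) 0).2.
have D2 : derivable (F \o tau) t v by exact: (derivable1P (F \o tau) t v).2.
apply: (DeriveDef D2).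
have E1 : 'D_1 (F \o c) 0 = 'd (F \o c) 0 1 by exact: deriveE.
have E2 : 'D_1 c 0 = 'd c 0 1 by exact: deriveE.
have E3 := diff_comp dc dF'.
have E4 : 'D_v (F \o tau) t = 'D_1 (F \o c) 0 := derive_line0 (F \o tau) t v.
have E5 : 'D_v tau t = 'D_1 c 0 := derive_line0 tau t v.
by rewrite E4 E5 E1 E2 E3 /= c0.
Qed.

Lemma is_derive_chain (V : normedModType R) (m : nat)
    (F : 'rV[R]_m -> R) (tau : V -> 'rV[R]_m) (t v : V) :
  differentiable F (tau t) -> (forall j, derivable (fun s => tau s 0 j) t v) ->
  is_derive t v (fun s => F (tau s))
    (\sum_j partial j F (tau t) * 'D_v (fun s => tau s 0 j) t).
Proof.
move=> dF dtau.
have dtau' : derivable tau t v.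
  by apply/derivable_mxP => i j; rewrite ord1; exact: dtau.
have -> : \sum_j partial j F (tau t) * 'D_v (fun s => tau s 0 j) t =
    'd F (tau t) ('D_v tau t).
  rewrite (derive_mx dtau') [X in _ = 'd F _ X]row_sum_delta linear_sum /=.
  apply: eq_bigr => j _; rewrite linearZ /= mxE /partial deriveE // mulrC.
  by [].
exact: is_derive_comp_diff.
Qed.

Lemma Ck_comp (d m k : nat) (V : set 'rV[R]_d) (V2 : set 'rV[R]_m)
    (F : 'rV[R]_m -> R) (tau : 'rV[R]_d -> 'rV[R]_m) :
  open V -> open V2 -> (forall t, V t -> V2 (tau t)) ->
  Ck k V2 F -> (forall j, Ck k V (fun t => tau t 0 j)) ->
  Ck k V (fun t => F (tau t)).
Proof.
move=> oV oV2 VV2; elim: k F => [|k IH] F CF Ctau.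
  split=> // t Vt; apply: continuous_comp.
    by apply: mx_continuous => i j; rewrite ord1; exact: Ck_continuous (Ctau j) Vt.
  by apply: (Ck_continuous CF); exact: VV2.
have ctau t : V t -> {for t, continuous tau}.
  by move=> Vt; apply: mx_continuous => i j; rewrite ord1; exact: Ck_continuous (Ctau j) Vt.
have dtau t i j : V t -> derivable (fun s => tau s 0 j) t (delta_mx 0 i).
  by move=> Vt; have [_ [dt _]] := Ctau j; exact: dt.
have dF t : V t -> differentiable F (tau t).
  by move=> Vt; exact: Ck_differentiable oV2 CF (VV2 _ Vt).
split.
  move=> t Vt; apply: continuous_comp; first exact: ctau.
  by apply: (Ck_continuous CF); exact: VV2.
split=> [t i Vt|i].
  by have [] := is_derive_chain (dF _ Vt) (fun j => dtau t i j Vt).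
have [_ [_ pF]] := CF.
apply: (@Ck_eq _ _ _ _ (fun t => \sum_j partial j F (tau t) *
    partial i (fun s => tau s 0 j) t)) => //.
  move=> t Vt; have H := is_derive_chain (dF _ Vt) (fun j => dtau t i j Vt).
  by rewrite /partial [RHS]derive_val.
apply: Ck_sum => // j; apply: Ck_mul => //.
  by apply: IH; [exact: pF | move=> l; exact: CkW].
by have [_ [_ pt]] := Ctau j; exact: pt.
Qed.

(** A mean value along [i] for the difference [phi] in direction [j], then one along [j]. Two steps
    of length [r / 4] stay in the ball. The left-hand side is symmetric in [i] and [j]. *)
Lemma second_difference (d : nat) (f : 'rV[R]_d -> R) (V : set 'rV[R]_d) t (r : R) i j :
  Ck 2 V f -> 0 < r -> ball t r `<=` V ->
  let h := r / 4 in
  exists2 s, ball t r s &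
    f (t + h *: delta_mx 0 i + h *: delta_mx 0 j) - f (t + h *: delta_mx 0 i)
    - f (t + h *: delta_mx 0 j) + f t = h ^+ 2 * partial j (partial i f) s.
Proof.
move=> [cf [df pf]] r0 bV h.
set ei : 'rV[R]_d := delta_mx 0 i; set ej : 'rV[R]_d := delta_mx 0 j.
have nd k : `|delta_mx 0 k : 'rV[R]_d| <= 1.
  rewrite [leLHS]/Num.Def.normr /= mx_normrE; apply: bigmax_le => //= -[a b] _ /=.
  by rewrite !mxE; case: (_ && _); rewrite ?normr1 ?normr0.
have h0 : 0 < h by rewrite divr_gt0.
have inb (a b : R) : `|a| <= `|h| -> `|b| <= `|h| -> ball t r (t + a *: ei + b *: ej).
  move=> ha hb; rewrite -ball_normE /= -addrA opprD addrA subrr sub0r normrN.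
  apply: le_lt_trans (ler_normD _ _) _; rewrite !normrZ.
  have H (c : R) k : `|c| <= `|h| -> `|c| * `|delta_mx 0 k : 'rV[R]_d| <= h.
    move=> hc; rewrite -[leRHS]mulr1 -[X in _ <= X * 1](ger0_norm (ltW h0)).
    exact: ler_pM.
  apply: le_lt_trans (lerD (H _ _ ha) (H _ _ hb)) _.
  by rewrite /h; lra.
pose phi (p : 'rV[R]_d) := f (p + h *: ej) - f p.
have z0 : `|0 : R| <= `|h| by rewrite normr0.
have dshift (p v w : 'rV[R]_d) : derivable f (p + w) v ->
    is_derive p v (fun p => f (p + w)) ('D_v f (p + w)).
  move=> dfw.
  have E : (fun k : R => k^-1 *: (((fun p : 'rV[R]_d => f (p + w)) \o shift p) (k *: v) - f (p + w)))
     = (fun k : R => k^-1 *: ((f \o shift (p + w)) (k *: v) - f (p + w))).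
    by apply/funext => k /=; rewrite addrA.
  by apply: DeriveDef; [rewrite /derivable E | rewrite /derive E].
have dphi c : `|c| <= `|h| -> is_derive (t + c *: ei) ei phi
    (partial i f (t + c *: ei + h *: ej) - partial i f (t + c *: ei)).
  move=> hc; rewrite /phi; apply: is_deriveB.
    by apply: dshift; apply: df; apply: bV; exact: inb.
  apply: derivableP; apply: df; apply: bV.
  by rewrite -[_ + _]addr0 -(scale0r ej); exact: inb.
have [|c hc E1] := @mvt_line R _ phi t ei h.
  by move=> s /dphi [].
have [_ E2] := dphi _ hc.
have [cpf [dpf ppf]] := pf i.
have [|c' hc' E3] := @mvt_line R _ (partial i f) (t + c *: ei) ej h.
  by move=> s hs; apply: dpf; apply: bV; exact: inb.
exists (t + c *: ei + c' *: ej); first exact: inb.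
rewrite expr2 -mulrA -[partial j _ _]/('D_ej (partial i f) (t + c *: ei + c' *: ej)).
rewrite -E3 -E2 -E1 /phi opprB addrA addrAC -!addrA; congr (_ + _).
Qed.

(** The same second difference, evaluated in the two orders, equates the two mixed derivatives at
    points [s] and [s'] arbitrarily close to [t]; continuity brings them to [t]. *)
Lemma partialC (d : nat) (f : 'rV[R]_d -> R) (V : set 'rV[R]_d) i j t :
  open V -> Ck 2 V f -> V t -> partial i (partial j f) t = partial j (partial i f) t.
Proof.
move=> oV Cf Vt; apply/eqP; rewrite -subr_eq0 -normr_le0; apply/ler_addgt0Pr => e e0.
have cA (k l : 'I_d) : {for t, continuous (partial k (partial l f))}.
  by have [_ [_ pf]] := Cf; have [_ [_ ppf]] := pf l; exact: (@Ck_continuous _ _ 0%N _ _ _ (ppf k) Vt).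
have near k l : \forall s \near t,
    `|partial k (partial l f) t - partial k (partial l f) s| <= e / 2.
  by have /cvgrPdist_le := cA k l; apply; rewrite divr_gt0.
have : \forall s \near t, V s /\
   (`|partial i (partial j f) t - partial i (partial j f) s| <= e / 2 /\
   `|partial j (partial i f) t - partial j (partial i f) s| <= e / 2).
  apply: filterI; first exact: open_nbhs_nbhs.
  by apply: filterI; exact: near.
move=> /nbhs_ballP [r r0 Hr].
have bV : ball t r `<=` V by move=> s /Hr[].
have [s bs Es] := second_difference j i Cf r0 bV.
have [s' bs' Es'] := second_difference i j Cf r0 bV.
have Ess : partial i (partial j f) s = partial j (partial i f) s'.
  have h0 : (r / 4) ^+ 2 != 0 by rewrite expf_neq0 // gt_eqF // divr_gt0.
  apply: (mulfI h0); apply: etrans (esym Es) _; apply: etrans _ Es'.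
  by congr (_ + _); rewrite [LHS]addrAC; congr (f _ - _ - _); rewrite addrAC.
have [_ [H1 _]] := Hr _ bs; have [_ [_ H2]] := Hr _ bs'.
rewrite -(subrKA (partial i (partial j f) s)) add0r [leRHS]splitr.
apply: le_trans (ler_normD _ _) _; apply: lerD; first exact: H1.
by rewrite Ess distrC.
Qed.

End Chain.

(** * Closure properties of smooth functions *)

Section SmoothCalculus.
Variables (R : realType) (d : nat).
Implicit Types (V : set 'rV[R]_d) (f g : 'rV[R]_d -> R).

Lemma smooth_cst V (a : R) : smooth_on V (fun=> a : R).
Proof. by apply/smooth_onP => k; exact: Ck_cst. Qed.

Lemma smooth_coord V j : smooth_on V (fun t => t 0 j).
Proof. by apply/smooth_onP => k; exact: Ck_coord. Qed.

Lemma smooth_add V f g : open V -> smooth_on V f -> smooth_on V g ->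
  smooth_on V (fun t => f t + g t).
Proof.
move=> oV /smooth_onP Cf /smooth_onP Cg.
by apply/smooth_onP => k; exact: Ck_add.
Qed.

Lemma smooth_mul V f g : open V -> smooth_on V f -> smooth_on V g ->
  smooth_on V (fun t => f t * g t).
Proof.
move=> oV /smooth_onP Cf /smooth_onP Cg.
by apply/smooth_onP => k; exact: Ck_mul.
Qed.

Lemma smooth_opp V f : open V -> smooth_on V f -> smooth_on V (fun t => - f t).
Proof. by move=> oV /smooth_onP Cf; apply/smooth_onP => k; exact: Ck_opp. Qed.

Lemma smooth_sub V f g : open V -> smooth_on V f -> smooth_on V g ->
  smooth_on V (fun t => f t - g t).
Proof. by move=> oV sf sg; exact: (smooth_add oV sf (smooth_opp oV sg)). Qed.

Lemma smooth_inv V f : open V -> (forall t, V t -> f t != 0) -> smooth_on V f ->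
  smooth_on V (fun t => (f t)^-1).
Proof. by move=> oV f0 /smooth_onP Cf; apply/smooth_onP => k; exact: Ck_inv. Qed.

Lemma smooth_norm V f : open V -> (forall t, V t -> f t != 0) -> smooth_on V f ->
  smooth_on V (fun t => `|f t|).
Proof. by move=> oV f0 /smooth_onP Cf; apply/smooth_onP => k; exact: Ck_norm. Qed.

Lemma smooth_sum V (I : Type) (r : seq I) (f : I -> 'rV[R]_d -> R) : open V ->
  (forall i, smooth_on V (f i)) -> smooth_on V (fun t => \sum_(i <- r) f i t).
Proof.
move=> oV Cf; apply/smooth_onP => k; apply: Ck_sum => // i.
by have /smooth_onP := Cf i; apply.
Qed.

Lemma smooth_prod V (I : Type) (r : seq I) (f : I -> 'rV[R]_d -> R) : open V ->
  (forall i, smooth_on V (f i)) -> smooth_on V (fun t => \prod_(i <- r) f i t).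
Proof.
move=> oV Cf; apply/smooth_onP => k; apply: Ck_prod => // i.
by have /smooth_onP := Cf i; apply.
Qed.

Lemma smooth_det V (m : nat) (A : 'rV[R]_d -> 'M[R]_m) : open V ->
  (forall i j, smooth_on V (fun t => A t i j)) -> smooth_on V (fun t => \det (A t)).
Proof.
move=> oV sA; rewrite /determinant; apply: smooth_sum => // s.
apply: smooth_mul => //; first exact: smooth_cst.
exact: smooth_prod.
Qed.

Lemma smooth_partial V (W : normedModType R) (f : 'rV[R]_d -> W) i :
  smooth_on V f -> smooth_on V (partial i f).
Proof. by move=> sf s t Vt; rewrite -iter_partial_rcons; exact: sf. Qed.

Lemma smooth_eq V f g : open V -> (forall t, V t -> f t = g t) ->
  smooth_on V f -> smooth_on V g.
Proof.
by move=> oV fg /smooth_onP Cf; apply/smooth_onP => k; exact: Ck_eq (Cf k).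
Qed.

Lemma smooth_subset V V' (W : normedModType R) (f : 'rV[R]_d -> W) :
  V' `<=` V -> smooth_on V f -> smooth_on V' f.
Proof. by move=> sub sf s t /sub; exact: sf. Qed.

Lemma smooth_local V (W : normedModType R) (f : 'rV[R]_d -> W) :
  (forall t, V t -> exists V', V' t /\ smooth_on V' f) -> smooth_on V f.
Proof. by move=> H s t /H[V' [V't sf]]; exact: sf. Qed.

Lemma smooth_continuous V (W : normedModType R) (f : 'rV[R]_d -> W) t :
  smooth_on V f -> V t -> {for t, continuous f}.
Proof. by move=> sf Vt; have [] := sf [::] t Vt. Qed.

Lemma smooth_derivable V (W : normedModType R) (f : 'rV[R]_d -> W) t i :
  smooth_on V f -> V t -> derivable f t (delta_mx 0 i).
Proof. by move=> sf Vt; have [_] := sf [::] t Vt; apply. Qed.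

Lemma smooth_differentiable V f t : open V -> smooth_on V f -> V t ->
  differentiable f t.
Proof. by move=> oV /smooth_onP /(_ 1%N); exact: Ck_differentiable. Qed.

Lemma smooth_partialC V f i j t : open V -> smooth_on V f -> V t ->
  partial i (partial j f) t = partial j (partial i f) t.
Proof. by move=> oV /smooth_onP /(_ 2%N); exact: partialC. Qed.

Lemma iter_partial_eq V (W : normedModType R) (f g : 'rV[R]_d -> W) s t :
  open V -> (forall t, V t -> f t = g t) -> V t ->
  iter_partial s f t = iter_partial s g t.
Proof.
move=> oV fg; elim: s t => [|i s IH] t Vt /=; first exact: fg.
by apply: near_eq_derive; exact: near_open oV Vt IH.
Qed.

Lemma derivable_linear (U W : normedModType R) (l : {linear U -> W})
    (f : 'rV[R]_d -> U) t v : continuous l -> derivable f t v ->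
  is_derive t v (fun s => l (f s)) (l ('D_v f t)).
Proof.
move=> cl df.
have E : (fun h : R => h^-1 *: (((fun s => l (f s)) \o shift t) (h *: v) - l (f t))) =
    l \o (fun h : R => h^-1 *: ((f \o shift t) (h *: v) - f t)).
  by apply/funext => h; rewrite [RHS]/= linearZZ [in RHS]linearB.
have H : l \o (fun h : R => h^-1 *: ((f \o shift t) (h *: v) - f t)) @ 0^'
     --> l ('D_v f t).
  exact: cvg_comp df (cl _).
apply: DeriveDef; first by rewrite /derivable E; apply/cvg_ex; exists (l ('D_v f t)).
by rewrite /derive E; apply: cvg_lim.
Qed.

Lemma iter_partial_linear V (U W : normedModType R) (l : {linear U -> W})
    (f : 'rV[R]_d -> U) s t : open V -> continuous l -> smooth_on V f -> V t ->
  iter_partial s (fun t => l (f t)) t = l (iter_partial s f t).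
Proof.
move=> oV cl sf; elim: s t => [//|i s IH] t Vt /=.
rewrite /partial (near_eq_derive _ (near_open oV Vt IH)).
have df : derivable (iter_partial s f) t (delta_mx 0 i) by have [_] := sf s t Vt; apply.
by have [_ ->] := derivable_linear cl df.
Qed.

Lemma smooth_linear V (U W : normedModType R) (l : {linear U -> W})
    (f : 'rV[R]_d -> U) : open V -> continuous l -> smooth_on V f ->
  smooth_on V (fun t => l (f t)).
Proof.
move=> oV cl sf s t Vt; have [cf df] := sf s t Vt.
have E : forall t, V t -> l (iter_partial s f t) = iter_partial s (fun t => l (f t)) t.
  by move=> t' Vt'; rewrite (iter_partial_linear _ oV).
split.
  rewrite /prop_for /continuous_at -E //.
  apply: cvg_trans (near_eq_cvg (near_open oV Vt E)) _.
  by apply: continuous_cvg; [exact: cl | exact: cf].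
move=> i; apply: near_eq_derivable (near_open oV Vt E) _.
by have [] := derivable_linear cl (df i).
Qed.

Lemma iter_partial_row V (m : nat) (f : 'rV[R]_d -> 'rV[R]_m) s t : open V ->
  (forall j, smooth_on V (fun t => f t 0 j)) -> V t ->
  iter_partial s f t = \row_j iter_partial s (fun t => f t 0 j) t.
Proof.
move=> oV sf; elim: s t => [|i s IH] t Vt /=; first by apply/rowP => j; rewrite mxE.
rewrite /partial (near_eq_derive _ (near_open oV Vt IH)).
rewrite derive_mx.
  apply/rowP => j; rewrite !mxE.
  by congr ('D_ _ _ _); apply/funext => t'; rewrite mxE.
apply/derivable_mxP => a j.
rewrite (_ : (fun x => _) = iter_partial s (fun t => f t 0 j)).
  by have [_] := sf j s t Vt; apply.
by apply/funext => t'; rewrite mxE.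
Qed.

Lemma smooth_row V (m : nat) (f : 'rV[R]_d -> 'rV[R]_m) : open V ->
  (forall j, smooth_on V (fun t => f t 0 j)) -> smooth_on V f.
Proof.
move=> oV sf s t Vt.
have E : forall t, V t -> \row_j iter_partial s (fun t => f t 0 j) t = iter_partial s f t.
  by move=> t' Vt'; rewrite (iter_partial_row _ oV).
have cr : {for t, continuous
    (fun t => \row_j iter_partial s (fun t => f t 0 j) t : 'rV[R]_m)}.
  apply: mx_continuous => a j.
  rewrite (_ : (fun t => _) = iter_partial s (fun t => f t 0 j)).
    by have [] := sf j s t Vt.
  by apply/funext => t'; rewrite mxE.
split.
  rewrite /prop_for /continuous_at -E //.
  exact: cvg_trans (near_eq_cvg (near_open oV Vt E)) cr.
move=> i; apply: near_eq_derivable (near_open oV Vt E) _.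
apply/derivable_mxP => a j.
rewrite (_ : (fun x => _) = iter_partial s (fun t => f t 0 j)).
  by have [_] := sf j s t Vt; apply.
by apply/funext => t'; rewrite mxE.
Qed.

End SmoothCalculus.

Lemma smooth_comp (R : realType) (d m : nat) (V : set 'rV[R]_d) (V2 : set 'rV[R]_m)
    (F : 'rV[R]_m -> R) (tau : 'rV[R]_d -> 'rV[R]_m) :
  open V -> open V2 -> (forall t, V t -> V2 (tau t)) ->
  smooth_on V2 F -> (forall j, smooth_on V (fun t => tau t 0 j)) ->
  smooth_on V (fun t => F (tau t)).
Proof.
move=> oV oV2 VV2 /smooth_onP CF Ct; apply/smooth_onP => k.
by apply: (Ck_comp oV oV2 VV2 (CF k)) => j; have /smooth_onP := Ct j; apply.
Qed.

(** * First-order expansion in a parameter *)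

Section Taylor.
Variables (R : realType) (d : nat).

(** Time becomes the first coordinate of a longer row, so the calculus of partial derivatives covers
    families of functions too. *)
Definition time_row (s : R) (t : 'rV[R]_d) : 'rV[R]_(1 + d) := row_mx (const_mx s) t.

Definition time_idx : 'I_(1 + d) := lshift d 0.
Definition space_idx (i : 'I_d) : 'I_(1 + d) := rshift 1 i.

Definition slab (e : R) (V : set 'rV[R]_d) : set 'rV[R]_(1 + d) :=
  [set z : 'rV[R]_(1 + d) | `|z 0 time_idx| < e /\ V (rsubmx z)].

Lemma time_row_time_idx s t : time_row s t 0 time_idx = s.
Proof. by rewrite /time_row /time_idx row_mxEl mxE. Qed.

Lemma time_row_space s t i : time_row s t 0 (space_idx i) = t 0 i.
Proof. by rewrite /time_row /space_idx row_mxEr. Qed.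

Lemma rsubmx_time_row s t : rsubmx (time_row s t) = t.
Proof. exact: row_mxKr. Qed.

Lemma slab_time_row e V s t : `|s| < e -> V t -> slab e V (time_row s t).
Proof. by move=> se Vt; split; rewrite ?time_row_time_idx ?rsubmx_time_row. Qed.

Lemma rsubmx_continuous : continuous (rsubmx : 'rV[R]_(1 + d) -> 'rV[R]_d).
Proof.
move=> z; apply: mx_continuous => i j.
rewrite (_ : (fun z => _) = (fun z : 'rV[R]_(1 + d) => z i (rshift 1 j))).
  exact: coord_continuous.
by apply/funext => z'; rewrite mxE.
Qed.

Lemma open_slab e V : open V -> open (slab e V).
Proof.
move=> oV.
have -> : slab e V = ((fun z : 'rV[R]_(1 + d) => `|z 0 time_idx|) @^-1` [set x | x < e])
    `&` (rsubmx @^-1` V) by [].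
apply: openI.
  apply: open_comp; last exact: open_lt.
  move=> z _; apply: (@continuous_comp _ _ _ (fun z : 'rV[R]_(1 + d) => z 0 time_idx) Num.norm).
    exact: coord_continuous.
  exact: norm_continuous.
apply: (@open_comp _ _ rsubmx V) => // z _; exact: rsubmx_continuous.
Qed.

Lemma time_row_shift_time_idx s t h : h *: delta_mx 0 time_idx + time_row s t = time_row (h + s) t.
Proof.
apply/rowP => j; rewrite -(splitK j); case: (fintype.split j) => [a|a] /=.
  by rewrite (ord1 a) -/time_idx [LHS]mxE !time_row_time_idx [X in X + _]mxE [X in _ * X]mxE !eqxx mulr1.
by rewrite -/(space_idx a) [LHS]mxE !time_row_space [X in X + _]mxE [X in _ * X]mxE eqxx /= mulr0 add0r.
Qed.

Lemma time_row_shift_space s t i h :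
  h *: delta_mx 0 (space_idx i) + time_row s t = time_row s (h *: delta_mx 0 i + t).
Proof.
apply/rowP => j; rewrite -(splitK j); case: (fintype.split j) => [a|a] /=.
  by rewrite (ord1 a) -/time_idx [LHS]mxE !time_row_time_idx [X in X + _]mxE [X in _ * X]mxE eqxx /= mulr0 add0r.
rewrite -/(space_idx a) [LHS]mxE !time_row_space !mxE eqxx /=.
by rewrite /space_idx (inj_eq (@rshift_inj _ _)).
Qed.

Lemma partial_time_row (H : 'rV[R]_(1 + d) -> R) s t i :
  partial i (fun t => H (time_row s t)) t = partial (space_idx i) H (time_row s t).
Proof.
rewrite /partial /derive.
have -> : (fun h : R => h^-1 *: (((fun t => H (time_row s t)) \o shift t) (h *: delta_mx 0 i)
    - H (time_row s t))) =
  (fun h : R => h^-1 *: ((H \o shift (time_row s t)) (h *: delta_mx 0 (space_idx i)) - H (time_row s t))).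
  by apply/funext => h /=; rewrite time_row_shift_space.
by [].
Qed.

Lemma smooth_time_row e V (H : 'rV[R]_(1 + d) -> R) s : open V -> `|s| < e ->
  smooth_on (slab e V) H -> smooth_on V (fun t => H (time_row s t)).
Proof.
move=> oV se sH; apply: (smooth_comp oV (open_slab oV) _ sH).
  by move=> t; exact: slab_time_row.
move=> j; rewrite -(splitK j); case: (fintype.split j) => [a|a] /=.
  rewrite (ord1 a) -/time_idx; under eq_fun do rewrite time_row_time_idx.
  exact: smooth_cst.
rewrite -/(space_idx a); under eq_fun do rewrite time_row_space.
exact: smooth_coord.
Qed.

Definition taylor_rest (H : 'rV[R]_(1 + d) -> R) s : 'rV[R]_d -> R :=
  fun t => H (time_row s t) - H (time_row 0 t) - s * partial time_idx H (time_row 0 t).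

(** Mixed derivatives commute, so a space derivative of the remainder is the remainder of the space
    derivative. Bounds of every order thus follow from the bound of order zero. *)
Lemma partial_taylor_rest e V H s t i : open V -> `|s| < e ->
  smooth_on (slab e V) H -> V t ->
  partial i (taylor_rest H s) t = taylor_rest (partial (space_idx i) H) s t.
Proof.
move=> oV se sH Vt.
have e0 : `|0 : R| < e by rewrite normr0; apply: le_lt_trans se.
have d1 s' : `|s'| < e -> derivable (fun t => H (time_row s' t)) t (delta_mx 0 i).
  by move=> s'e; exact: (smooth_derivable (smooth_time_row oV s'e sH) Vt).
have d2 : derivable (fun t => partial time_idx H (time_row 0 t)) t (delta_mx 0 i).
  exact: (smooth_derivable (smooth_time_row oV e0 (smooth_partial time_idx sH)) Vt).
have d3 : derivable (fun t => s * partial time_idx H (time_row 0 t)) t (delta_mx 0 i).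
  by apply: derivableM; first exact: derivable_cst.
have E3 : 'D_(delta_mx 0 i) (fun t => s * partial time_idx H (time_row 0 t)) t =
    s * 'D_(delta_mx 0 i) (fun t => partial time_idx H (time_row 0 t)) t.
  have := deriveM (derivable_cst (s : R) t (delta_mx 0 i)) d2.
  by rewrite derive_cst scaler0 addr0.
rewrite /taylor_rest.
rewrite -(@smooth_partialC _ _ (slab e V)) //; last 2 first.
- exact: open_slab.
- exact: slab_time_row.
rewrite -!partial_time_row /partial.
rewrite deriveB; [|apply: derivableB; exact: d1|exact: d3].
rewrite deriveB; [|exact: d1|exact: d1].
by rewrite E3.
Qed.

Lemma compact_time_row (a : R) (L : set 'rV[R]_d) : compact L ->
  compact [set z | exists s t, [/\ `|s| <= a, L t & z = time_row s t]].
Proof.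
move=> cL.
have -> : [set z | exists s t, [/\ `|s| <= a, L t & z = time_row s t]] =
   (fun p : R * 'rV[R]_d => time_row p.1 p.2) @` (`[- a, a] `*` L).
  apply/seteqP; split=> [z [s [t [sa Lt ->]]]|z [[s t] [/= sa Lt] <-]].
    by exists (s, t) => //; split=> //=; rewrite in_itv /= -ler_norml.
  by exists s, t; split=> //; move: sa; rewrite in_itv /= -ler_norml.
apply: continuous_compact; last by apply: compact_setX => //; exact: segment_compact.
apply: continuous_subspaceT => p; apply: mx_continuous => i j.
rewrite (ord1 i) -(splitK j); case: (fintype.split j) => [b|b] /=.
  rewrite (ord1 b) -/time_idx (_ : (fun p => _) = fst); first exact: cvg_fst.
  by apply/funext => p'; rewrite time_row_time_idx.
rewrite (_ : (fun p : R * 'rV[R]_d => _) = fun p : R * 'rV[R]_d => p.2 0 b); last first.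
  by apply/funext => p'; rewrite time_row_space.
apply: (@continuous_comp _ _ _ snd (fun t : 'rV[R]_d => t 0 b)); first exact: cvg_snd.
exact: coord_continuous.
Qed.

Lemma compact_bound (T : topologicalType) (A : set T) (f : T -> R) : compact A ->
  (forall x, A x -> {for x, continuous f}) ->
  exists2 C, 0 <= C & forall x, A x -> `|f x| <= C.
Proof.
move=> cA cf.
have : compact (f @` A).
  by apply: continuous_compact => //; apply: continuous_in_subspaceT => x /set_mem; exact: cf.
move=> /compact_bounded [M [Mr HM]]; exists (`|M| + 1); first by rewrite addr_ge0.
move=> x Ax; apply: HM; last by exists x.
by rewrite (le_lt_trans (ler_norm M)) // ltrDl.
Qed.

(** In order zero, two mean values in time express the remainder as [s * c] times a second time
    derivative with |c| <= |s|. Shrinking [e] to [e'] makes the relevant set of times and points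
    compact, hence that derivative bounded. Higher orders apply this to the space derivatives,
    summing the constants in place of taking their maximum. *)
Lemma taylor_iter e e' V H L (k : nat) : open V -> 0 <= e' < e ->
  smooth_on (slab e V) H -> compact L -> L `<=` V ->
  exists2 C, 0 <= C & forall (a : seq 'I_d) s t, (size a <= k)%N -> L t -> `|s| <= e' ->
    `|iter_partial a (taylor_rest H s) t| <= C * s ^+ 2.
Proof.
move=> oV /andP[e'0 e'e] sH cL LV.
have base K : smooth_on (slab e V) K -> exists2 C, 0 <= C &
    forall s t, L t -> `|s| <= e' -> `|taylor_rest K s t| <= C * s ^+ 2.
  move=> sK.
  have sub : [set z | exists s t, [/\ `|s| <= e', L t & z = time_row s t]] `<=` slab e V.
    move=> z [s [t [se Lt ->]]]; apply: slab_time_row; last exact: LV.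
    exact: le_lt_trans se e'e.
  have [C C0 HC] := @compact_bound _ _ (partial time_idx (partial time_idx K))
    (compact_time_row (a := e') cL) (fun z Az => smooth_continuous
      (smooth_partial time_idx (smooth_partial time_idx sK)) (sub z Az)).
  exists C => // s t Lt se.
  have dl K' r : smooth_on (slab e V) K' -> `|r| <= e' ->
      derivable K' (time_row 0 t + r *: delta_mx 0 time_idx) (delta_mx 0 time_idx).
    move=> sK' re; rewrite addrC time_row_shift_time_idx addr0.
    apply: (smooth_derivable sK'); apply: slab_time_row; last exact: LV.
    exact: le_lt_trans re e'e.
  have [|c hc E1] := @mvt_line R _ K (time_row 0 t) (delta_mx 0 time_idx) s.
    by move=> r rs; apply: dl => //; exact: le_trans rs se.
  have ce := le_trans hc se.
  have [|c' hc' E2] := @mvt_line R _ (partial time_idx K) (time_row 0 t) (delta_mx 0 time_idx) c.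
    by move=> r rs; apply: dl; [exact: smooth_partial | exact: le_trans rs ce].
  have -> : taylor_rest K s t = s * (c * partial time_idx (partial time_idx K) (time_row c' t)).
    have E3 : K (time_row s t) - K (time_row 0 t) = s * partial time_idx K (time_row c t).
      by move: E1; rewrite ![_ + _ *: _]addrC !time_row_shift_time_idx !addr0.
    rewrite /taylor_rest E3 -mulrBr; congr (_ * _).
    by move: E2; rewrite ![_ + _ *: _]addrC !time_row_shift_time_idx !addr0.
  rewrite !normrM -[s ^+ 2]real_normK ?num_real // expr2 mulrC mulrA ler_wpM2r //.
  rewrite mulrC; apply: ler_pM => //.
    by apply: HC; exists c', t; split=> //; exact: le_trans hc' ce.
elim: k H sH => [|k IH] H sH.
  have [C C0 HC] := base H sH; exists C => // -[|//] s t _ Lt se /=; exact: HC.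
have [C C0 HC] := base H sH.
have Hi i : {C : R | 0 <= C & forall (a : seq 'I_d) s t, (size a <= k)%N -> L t ->
    `|s| <= e' -> `|iter_partial a (taylor_rest (partial (space_idx i) H) s) t| <= C * s ^+ 2}.
  by apply/cid2/IH; exact: smooth_partial.
pose D i : R := s2val (Hi i).
have D0 i : 0 <= D i by rewrite /D; case: (Hi i).
have HD i : forall (a : seq 'I_d) s t, (size a <= k)%N -> L t ->
    `|s| <= e' -> `|iter_partial a (taylor_rest (partial (space_idx i) H) s) t| <= D i * s ^+ 2.
  by rewrite /D; case: (Hi i).
exists (C + \sum_i D i); first by rewrite addr_ge0 // sumr_ge0.
move=> a s t; case/lastP: a => [_ Lt se /=|a i].
  apply: le_trans (HC _ _ Lt se) _; rewrite ler_wpM2r ?sqr_ge0 // lerDl.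
  exact: sumr_ge0.
rewrite size_rcons ltnS => ak Lt se; rewrite iter_partial_rcons.
have se' : `|s| < e by exact: le_lt_trans se e'e.
rewrite (iter_partial_eq a oV (g := taylor_rest (partial (space_idx i) H) s)).
- apply: le_trans (HD i _ _ _ ak Lt se) _; rewrite ler_wpM2r ?sqr_ge0 //.
  rewrite (bigD1 i) //= addrCA lerDl addr_ge0 // sumr_ge0 //.
- by move=> t' Vt'; exact: partial_taylor_rest se' sH Vt'.
- exact: LV.
Qed.

End Taylor.

Arguments time_idx {d}.

(** * Coordinates on the ambient space *)

Section Coordinates.
Variables (R : realType) (n : nat).

Local Notation E := (ambient R n).
Local Notation N := (1 + dimX1 n)%N.

Lemma ambient_dim : ((1 + n) + (1 + n) = N)%N.
Proof. by rewrite /dimX1 -addnn !add1n addSn addnS. Qed.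

Definition x_idx (i : 'I_(1 + n)) : 'I_N := cast_ord ambient_dim (lshift (1 + n) i).
Definition y_idx (i : 'I_(1 + n)) : 'I_N := cast_ord ambient_dim (rshift (1 + n) i).

Variant idx_spec : 'I_N -> Type :=
  | IdxX i : idx_spec (x_idx i)
  | IdxY i : idx_spec (y_idx i).

Lemma idxP j : idx_spec j.
Proof.
rewrite -(cast_ordKV ambient_dim j) -(splitK (cast_ord (esym ambient_dim) j)).
by case: (fintype.split _) => i; [exact: IdxX | exact: IdxY].
Qed.

(* The index of the coordinate paired with [j] in [quad]. *)
Definition swap (j : 'I_N) : 'I_N :=
  match fintype.split (cast_ord (esym ambient_dim) j) with
  | inl i => y_idx i
  | inr i => x_idx i
  end.

Lemma split_x_idx i : fintype.split (cast_ord (esym ambient_dim) (x_idx i)) = inl i.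
Proof. by rewrite /x_idx cast_ordK -[lshift _ _]/(unsplit (inl i)) unsplitK. Qed.

Lemma split_y_idx i : fintype.split (cast_ord (esym ambient_dim) (y_idx i)) = inr i.
Proof. by rewrite /y_idx cast_ordK -[rshift _ _]/(unsplit (inr i)) unsplitK. Qed.

Lemma swap_x_idx i : swap (x_idx i) = y_idx i. Proof. by rewrite /swap split_x_idx. Qed.
Lemma swap_y_idx i : swap (y_idx i) = x_idx i. Proof. by rewrite /swap split_y_idx. Qed.

Lemma swapK : involutive swap.
Proof. by move=> j; case: (idxP j) => i; rewrite ?(swap_x_idx, swap_y_idx). Qed.

Lemma x_idx_inj : injective x_idx.
Proof. by move=> i j /(congr1 (fun a => fintype.split (cast_ord (esym ambient_dim) a))); rewrite !split_x_idx => -[]. Qed.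

Lemma y_idx_inj : injective y_idx.
Proof. by move=> i j /(congr1 swap); rewrite !swap_y_idx => /x_idx_inj. Qed.

Lemma x_idx_neq_y_idx i j : (x_idx i == y_idx j) = false.
Proof.
by apply/negbTE/eqP => /(congr1 (fun a => fintype.split (cast_ord (esym ambient_dim) a))); rewrite split_x_idx split_y_idx.
Qed.

Lemma y_idx_neq_x_idx i j : (y_idx i == x_idx j) = false.
Proof. by rewrite eq_sym x_idx_neq_y_idx. Qed.

Lemma swap_neq j : (swap j == j) = false.
Proof. by case: (idxP j) => i; rewrite ?swap_x_idx ?swap_y_idx ?x_idx_neq_y_idx ?y_idx_neq_x_idx. Qed.

Lemma sum_idx (V : nmodType) (f : 'I_N -> V) :
  \sum_j f j = \sum_i f (x_idx i) + \sum_i f (y_idx i).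
Proof.
rewrite (reindex (cast_ord ambient_dim)) /=; last first.
  by exists (cast_ord (esym ambient_dim)) => j _; rewrite ?cast_ordK ?cast_ordKV.
by rewrite big_split_ord.
Qed.

(** Pairs are flattened to rows, the type on which [partial] is defined. *)
Definition vec (p : E) : 'rV[R]_N := \row_j
  match fintype.split (cast_ord (esym ambient_dim) j) with
  | inl i => p.1 i 0
  | inr i => p.2 i 0
  end.

Definition unvec (v : 'rV[R]_N) : E := (\col_i v 0 (x_idx i), \col_i v 0 (y_idx i)).

Lemma vec_x_idx p i : vec p 0 (x_idx i) = p.1 i 0.
Proof. by rewrite mxE split_x_idx. Qed.

Lemma vec_y_idx p i : vec p 0 (y_idx i) = p.2 i 0.
Proof. by rewrite mxE split_y_idx. Qed.

Lemma rowE_idx (u v : 'rV[R]_N) :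
  (forall i, u 0 (x_idx i) = v 0 (x_idx i)) -> (forall i, u 0 (y_idx i) = v 0 (y_idx i)) -> u = v.
Proof. by move=> hx hy; apply/rowP => j; case: (idxP j). Qed.

Lemma unvecK : cancel unvec vec.
Proof. by move=> v; apply: rowE_idx => i; rewrite ?vec_x_idx ?vec_y_idx mxE. Qed.

Lemma vecK : cancel vec unvec.
Proof.
case=> x y; rewrite /unvec; congr (_, _);
  by apply/colP => i; rewrite !mxE ?split_x_idx ?split_y_idx.
Qed.

Lemma vec_linear : linear vec.
Proof.
by move=> a p r; apply: rowE_idx => i; rewrite ?mxE ?split_x_idx ?split_y_idx !mxE.
Qed.
HB.instance Definition _ := GRing.isLinear.Build _ _ _ _ vec vec_linear.

Lemma unvec_linear : linear unvec.
Proof.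
move=> a u v; rewrite /unvec; congr (_, _);
  by apply/colP => i; rewrite !mxE.
Qed.
HB.instance Definition _ := GRing.isLinear.Build _ _ _ _ unvec unvec_linear.

Lemma vec_continuous : continuous vec.
Proof.
move=> p; apply: mx_continuous => a j; rewrite (ord1 a); case: (idxP j) => i.
  rewrite (_ : (fun p : E => _) = (fun x : 'cV[R]_(1 + n) => x i 0) \o fst); last first.
    by apply/funext => p'; rewrite vec_x_idx.
  by apply: continuous_comp; [exact: cvg_fst | exact: coord_continuous].
rewrite (_ : (fun p : E => _) = (fun x : 'cV[R]_(1 + n) => x i 0) \o snd); last first.
  by apply/funext => p'; rewrite vec_y_idx.
by apply: continuous_comp; [exact: cvg_snd | exact: coord_continuous].
Qed.

Lemma unvec_continuous : continuous unvec.
Proof.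
move=> v.
have H (f : 'I_(1 + n) -> 'I_N) :
    {for v, continuous (fun v : 'rV[R]_N => \col_i v 0 (f i) : 'cV[R]_(1 + n))}.
  apply: mx_continuous => a b; rewrite (ord1 b).
  rewrite (_ : (fun v : 'rV[R]_N => _) = fun v : 'rV[R]_N => v 0 (f a)).
    exact: coord_continuous.
  by apply/funext => v'; rewrite mxE.
exact: (cvg_pair (H x_idx) (H y_idx)).
Qed.

Definition quad (v : 'rV[R]_N) : R := \sum_i v 0 (x_idx i) * v 0 (y_idx i).
(** Polar form of [quad] without the factor 1/2; its Gram matrix is the permutation matrix of
    [swap]. *)
Definition polar (u v : 'rV[R]_N) : R := \sum_j u 0 j * v 0 (swap j).

Lemma polarE u v : polar u v = \sum_i (u 0 (x_idx i) * v 0 (y_idx i) + u 0 (y_idx i) * v 0 (x_idx i)).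
Proof.
rewrite /polar sum_idx -big_split /=; apply: eq_bigr => i _.
by rewrite swap_x_idx swap_y_idx.
Qed.

Lemma polar_linear u : linear (polar u : 'rV[R]_N -> R^o).
Proof.
move=> a v w; rewrite /polar scaler_sumr -big_split /=; apply: eq_bigr => j _.
by rewrite !mxE /GRing.scale /=; ring.
Qed.

Lemma polarDr u v w : polar u (v + w) = polar u v + polar u w.
Proof. by have := polar_linear u 1 v w; rewrite !scale1r. Qed.

Lemma polarZr u a v : polar u (a *: v) = a * polar u v.
Proof.
rewrite /polar mulr_sumr; apply: eq_bigr => j _.
by rewrite !mxE; ring.
Qed.

Lemma polar_sumr u (I : Type) (r : seq I) (f : I -> 'rV[R]_N) :
  polar u (\sum_(i <- r) f i) = \sum_(i <- r) polar u (f i).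
Proof.
elim: r => [|i r IH]; last by rewrite !big_cons polarDr IH.
by rewrite !big_nil -[0 in LHS](scale0r 0) polarZr mul0r.
Qed.

Lemma polar_quad v : polar v v = 2 * quad v.
Proof.
rewrite polarE /quad mulr_sumr; apply: eq_bigr => i _.
by ring.
Qed.

Lemma quadD u v : quad (u + v) = quad u + polar u v + quad v.
Proof.
rewrite /quad polarE -!big_split /=; apply: eq_bigr => i _.
by rewrite !mxE; ring.
Qed.

Lemma polar_delta u j : polar u (delta_mx 0 j) = u 0 (swap j).
Proof.
rewrite /polar (bigD1 (swap j)) //= !mxE swapK !eqxx mulr1 big1 ?addr0 // => k kj.
rewrite mxE; have -> : (swap k == j) = false; last by rewrite andbF mulr0.
by apply/negbTE; apply: contra kj => /eqP <-; rewrite swapK.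
Qed.

Lemma quadZ a v : quad (a *: v) = a ^+ 2 * quad v.
Proof. by rewrite /quad mulr_sumr; apply: eq_bigr => i _; rewrite !mxE; ring. Qed.

Lemma quad_delta j : quad (delta_mx 0 j) = 0.
Proof.
apply: (@mulfI _ 2); rewrite ?pnatr_eq0 // -polar_quad polar_delta mulr0.
by rewrite mxE swap_neq.
Qed.

Lemma X1E (p : E) : @X1 R n p <-> quad (vec p) = 1.
Proof.
rewrite /X1 /= /dotv /quad; under [in X in _ <-> X]eq_bigr do rewrite vec_x_idx vec_y_idx.
by [].
Qed.

Lemma TX1E (p w : E) : @TX1 R n p w <-> polar (vec p) (vec w) = 0.
Proof.
rewrite /TX1 /= /dotv -big_split polarE /=.
by split=> H; rewrite -[RHS]H; apply: eq_bigr => i _; rewrite !vec_x_idx !vec_y_idx; ring.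
Qed.

End Coordinates.

(** * The invariant density *)

Section Densities.
Variables (R : realType) (n : nat).

Local Notation E := (ambient R n).
Local Notation d := (dimX1 n).
Local Notation N := (1 + dimX1 n)%N.
Local Notation X := (@X1 R n).
Local Notation TX := (@TX1 R n).

(* [p] is transverse to the tangent space of [X] at [p], because [polar p p = 2]. *)
Definition frame_mx (p : E) (A : 'I_d -> E) : 'M[R]_N :=
  col_mx (vec p) (\matrix_i vec (A i)).

Definition vol p A : R := `|\det (frame_mx p A)|.

(** The value 0 off tangent frames is the normalization imposed by [is_density]. *)
Definition omega p A : R := if `[< tangent_frame X TX p A >] then vol p A else 0.

Definition density_of (F : 'rV[R]_N -> R) : predensity E d :=
  fun p A => (F (vec p) * omega p A)%:C.

Lemma omega_tangent p A : tangent_frame X TX p A -> omega p A = vol p A.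
Proof. by move=> tA; rewrite /omega asboolT. Qed.

Lemma omega_not_tangent p A : ~ tangent_frame X TX p A -> omega p A = 0.
Proof. by move=> tA; rewrite /omega asboolF. Qed.

Lemma mulmx_frame (B : 'M[R]_d) (A : 'I_d -> E) :
  \matrix_i vec (\sum_j B i j *: A j) = B *m \matrix_i vec (A i).
Proof.
apply/row_matrixP => i; rewrite rowK row_mul mulmx_sum_row linear_sum /=.
by apply: eq_bigr => j _; rewrite linearZ /= mxE rowK.
Qed.

Lemma frame_mx_mul p (B : 'M[R]_d) (A : 'I_d -> E) :
  frame_mx p (fun i => \sum_j B i j *: A j) =
  block_mx (1%:M : 'M[R]_1) 0 0 B *m frame_mx p A.
Proof.
by rewrite /frame_mx mul_block_col mul1mx !mul0mx addr0 add0r mulmx_frame.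
Qed.

Lemma vol_mul p (B : 'M[R]_d) (A : 'I_d -> E) :
  vol p (fun i => \sum_j B i j *: A j) = `|\det B| * vol p A.
Proof. by rewrite /vol frame_mx_mul det_mulmx det_lblock det1 mul1r normrM. Qed.

Lemma tangent_frame_mul p (B : 'M[R]_d) (A : 'I_d -> E) :
  tangent_frame X TX p A -> tangent_frame X TX p (fun i => \sum_j B i j *: A j).
Proof.
case=> Xp tA; split=> // i; apply/TX1E; rewrite linear_sum polar_sumr big1 // => j _.
by rewrite linearZ /= polarZr ((TX1E _ _).1 (tA _)) mulr0.
Qed.

Lemma density_of_is_density F : is_density X TX (density_of F).
Proof.
split=> [p A tA|p A B tA]; first by rewrite /density_of omega_not_tangent // mulr0.
rewrite /density_of !omega_tangent //; last exact: tangent_frame_mul.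
by rewrite vol_mul -rmorphM /=; congr (_%:C); rewrite mulrCA.
Qed.

(** In a linear relation between [p] and the tangent vectors, pairing with [p] by [polar] isolates
    the coefficient of [p], because tangent vectors are orthogonal to [p] and [polar p p = 2]. *)
Lemma frame_mx_free p A : tangent_frame X TX p A ->
  (forall c : 'I_d -> R, \sum_i c i *: A i = 0 -> forall i, c i = 0) ->
  \det (frame_mx p A) != 0.
Proof.
move=> [Xp tA] freeA; apply/negP => /det0P [u u0 uM]; case/negP: u0.
have qp : polar (vec p) (vec p) = 2 by rewrite polar_quad (X1E p).1 // mulr1.
have := uM; rewrite -[u]hsubmxK /frame_mx mul_row_col.
set c := lsubmx u; set w := rsubmx u.
have -> : c *m vec p = c 0 0 *: vec p.
  by rewrite [c in LHS]mx11_scalar mul_scalar_mx.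
have -> : w *m (\matrix_i vec (A i)) = vec (\sum_i w 0 i *: A i).
  rewrite mulmx_sum_row linear_sum /=; apply: eq_bigr => i _.
  by rewrite rowK linearZ.
move=> H.
have c0 : c 0 0 = 0.
  have : polar (vec p) 0 = 0 by rewrite -(scale0r 0) polarZr mul0r.
  rewrite -{1}H polarDr polarZr qp linear_sum polar_sumr big1 => [|i _].
    by rewrite addr0 => /eqP; rewrite mulf_eq0 pnatr_eq0 orbF => /eqP.
  by rewrite linearZ /= polarZr ((TX1E _ _).1 (tA _)) mulr0.
move: H; rewrite c0 scale0r add0r => H.
have w0 : forall i, w 0 i = 0.
  by apply: freeA; rewrite -[LHS]vecK H linear0.
apply/eqP; rewrite [c]mx11_scalar c0.
rewrite (_ : w = 0); last by apply/rowP => i; rewrite w0 mxE.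
by rewrite raddf0 row_mx0.
Qed.

Section Chart.
Variables (V : set 'rV[R]_d) (sigma : 'rV[R]_d -> E).
Hypothesis lp : local_param X V sigma.

Let oV : open V. Proof. by have [] := lp. Qed.

Lemma chart_coord_smooth j : smooth_on V (fun t => vec (sigma t) 0 j).
Proof.
have [_ ss _ _ _] := lp.
pose l0 := (fun p : E => vec p 0 j) : E -> R.
have l0lin : linear l0 by move=> a u v; rewrite /l0 linearP !mxE.
pose l0M := GRing.isLinear.Build _ _ _ _ _ l0lin.
pose l : {linear E -> R} := HB.pack l0 l0M.
apply: (smooth_linear (l := l) oV _ ss) => p.
apply: (@continuous_comp _ _ _ (@vec R n) (fun v : 'rV[R]_N => v 0 j)).
  exact: vec_continuous.
exact: coord_continuous.
Qed.

Lemma chart_frame_vec t i j : V t ->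
  vec (coord_frame sigma t i) 0 j = partial i (fun t => vec (sigma t) 0 j) t.
Proof.
move=> Vt; have [_ ss _ _ _] := lp.
pose l0 := (fun p : E => vec p 0 j) : E -> R.
have l0lin : linear l0 by move=> a u v; rewrite /l0 linearP !mxE.
pose l0M := GRing.isLinear.Build _ _ _ _ _ l0lin.
pose l : {linear E -> R} := HB.pack l0 l0M.
have cl : continuous l.
  move=> p; apply: (@continuous_comp _ _ _ (@vec R n) (fun v : 'rV[R]_N => v 0 j)).
    exact: vec_continuous.
  exact: coord_continuous.
have ds : derivable sigma t (delta_mx 0 i) by exact: smooth_derivable ss Vt.
by have [_ El] := derivable_linear cl ds; exact: esym El.
Qed.

(** Differentiate [quad = 1] along the chart. *)
Lemma chart_tangent t : V t -> tangent_frame X TX (sigma t) (coord_frame sigma t).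
Proof.
move=> Vt; have [_ ss sX _ _] := lp; split=> [|i]; first exact: sX.
apply/TX1E; rewrite polarE.
pose f j t := vec (sigma t) 0 j.
have df j : derivable (f j) t (delta_mx 0 i).
  exact: smooth_derivable (chart_coord_smooth j) Vt.
have : partial i (fun t => \sum_k f (x_idx k) t * f (y_idx k) t) t = 0.
  rewrite (partial_eq (g := cst 1) i oV Vt); first exact: derive_cst.
  by move=> s Vs; apply/X1E/sX.
rewrite (_ : (fun t => \sum_k f (x_idx k) t * f (y_idx k) t) =
    \sum_k (f (x_idx k) \* f (y_idx k))); last first.
  by apply/funext => s; rewrite fct_sumE.
rewrite /partial derive_sum; last by move=> k; apply: derivableM.
move=> H; rewrite -[RHS]H; apply: eq_bigr => k _.
rewrite deriveM // !chart_frame_vec // /partial /GRing.scale /=.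
Qed.

Lemma chart_vol_neq0 t : V t -> \det (frame_mx (sigma t) (coord_frame sigma t)) != 0.
Proof.
move=> Vt; apply: frame_mx_free; first exact: chart_tangent.
by have [_ _ _ _ [im _]] := lp; exact: im.
Qed.

Lemma chart_vol_smooth : smooth_on V (fun t => vol (sigma t) (coord_frame sigma t)).
Proof.
apply: smooth_norm => //; first exact: chart_vol_neq0.
apply: smooth_det => // i j; rewrite -(splitK i); case: (fintype.split i) => k /=.
  rewrite (_ : (fun t => _) = fun t => vec (sigma t) 0 j); first exact: chart_coord_smooth.
  by apply/funext => t; rewrite /frame_mx col_mxEu (ord1 k).
apply: (smooth_eq oV _ (smooth_partial k (chart_coord_smooth j))) => t Vt.
by rewrite /frame_mx col_mxEd mxE chart_frame_vec.
Qed.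

Lemma density_of_coord_re F t : V t ->
  density_coord_re (density_of F) sigma t = F (vec (sigma t)) * vol (sigma t) (coord_frame sigma t).
Proof.
move=> Vt; rewrite /density_coord_re /density_coord /density_of /=.
by rewrite omega_tangent //; exact: chart_tangent.
Qed.

End Chart.

Definition regular : set 'rV[R]_N := [set v | quad v != 0].

Local Notation U := regular.

Lemma smooth_quad V : open V -> smooth_on V (@quad R n).
Proof.
move=> oV; apply: smooth_sum => // i.
by apply: smooth_mul => //; exact: smooth_coord.
Qed.

Lemma open_regular : open U.
Proof.
have -> : U = @quad R n @^-1` [set x | x != 0] by [].
apply: open_comp; last exact: open_neq.
by move=> v _; apply: smooth_continuous (smooth_quad openT) _.
Qed.

Lemma X1_regular p : X p -> U (vec p).
Proof. by move=> /X1E; rewrite /regular /= => ->; rewrite oner_eq0. Qed.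

Definition test_fun (F : 'rV[R]_N -> R) : Prop :=
  smooth_on U F /\ exists K : set E,
    [/\ compact K, K `<=` X & forall p, X p -> ~ K p -> F (vec p) = 0].

Lemma density_of_smooth F : smooth_on U F -> smooth_density X TX (density_of F).
Proof.
move=> sF; split; first exact: density_of_is_density.
move=> V sigma lp; have [oV ss sX _ _] := lp; split.
  apply: (smooth_eq oV (fun t Vt => esym (density_of_coord_re lp F Vt))).
  apply: smooth_mul => //; last exact: chart_vol_smooth.
  apply: (smooth_comp oV open_regular _ sF); last by move=> j; exact: chart_coord_smooth.
  by move=> t Vt; apply: X1_regular; exact: sX.
exact: smooth_cst.
Qed.

Lemma density_of_supported F K : (forall p, X p -> ~ K p -> F (vec p) = 0) ->
  supported_in K (density_of F).
Proof.
move=> FK p A Kp; rewrite /density_of; have [Xp|Xp] := pselect (X p).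
  by rewrite FK // mul0r.
by rewrite omega_not_tangent ?mulr0 // => -[].
Qed.

Lemma density_of_test F : test_fun F -> test_density X TX (density_of F).
Proof.
move=> [sF [K [cK KX FK]]]; split; first exact: density_of_smooth.
by exists K; split=> //; exact: density_of_supported.
Qed.

Lemma density_of_eq F G : (forall p, X p -> F (vec p) = G (vec p)) -> density_of F = density_of G.
Proof.
move=> FG; apply/funext => p; apply/funext => A; rewrite /density_of.
have [Xp|Xp] := pselect (X p); first by rewrite FG.
by rewrite omega_not_tangent ?mulr0 // => -[].
Qed.

End Densities.

(** * Test densities as functions *)

Section Representation.
Variables (R : realType) (n : nat).

Local Notation E := (ambient R n).
Local Notation d := (dimX1 n).
Local Notation N := (1 + dimX1 n)%N.
Local Notation X := (@X1 R n).
Local Notation TX := (@TX1 R n).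
Local Notation U := (@regular R n).

Section GraphChart.
Variable a : 'I_N.

(* On [v_a != 0] the equation [quad v = 1] is solved for the coordinate paired
   with [a]. *)
Definition insert_zero (t : 'rV[R]_d) : 'rV[R]_N :=
  \row_j (if unlift (swap a) j is Some k then t 0 k else 0).

Definition drop_coord (v : 'rV[R]_N) : 'rV[R]_d := \row_k v 0 (lift (swap a) k).

Definition graph_coord (t : 'rV[R]_d) : 'rV[R]_N :=
  insert_zero t + ((1 - quad (insert_zero t)) / insert_zero t 0 a) *: delta_mx 0 (swap a).

Definition graph_chart (t : 'rV[R]_d) : E := unvec (graph_coord t).

Definition graph_dom : set 'rV[R]_d := [set t | insert_zero t 0 a != 0].

Lemma insert_zero_drop_coord v : v = insert_zero (drop_coord v) + v 0 (swap a) *: delta_mx 0 (swap a).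
Proof.
apply/rowP => j; rewrite !mxE eqxx /=.
by case: unliftP => [k ->|->]; rewrite ?mxE ?eqxx ?mulr1 ?add0r //
  eq_sym (negbTE (neq_lift _ _)) mulr0 addr0.
Qed.

Lemma drop_coord_linear : linear drop_coord.
Proof. by move=> c u v; apply/rowP => k; rewrite !mxE. Qed.

Lemma drop_coord_graph_coord t : drop_coord (graph_coord t) = t.
Proof.
apply/rowP => k; rewrite !mxE liftK eqxx /=.
by rewrite eq_sym (negbTE (neq_lift _ _)) mulr0 addr0.
Qed.

(** The axis paired with [a] is isotropic, so along it [quad] is affine with slope [v_a]. This is
    where the formula for [graph_coord] comes from. *)
Lemma quad_line (v : 'rV[R]_N) c : quad (v + c *: delta_mx 0 (swap a)) = quad v + c * v 0 a.
Proof. by rewrite quadD polarZr polar_delta swapK quadZ quad_delta mulr0 addr0. Qed.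

Lemma quad_graph_coord t : graph_dom t -> quad (graph_coord t) = 1.
Proof. by rewrite /graph_dom /= => t0; rewrite quad_line divfK // addrC subrK. Qed.

Lemma insert_zero_drop_coord_a v : insert_zero (drop_coord v) 0 a = v 0 a.
Proof.
by rewrite [in RHS](insert_zero_drop_coord v) [RHS]mxE [X in _ + X]mxE [X in _ * X]mxE [X in _ && X]eq_sym swap_neq andbF mulr0 addr0.
Qed.

Lemma graph_coord_drop_coord v : quad v = 1 -> v 0 a != 0 -> graph_coord (drop_coord v) = v.
Proof.
move=> qv va; rewrite [RHS]insert_zero_drop_coord /graph_coord; congr (_ + _ *: _).
have : quad v = quad (insert_zero (drop_coord v)) + v 0 (swap a) * v 0 a.
  by rewrite [in LHS](insert_zero_drop_coord v) quad_line insert_zero_drop_coord_a.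
by rewrite qv insert_zero_drop_coord_a => ->; rewrite addrC addKr mulfK.
Qed.

Lemma insert_zero_smooth (V : set 'rV[R]_d) j : smooth_on V (fun t => insert_zero t 0 j).
Proof.
rewrite /insert_zero; case E : (unlift (swap a) j) => [k|].
  rewrite (_ : (fun t => _) = fun t : 'rV[R]_d => t 0 k); first exact: smooth_coord.
  by apply/funext => t; rewrite mxE E.
rewrite (_ : (fun t => _) = fun t : 'rV[R]_d => 0 : R); first exact: smooth_cst.
by apply/funext => t; rewrite mxE E.
Qed.

Lemma open_graph_dom : open graph_dom.
Proof.
have -> : graph_dom = (fun t => insert_zero t 0 a) @^-1` [set x | x != 0] by [].
apply: open_comp; last exact: open_neq.
by move=> v _; exact: (smooth_continuous (@insert_zero_smooth setT a)).
Qed.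

Lemma graph_coord_smooth j : smooth_on graph_dom (fun t => graph_coord t 0 j).
Proof.
have oV := open_graph_dom.
have E t : graph_coord t 0 j = insert_zero t 0 j +
    (1 - \sum_i insert_zero t 0 (x_idx i) * insert_zero t 0 (y_idx i)) * (insert_zero t 0 a)^-1 *
    (delta_mx 0 (swap a) : 'rV[R]_N) 0 j.
  by rewrite [LHS]mxE [X in _ + X]mxE.
under eq_fun do rewrite E.
apply: smooth_add => //; first exact: insert_zero_smooth.
apply: smooth_mul => //; last exact: smooth_cst.
apply: smooth_mul => //; last first.
  by apply: smooth_inv => //; exact: insert_zero_smooth.
apply: smooth_sub => //; first exact: smooth_cst.
apply: smooth_sum => // i; apply: smooth_mul => //; exact: insert_zero_smooth.
Qed.

Lemma drop_coord_continuous : continuous drop_coord.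
Proof.
move=> v; apply: mx_continuous => i k.
rewrite (_ : (fun v => _) = fun v : 'rV[R]_N => v 0 (lift (swap a) k)).
  exact: coord_continuous.
by apply/funext => t; rewrite mxE.
Qed.

(** [drop_coord] after [vec] is a continuous linear left inverse of the chart. It yields
    injectivity, independence of the coordinate frame, and the open set cutting out the image. *)
Lemma graph_chart_param : local_param X graph_dom graph_chart.
Proof.
have oV := open_graph_dom.
have ss : smooth_on graph_dom graph_chart.
  apply: smooth_linear => //; first exact: unvec_continuous.
  by apply: smooth_row => // j; exact: graph_coord_smooth.
have pK t : drop_coord (vec (graph_chart t)) = t.
  by rewrite /graph_chart unvecK drop_coord_graph_coord.
split=> //.
- by move=> t tV; apply/X1E; rewrite unvecK quad_graph_coord.
- by move=> t1 t2 _ _ E; rewrite -(pK t1) E pK.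
- split=> [t Vt c Hc i|O oO OV].
    pose l0 := (fun p : E => drop_coord (vec p)) : E -> 'rV[R]_d.
    have l0lin : linear l0 by move=> b u v; rewrite /l0 linearP drop_coord_linear.
    pose l0M := GRing.isLinear.Build _ _ _ _ _ l0lin.
    pose l : {linear E -> 'rV[R]_d} := HB.pack l0 l0M.
    have cl : continuous l.
      move=> p; apply: (@continuous_comp _ _ _ (@vec R n) drop_coord).
        exact: vec_continuous.
      exact: drop_coord_continuous.
    have lE k : l (coord_frame graph_chart t k) = delta_mx 0 k.
      have ds : derivable graph_chart t (delta_mx 0 k) by exact: smooth_derivable ss Vt.
      have [_ El] := derivable_linear cl ds.
      apply: etrans (esym El) _.
      rewrite (_ : (fun s => _) = id); last by apply/funext => s; exact: pK.
      exact: derive_id.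
    have : l (\sum_k c k *: coord_frame graph_chart t k) = 0 by rewrite Hc linear0.
    rewrite linear_sum; under eq_bigr do rewrite linearZZ lE.
    move=> /rowP /(_ i); rewrite summxE (bigD1 i) //= big1 => [|k ki].
      by rewrite !mxE !eqxx mulr1 addr0.
    by rewrite !mxE eqxx /= eq_sym (negbTE ki) mulr0.
  exists ((fun p => drop_coord (vec p)) @^-1` O).
    apply: open_comp => // p _; apply: (@continuous_comp _ _ _ (@vec R n) drop_coord).
      exact: vec_continuous.
    exact: drop_coord_continuous.
  apply/seteqP; split=> [p [t Ot <-]|p [Xp Op]].
    split; last by rewrite /= pK.
    by apply/X1E; rewrite unvecK quad_graph_coord //; exact: OV.
  exists (drop_coord (vec p)) => //; rewrite /graph_chart graph_coord_drop_coord ?vecK //.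
    exact/X1E.
  by have := OV _ Op; rewrite /graph_dom /= insert_zero_drop_coord_a.
Qed.

End GraphChart.

(** Expressing the frame of [A] through that of [B] gives a matrix whose lower left block vanishes,
    so [A] is a combination of [B] alone and both [mu] and [vol] scale by the same determinant. *)
Lemma density_ratio (mu : predensity E d) p (A B : 'I_d -> E) :
  is_density X TX mu -> tangent_frame X TX p A -> tangent_frame X TX p B ->
  vol p B != 0 -> mu p A = (vol p A / vol p B)%:C * mu p B.
Proof.
move=> [_ dm] tA tB vB.
have uB : frame_mx p B \in unitmx.
  by rewrite unitmxE unitfE; move: vB; rewrite /vol normr_eq0.
pose M : 'M[R]_(1 + d) := frame_mx p A *m invmx (frame_mx p B).
have HM : frame_mx p A = M *m frame_mx p B by rewrite mulmxKV.
have qp : polar (vec p) (vec p) = 2 by rewrite polar_quad ((X1E p).1 tA.1) mulr1.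
have rows i : vec (A i) = M (rshift 1 i) (lshift d 0) *: vec p +
    vec (\sum_j drsubmx M i j *: B j).
  have : row (rshift 1 i) (frame_mx p A) = row (rshift 1 i) M *m frame_mx p B.
    by rewrite HM row_mul.
  rewrite {1}/frame_mx rowKd rowK => ->.
  rewrite -[row _ M]hsubmxK /frame_mx mul_row_col; congr (_ + _).
    by rewrite [lsubmx _]mx11_scalar mul_scalar_mx !mxE.
  rewrite mulmx_sum_row linear_sum /=; apply: eq_bigr => j _.
  by rewrite rowK linearZ !mxE.
(* Pairing with [p] removes its coefficient, since [A i] and the combinations of [B] are tangent. *)
have z i : M (rshift 1 i) (lshift d 0) = 0.
  have := (TX1E _ _).1 (tA.2 i); rewrite rows polarDr polarZr qp.
  rewrite ((TX1E _ _).1 ((tangent_frame_mul (drsubmx M) tB).2 i)) addr0.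
  by move/eqP; rewrite mulf_eq0 pnatr_eq0 orbF => /eqP.
have EA : A = fun i => \sum_j drsubmx M i j *: B j.
  by apply/funext => i; apply: (can_inj (@vecK R n)); rewrite rows z scale0r add0r.
rewrite {1 2}EA dm // vol_mul mulfK //.
Qed.

(* The retraction [(x, y) |-> (x, y / quad)] of [U] onto [X]. *)
Definition retract (v : 'rV[R]_N) : 'rV[R]_N :=
  \row_j match fintype.split (cast_ord (esym (ambient_dim n)) j) with
         | inl i => v 0 (x_idx i)
         | inr i => v 0 (y_idx i) / quad v
         end.

Lemma retract_x_idx v i : retract v 0 (x_idx i) = v 0 (x_idx i).
Proof. by rewrite mxE split_x_idx. Qed.

Lemma retract_y_idx v i : retract v 0 (y_idx i) = v 0 (y_idx i) / quad v.
Proof. by rewrite mxE split_y_idx. Qed.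

Lemma quad_retract v : U v -> quad (retract v) = 1.
Proof.
move=> Uv; rewrite /quad; under eq_bigr do rewrite retract_x_idx retract_y_idx mulrA.
by rewrite -mulr_suml divff.
Qed.

Lemma retract_id v : quad v = 1 -> retract v = v.
Proof.
by move=> qv; apply: rowE_idx => i; rewrite ?retract_x_idx ?retract_y_idx // qv divr1.
Qed.

Lemma retract_smooth j : smooth_on U (fun v => retract v 0 j).
Proof.
have oU := @open_regular R n.
case: (idxP j) => i; first by under eq_fun do rewrite retract_x_idx; exact: smooth_coord.
under eq_fun do rewrite retract_y_idx.
apply: smooth_mul => //; first exact: smooth_coord.
by apply: smooth_inv => //; exact: smooth_quad.
Qed.

Lemma U_x_idx v : U v -> exists i, v 0 (x_idx i) != 0.
Proof.
move=> Uv; apply: contrapT => H; case/negP: Uv; apply/eqP.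
rewrite /quad big1 // => i _; have [->|v0] := eqVneq (v 0 (x_idx i)) 0; first by rewrite mul0r.
by case: H; exists i.
Qed.

(* Unlike [test_fun], this support condition concerns an open set of the ambient space,
   so it passes to partial derivatives. *)
Definition test_ext (F : 'rV[R]_N -> R) : Prop :=
  smooth_on U F /\ exists K : set E,
    [/\ compact K, K `<=` X & forall v, U v -> ~ K (unvec (retract v)) -> F v = 0].

Lemma test_ext_test_fun F : test_ext F -> test_fun F.
Proof.
move=> [sF [K [cK KX FK]]]; split=> //; exists K; split=> // p Xp Kp.
apply: FK; first exact: X1_regular.
by rewrite retract_id ?vecK //; exact/X1E.
Qed.

(** Here [pt] is the real or the imaginary part. The quotient of [mu] by [vol] on an arbitrarily
    chosen frame is independent of the frame by [density_ratio]; smoothness is then read off from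
    the frames of graph charts, and the retraction extends the quotient to [regular]. *)
Lemma density_part (pt : R[i] -> R) (mu : predensity E d) :
  pt 0 = 0 -> (forall r z, pt (r%:C * z) = r * pt z) ->
  is_density X TX mu ->
  (forall V sigma, local_param X V sigma -> smooth_on V (fun t => pt (density_coord mu sigma t))) ->
  (exists K : set E, [/\ compact K, K `<=` X & supported_in K mu]) ->
  exists2 F, test_ext F & forall p A, pt (mu p A) = F (vec p) * omega p A.
Proof.
move=> pt0 ptM dm sm [K [cK KX mK]].
(* Off [X] the frame is a dummy; on [X] it comes from a graph chart around [p]. *)
have fr p : {B | X p -> tangent_frame X TX p B /\ vol p B != 0}.
  have [Xp|Xp] := pselect (X p); last by exists (fun=> 0).
  have /cid [i vi] := U_x_idx (X1_regular Xp).
  have Vt : graph_dom (x_idx i) (drop_coord (x_idx i) (vec p)) by rewrite /graph_dom /= insert_zero_drop_coord_a.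
  have Ep : graph_chart (x_idx i) (drop_coord (x_idx i) (vec p)) = p.
    by rewrite /graph_chart graph_coord_drop_coord ?vecK //; exact/X1E.
  exists (coord_frame (graph_chart (x_idx i)) (drop_coord (x_idx i) (vec p))) => _; split.
    by rewrite -{1}Ep; exact: chart_tangent (graph_chart_param (x_idx i)) _ Vt.
  by rewrite /vol normr_eq0 -{1}Ep; exact: chart_vol_neq0 (graph_chart_param (x_idx i)) _ Vt.
pose B p := sval (fr p).
have tB p : X p -> tangent_frame X TX p (B p) by rewrite /B; case: (fr p) => /= b H /H[].
have vB p : X p -> vol p (B p) != 0 by rewrite /B; case: (fr p) => /= b H /H[].
pose phi p := pt (mu p (B p)) / vol p (B p).
have phiE p A : pt (mu p A) = phi p * omega p A.
  have [tA|tA] := pselect (tangent_frame X TX p A); last first.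
    by rewrite omega_not_tangent // mulr0 (dm.1 _ _ tA).
  rewrite omega_tangent // (density_ratio dm tA (tB _ tA.1) (vB _ tA.1)) ptM /phi.
  by rewrite mulrAC -mulrA mulrC; congr (_ * _); rewrite mulrC.
exists (fun v => phi (unvec (retract v))); last first.
  move=> p A; rewrite phiE; have [Xp|Xp] := pselect (X p).
    by rewrite retract_id ?vecK //; exact/X1E.
  by rewrite omega_not_tangent ?mulr0 // => -[].
have oU := @open_regular R n.
split; last first.
  exists K; split=> // v Uv Kv; rewrite /phi mK // pt0 mul0r //.
(* A nonzero x-coordinate is chosen because the retraction leaves it unchanged, so one graph chart
   serves the whole neighbourhood. *)
apply: smooth_local => v Uv; have [i vi] := U_x_idx Uv.
pose a := x_idx i : 'I_N.
pose V : set 'rV[R]_N := U `&` [set v | v 0 a != 0].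
have oV : open V.
  apply: openI => //.
  apply: (@open_comp _ _ (fun v : 'rV[R]_N => v 0 a) [set x | x != 0]); last exact: open_neq.
  by move=> w _; exact: coord_continuous.
have lp := graph_chart_param a.
pose q t := pt (density_coord mu (graph_chart a) t) /
  vol (graph_chart a t) (coord_frame (graph_chart a) t).
have v0 t : graph_dom a t -> vol (graph_chart a t) (coord_frame (graph_chart a) t) != 0.
  by move=> Vt; rewrite /vol normr_eq0; exact: chart_vol_neq0 lp _ Vt.
have sq : smooth_on (graph_dom a) q.
  have oG := @open_graph_dom a.
  apply: smooth_mul => //; first exact: sm.
  by apply: smooth_inv => //; exact: chart_vol_smooth.
exists V; split; first by split.
have VG w : V w -> graph_dom a (drop_coord a (retract w)).
  by move=> [Uw wa]; rewrite /graph_dom /= insert_zero_drop_coord_a /a retract_x_idx.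
apply: (smooth_eq (f := fun w => q (drop_coord a (retract w))) oV).
  move=> w Vw; have := VG _ Vw; move: Vw => [Uw wa] Gw.
  have Ew : graph_chart a (drop_coord a (retract w)) = unvec (retract w).
    by rewrite /graph_chart graph_coord_drop_coord ?quad_retract // /a retract_x_idx.
  rewrite /q /density_coord phiE omega_tangent; last exact: chart_tangent lp _ Gw.
  by rewrite mulfK ?v0 // Ew.
apply: (smooth_comp (tau := fun w => drop_coord a (retract w)) oV (@open_graph_dom a) VG sq).
move=> k; under eq_fun do rewrite mxE.
by apply: smooth_subset (retract_smooth _) => w [].
Qed.

(** The combination has the shape to which [test_linear] applies. *)
Lemma test_density_repr (mu : predensity E d) : test_density X TX mu ->
  exists F G, [/\ test_ext F, test_ext G & mu = fun p A => 'i%C * density_of G p A + density_of F p A].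
Proof.
move=> [[dm sm] sK].
have [F test_extF FE] : exists2 F, test_ext F & forall p A, complex.Re (mu p A) = F (vec p) * omega p A.
  apply: (density_part (pt := @complex.Re R)) => //.
    by move=> r [x y] /=; rewrite mul0r subr0.
  by move=> V sigma lp; have [] := sm _ _ lp.
have [G test_extG GE] : exists2 F, test_ext F & forall p A, complex.Im (mu p A) = F (vec p) * omega p A.
  apply: (density_part (pt := @complex.Im R)) => //.
    by move=> r [x y] /=; rewrite mul0r addr0.
  by move=> V sigma lp; have [] := sm _ _ lp.
exists F, G; split=> //; apply/funext => p; apply/funext => A.
rewrite /density_of -FE -GE; case: (mu p A) => x y /=.
by apply/eqP; rewrite eq_complex /=; apply/andP; split; apply/eqP; ring.
Qed.

End Representation.

(** * Distributions along smooth families *)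

Section Differentiation.
Variables (R : realType) (n : nat).

Local Notation E := (ambient R n).
Local Notation d := (dimX1 n).
Local Notation N := (1 + dimX1 n)%N.
Local Notation X := (@X1 R n).
Local Notation U := (@regular R n).

(** One compact set [K] must work for all times, as continuity of a distribution is stated for a
    fixed support. *)
Definition smooth_family (e : R) (K : set E) (H : 'rV[R]_(1 + N) -> R) : Prop :=
  [/\ 0 < e, smooth_on (slab e U) H, compact K, K `<=` X &
      forall s p, `|s| < e -> X p -> ~ K p -> H (time_row s (vec p)) = 0].

(** A time derivative depends only on the time line through [v]. Hence the velocity of a family
    inherits the support condition, which speaks only of points of [X]. *)
Lemma partial_time_idx_eq (e : R) (H G : 'rV[R]_(1 + N) -> R) (v : 'rV[R]_N) : 0 < e ->
  (forall s, `|s| < e -> H (time_row s v) = G (time_row s v)) ->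
  partial time_idx H (time_row 0 v) = partial time_idx G (time_row 0 v).
Proof.
move=> e0 HG; rewrite /partial derive_line0 [RHS]derive_line0.
apply: near_eq_derive; apply/nbhs_ballP; exists e => // s; rewrite -ball_normE /= sub0r normrN.
by move=> se; rewrite time_row_shift_time_idx addr0; exact: HG.
Qed.

Lemma family_slice_test_fun e K H s : smooth_family e K H -> `|s| < e ->
  test_fun (fun v => H (time_row s v)).
Proof.
move=> [e0 sH cK KX HK] se; split; first exact: (smooth_time_row (@open_regular R n) se sH).
by exists K; split=> // p Xp Kp; exact: HK.
Qed.

Lemma family_velocity_test_fun e K H : smooth_family e K H ->
  test_fun (fun v => partial time_idx H (time_row 0 v)).
Proof.
move=> [e0 sH cK KX HK]; split.
  by apply: (smooth_time_row (@open_regular R n) _ (smooth_partial time_idx sH)); rewrite normr0.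
exists K; split=> // p Xp Kp.
rewrite (partial_time_idx_eq (G := fun=> 0) e0); first exact: derive_cst.
by move=> s se; exact: HK.
Qed.

(* What is used of a distribution; the last clause replaces its continuity. *)
Definition admissible (Lam : ('rV[R]_N -> R) -> R) : Prop :=
  [/\ forall a F G, test_fun F -> test_fun G ->
        Lam (fun v => a * F v + G v) = a * Lam F + Lam G,
      forall F G, (forall p, X p -> F (vec p) = G (vec p)) -> Lam F = Lam G &
      forall e K H, smooth_family e K H ->
        exists C, forall s, `|s| <= e / 2 -> `|Lam (taylor_rest H s)| <= C * s ^+ 2].

Lemma iter_partial0 (a : seq 'I_d) (t : 'rV[R]_d) : iter_partial a (fun=> 0 : R) t = 0.
Proof.
have -> : iter_partial a (fun=> 0 : R) = (fun=> 0 : R) :> ('rV[R]_d -> R); last by [].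
elim: a => //= i a ->; apply/funext => t'; exact: derive_cst.
Qed.

Lemma chart_family V sigma e (H : 'rV[R]_(1 + N) -> R) : local_param X V sigma -> smooth_on (slab e U) H ->
  smooth_on (slab e V) (fun z : 'rV[R]_(1 + d) =>
    H (time_row (z 0 time_idx) (vec (sigma (rsubmx z)))) *
    vol (sigma (rsubmx z)) (coord_frame sigma (rsubmx z))).
Proof.
move=> lp sH; have [oV ss sX _ _] := lp.
have oS := open_slab (e := e) oV.
have sub (f : 'rV[R]_d -> R) : smooth_on V f -> smooth_on (slab e V) (fun z => f (rsubmx z)).
  move=> sf; apply: (smooth_comp (tau := rsubmx) oS oV _ sf) => [z Sz|j]; first by case: Sz.
  by under eq_fun do rewrite mxE; exact: smooth_coord.
apply: smooth_mul => //; last exact: (sub _ (chart_vol_smooth lp)).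
apply: (smooth_comp (tau := fun z => time_row (z 0 time_idx) (vec (sigma (rsubmx z))))
  oS (open_slab (e := e) (@open_regular R n)) _ sH).
  by move=> z [ze Vz]; apply: slab_time_row => //; apply: X1_regular; exact: sX.
move=> j; rewrite -(splitK j); case: (fintype.split j) => [b|b] /=.
  by rewrite (ord1 b) -/time_idx; under eq_fun do rewrite time_row_time_idx; exact: smooth_coord.
rewrite -/(space_idx b); under eq_fun do rewrite time_row_space.
exact: (sub (fun t => vec (sigma t) 0 b) (chart_coord_smooth lp b)).
Qed.

(** The volume factor does not depend on time, so it may be moved inside the remainder; in chart
    coordinates the density is again a Taylor remainder, to which [taylor_iter] applies. *)
Lemma density_coord_taylor_rest V sigma e (H : 'rV[R]_(1 + N) -> R) s t : local_param X V sigma ->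
  smooth_on (slab e U) H -> 0 < e -> V t ->
  density_coord_re (density_of (taylor_rest H s)) sigma t =
  taylor_rest (fun z : 'rV[R]_(1 + d) =>
    H (time_row (z 0 time_idx) (vec (sigma (rsubmx z)))) *
    vol (sigma (rsubmx z)) (coord_frame sigma (rsubmx z))) s t.
Proof.
move=> lp sH e0 Vt; have [oV ss sX _ _] := lp.
rewrite (density_of_coord_re lp _ Vt) /taylor_rest !time_row_time_idx !rsubmx_time_row.
set v := vec (sigma t); set w := vol _ _.
rewrite !mulrBl -mulrA; congr (_ - _ * _).
have dH : derivable H (time_row 0 v) (delta_mx 0 time_idx).
  by apply: (smooth_derivable sH); apply: slab_time_row; [rewrite normr0 | apply: X1_regular; exact: sX].
rewrite /partial [RHS]derive_line0.
rewrite (_ : (fun h : R => _) = (fun h : R => H (h *: delta_mx 0 time_idx + time_row 0 v)) * cst w).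
  rewrite deriveM; [|exact: (derivable1P _ _ _).1 dH|exact: derivable_cst].
  by rewrite derive_cst scaler0 add0r -derive_line0 /GRing.scale /= mulrC.
apply/funext => h; rewrite -[RHS]/(H (h *: delta_mx 0 time_idx + time_row 0 v) * w).
by rewrite !time_row_shift_time_idx time_row_time_idx addr0 rsubmx_time_row.
Qed.

(** The finitely many seminorms controlling [T] on [K] are all bounded by multiples of [s ^+ 2]
    through [taylor_iter]; halving [e] provides its smaller time interval. *)
Lemma distribution_bound (T : predensity E d -> R[i]) e K H :
  distribution_X1 T -> smooth_family e K H ->
  exists C, forall s, `|s| <= e / 2 ->
    `|T (density_of (taylor_rest H s))| <= (C * s ^+ 2)%:C.
Proof.
move=> [_ cT] fH; have [e0 sH cK KX HK] := fH.
have [m [k [V [L [sigma [C0 [chL bT]]]]]]] := cT K cK KX.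
pose Hj j (z : 'rV[R]_(1 + d)) := H (time_row (z 0 time_idx) (vec (sigma j (rsubmx z)))) *
    vol (sigma j (rsubmx z)) (coord_frame (sigma j) (rsubmx z)).
have e2 : 0 <= e / 2 < e by lra.
have tj j : {C : R | 0 <= C & forall (a : seq 'I_d) s t, (size a <= k)%N -> L j t ->
    `|s| <= e / 2 -> `|iter_partial a (taylor_rest (Hj j) s) t| <= C * s ^+ 2}.
  apply: cid2; have [lp cL LV] := chL j; have [oV _ _ _ _] := lp.
  by apply: (taylor_iter k oV e2 _ cL LV); exact: chart_family.
pose D j : R := s2val (tj j).
have D0 j : 0 <= D j by rewrite /D; case: (tj j).
have HD j : forall (a : seq 'I_d) s t, (size a <= k)%N -> L j t ->
    `|s| <= e / 2 -> `|iter_partial a (taylor_rest (Hj j) s) t| <= D j * s ^+ 2.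
  by rewrite /D; case: (tj j).
exists (C0 * \sum_j D j) => s se.
have se' : `|s| < e by apply: le_lt_trans se _; case/andP: e2.
rewrite -mulrA; apply: bT.
- apply: density_of_test; split.
    have oU := @open_regular R n; apply: smooth_sub => //.
      apply: smooth_sub => //; first exact: (smooth_time_row oU se' sH).
      by apply: (smooth_time_row oU _ sH); rewrite normr0.
    apply: smooth_mul => //; first exact: smooth_cst.
    by apply: (smooth_time_row oU _ (smooth_partial time_idx sH)); rewrite normr0.
  exists K; split=> // p Xp Kp; rewrite /taylor_rest !HK // ?normr0 //.
  rewrite (partial_time_idx_eq (G := fun=> 0) e0); last by move=> r re; exact: HK.
  by rewrite /partial derive_cst mulr0 !subrr.
- apply: density_of_supported => p Xp Kp; rewrite /taylor_rest !HK // ?normr0 //.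
  rewrite (partial_time_idx_eq (G := fun=> 0) e0); last by move=> r re; exact: HK.
  by rewrite /partial derive_cst mulr0 !subrr.
- by rewrite mulr_ge0 ?sqr_ge0 // sumr_ge0.
move=> j a t ak Lt; have [lp cL LV] := chL j; have [oV _ _ _ _] := lp.
have M0 : 0 <= (\sum_j D j) * s ^+ 2 by rewrite mulr_ge0 ?sqr_ge0 // sumr_ge0.
split; last first.
  by rewrite (_ : density_coord_im _ _ = fun=> 0) // iter_partial0 normr0.
rewrite (iter_partial_eq a oV (g := taylor_rest (Hj j) s)).
- apply: le_trans (HD j _ _ _ ak Lt se) _; rewrite ler_wpM2r ?sqr_ge0 //.
  by rewrite (bigD1 j) //= lerDl sumr_ge0.
- by move=> t' Vt'; exact: density_coord_taylor_rest lp sH e0 Vt'.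
- exact: LV.
Qed.

Lemma density_of_linear a F G :
  density_of (fun v => a * F v + G v) = (fun p A => a%:C * density_of F p A + density_of G p A) :> predensity E d.
Proof.
apply/funext => p; apply/funext => A; rewrite /density_of -rmorphM -rmorphD /=.
by congr (_%:C); ring.
Qed.

Lemma distribution_admissible (T : predensity E d -> R[i]) : distribution_X1 T ->
  admissible (fun F => complex.Re (T (density_of F))) /\
  admissible (fun F => complex.Im (T (density_of F))).
Proof.
move=> dT; have [lT _] := dT.
have normE (z : R[i]) (c : R) : `|z| <= c%:C -> `|complex.Re z| <= c /\ `|complex.Im z| <= c.
  case: z => x y; rewrite normc_def lecR /= => h.
  have sq (u v : R) : `|u| <= Num.sqrt (u ^+ 2 + v ^+ 2).
    by rewrite -sqrtr_sqr ler_wsqrtr // lerDl sqr_ge0.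
  split; first exact: le_trans (sq x y) h.
  by rewrite addrC in h; exact: le_trans (sq y x) h.
split; split.
- move=> a F G test_funF test_funG; rewrite density_of_linear lT; try exact: density_of_test.
  by case: (T (density_of F)) => x y; case: (T (density_of G)) => x' y' /=; ring.
- by move=> F G FG; rewrite (density_of_eq FG).
- move=> e K H fH; have [C HC] := distribution_bound dT fH; exists C => s se.
  by have [] := normE _ _ (HC s se).
- move=> a F G test_funF test_funG; rewrite density_of_linear lT; try exact: density_of_test.
  by case: (T (density_of F)) => x y; case: (T (density_of G)) => x' y' /=; ring.
- by move=> F G FG; rewrite (density_of_eq FG).
- move=> e K H fH; have [C HC] := distribution_bound dT fH; exists C => s se.
  by have [] := normE _ _ (HC s se).
Qed.

Section Admissible.
Variables (Lam : ('rV[R]_N -> R) -> R).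
Hypothesis aL : admissible Lam.

Lemma lam_lin a F G : test_fun F -> test_fun G ->
  Lam (fun v => a * F v + G v) = a * Lam F + Lam G.
Proof. by have [h _ _] := aL; exact: h. Qed.

Lemma lam_eq F G : (forall p, X p -> F (vec p) = G (vec p)) -> Lam F = Lam G.
Proof. by have [_ h _] := aL; exact: h. Qed.

Lemma lam_expand e K H : smooth_family e K H ->
  exists C, forall s, `|s| <= e / 2 ->
    `|Lam (fun v => H (time_row s v)) - Lam (fun v => H (time_row 0 v))
      - s * Lam (fun v => partial time_idx H (time_row 0 v))| <= C * s ^+ 2.
Proof.
move=> fH; have [e0 _ _ _ _] := fH; have [_ _ h] := aL.
have [C HC] := h _ _ _ fH; exists C => s se.
have se' : `|s| < e by lra.
have W1 := family_slice_test_fun fH se'.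
have W2 : test_fun (fun v => H (time_row 0 v)) by apply: family_slice_test_fun fH _; rewrite normr0.
have W3 := family_velocity_test_fun fH.
have W4 : test_fun (fun v => s * partial time_idx H (time_row 0 v) + H (time_row 0 v)).
  have [s2 [K2 [cK2 KX2 H2]]] := W2; have [s3 [K3 [cK3 KX3 H3]]] := W3.
  have oU := @open_regular R n.
  split; first exact: (smooth_add oU (smooth_mul oU (@smooth_cst _ _ U s) s3) s2).
  exists (K2 `|` K3); split; first exact: compactU.
    by move=> p [/KX2|/KX3].
  by move=> p Xp /not_orP [k2 k3]; rewrite H2 // H3 // mulr0 addr0.
have -> : Lam (fun v => H (time_row s v)) - Lam (fun v => H (time_row 0 v))
      - s * Lam (fun v => partial time_idx H (time_row 0 v)) = Lam (taylor_rest H s).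
  have -> : Lam (taylor_rest H s) = Lam (fun v =>
      (-1) * (s * partial time_idx H (time_row 0 v) + H (time_row 0 v)) + H (time_row s v)).
    by apply: lam_eq => p _; rewrite /taylor_rest; ring.
  by rewrite !lam_lin //; ring.
exact: HC.
Qed.

(** When the values along the family are constant, the expansion reads |s D| <= C s^2 for the value
    [D] on the velocity, and small [s] forces [D = 0]. *)
Lemma lam_velocity e K H : smooth_family e K H ->
  (forall s, `|s| < e -> Lam (fun v => H (time_row s v)) = Lam (fun v => H (time_row 0 v))) ->
  Lam (fun v => partial time_idx H (time_row 0 v)) = 0.
Proof.
move=> fH inv; have [e0 _ _ _ _] := fH; have [C HC] := lam_expand fH.
set D := Lam _.
apply/eqP; rewrite -normr_le0; apply/ler_addgt0Pr => r r0; rewrite add0r.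
have C1 : 0 < `|C| + 1 by rewrite ltr_wpDl.
(* Small enough that C s <= r; adding 1 to |C| keeps the denominator positive. *)
pose s := Num.min (e / 2) (r / (`|C| + 1)).
have s0 : 0 < s by rewrite lt_min !divr_gt0.
have se : `|s| <= e / 2 by rewrite gtr0_norm // ge_min lexx.
have := HC s se; rewrite inv ?subrr ?sub0r ?normrN; last by lra.
rewrite normrM gtr0_norm // expr2 mulrA [C * s]mulrC -mulrA ler_pM2l // => h.
apply: le_trans h _; apply: le_trans (ler_wpM2r (ltW s0) (ler_norm C)) _.
apply: le_trans (ler_wpM2r (ltW s0) (_ : `|C| <= `|C| + 1)) _; first by rewrite lerDl.
by rewrite mulrC -ler_pdivlMr // ge_min lexx orbT.
Qed.

End Admissible.
End Differentiation.

(** * Functionals killed by the general linear vector fields *)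

Section InvariantFunctionals.
Variables (R : comNzRingType) (V : Type) (U : V -> Prop) (I : eqType).
Variables (swap : I -> I) (co : I -> V -> R) (P : I -> (V -> R) -> V -> R).
Variables (S : (V -> R) -> Prop) (Lam : (V -> R) -> R).
Implicit Types (F G : V -> R) (a b c e : I) (v : V).

Hypothesis S_coordM : forall j F, S F -> S (fun v => co j v * F v).
Hypothesis S_partial : forall i F, S F -> S (P i F).
Hypothesis S_lin : forall (t : R) F G, S F -> S G -> S (fun v => t * F v + G v).
Hypothesis P_coordM : forall i j F v, S F -> U v ->
  P i (fun v => co j v * F v) v = co j v * P i F v + (i == j)%:R * F v.
Hypothesis P_lin : forall i (t : R) F G v, S F -> S G -> U v ->
  P i (fun v => t * F v + G v) v = t * P i F v + P i G v.
Hypothesis P_ext : forall i F G v, (forall v, U v -> F v = G v) -> U v -> P i F v = P i G v.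
Hypothesis P_comm : forall i j F v, S F -> U v -> P i (P j F) v = P j (P i F) v.
Hypothesis Lam_lin : forall (t : R) F G, S F -> S G ->
  Lam (fun v => t * F v + G v) = t * Lam F + Lam G.
Hypothesis Lam_ext : forall F G, (forall v, U v -> F v = G v) -> Lam F = Lam G.

(** The field of so(q) attached to the bivector of [a] and [b]. In the notation of the overview,
    E_ij is [rotation (x i) (y j)], A_j is [rotation (x k0) (x j)], B_j is [rotation (x k0) (y j)],
    and D is [rotation (y k2) (y k1)]. Coordinates and derivatives are abstract here because the
    argument is applied a second time with x and y exchanged. *)
Definition rotation a b F : V -> R := fun v => co a v * P (swap b) F v - co b v * P (swap a) F v.

Lemma S_sub F G : S F -> S G -> S (fun v => F v - G v).
Proof.
move=> SF SG; have := S_lin (-1) SG SF; congr S; apply/funext => v.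
by ring.
Qed.

Lemma S_add F G : S F -> S G -> S (fun v => F v + G v).
Proof.
move=> SF SG; have := S_lin 1 SF SG; congr S; apply/funext => v.
by ring.
Qed.

Lemma S_rotation a b F : S F -> S (rotation a b F).
Proof. by move=> SF; apply: S_sub; apply: S_coordM; exact: S_partial. Qed.

Lemma P_sub i F G v : S F -> S G -> U v ->
  P i (fun v => F v - G v) v = P i F v - P i G v.
Proof.
move=> SF SG Uv; rewrite (P_ext i (G := fun v => (-1) * G v + F v)) //; last first.
  by move=> w _; ring.
by rewrite P_lin //; ring.
Qed.

Lemma rotation_lin a b (t : R) F G v : S F -> S G -> U v ->
  rotation a b (fun v => t * F v + G v) v = t * rotation a b F v + rotation a b G v.
Proof. by move=> SF SG Uv; rewrite /rotation !P_lin //; ring. Qed.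

Lemma rotation_ext a b F G v : (forall v, U v -> F v = G v) -> U v ->
  rotation a b F v = rotation a b G v.
Proof. by move=> FG Uv; rewrite /rotation !(P_ext _ FG Uv). Qed.

Lemma P_rotation i a b F v : S F -> U v ->
  P i (rotation a b F) v =
    co a v * P i (P (swap b) F) v + (i == a)%:R * P (swap b) F v
  - (co b v * P i (P (swap a) F) v + (i == b)%:R * P (swap a) F v).
Proof.
move=> SF Uv; have Sa := S_partial (swap a) SF; have Sb := S_partial (swap b) SF.
by rewrite -!P_coordM // -P_sub //; exact: S_coordM.
Qed.

(** The second-order terms cancel because the derivatives commute; what remains are the structure
    relations of so(q). *)
Lemma rotation_commutator F a b c e v : S F -> U v ->
  rotation a b (rotation c e F) v - rotation c e (rotation a b F) v =
    (co a v * (swap b == c)%:R - co b v * (swap a == c)%:R) * P (swap e) F v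
  - (co a v * (swap b == e)%:R - co b v * (swap a == e)%:R) * P (swap c) F v
  - (co c v * (swap e == a)%:R - co e v * (swap c == a)%:R) * P (swap b) F v
  + (co c v * (swap e == b)%:R - co e v * (swap c == b)%:R) * P (swap a) F v.
Proof.
move=> SF Uv; rewrite [in LHS]/rotation !P_rotation //.
rewrite (P_comm (swap b) (swap e)) // (P_comm (swap b) (swap c)) //.
rewrite (P_comm (swap a) (swap e)) // (P_comm (swap a) (swap c)) //.
by ring.
Qed.

Variables (K : eqType) (x y : K -> I) (K1 : pred K).
Hypotheses (kx : forall i, swap (x i) = y i) (ky : forall i, swap (y i) = x i).
Hypotheses (xE : forall i j, (x i == x j) = (i == j)) (yE : forall i j, (y i == y j) = (i == j)).
Hypotheses (xy : forall i j, (x i == y j) = false) (yx : forall i j, (y i == x j) = false).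
Hypothesis inv : forall i j F, K1 i -> K1 j -> S F -> Lam (rotation (x i) (y j) F) = 0.
Variables (k0 k1 k2 k3 : K).
Hypotheses (K1k0 : ~~ K1 k0) (K1k1 : K1 k1) (K1k2 : K1 k2) (K1k3 : K1 k3).
Hypotheses (k12 : k1 != k2) (k13 : k1 != k3) (k23 : k2 != k3).

Let D F := rotation (y k2) (y k1) F.

Let k0E i : K1 i -> ((k0 == i) = false) * ((i == k0) = false).
Proof.
by move=> Ki; split; apply: contraNF K1k0 => /eqP; [move=> -> | move=> <-].
Qed.

Let ne : ((k1 == k2) = false) * ((k2 == k1) = false) * ((k1 == k3) = false)
  * ((k3 == k1) = false) * ((k2 == k3) = false) * ((k3 == k2) = false).
Proof. by rewrite ![_ == k1]eq_sym [k3 == k2]eq_sym !(negbTE k12, negbTE k13, negbTE k23). Qed.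

Let k0s := (k0E K1k1, k0E K1k2, k0E K1k3).
Let b01 : (false%:R = 0 :> R) * (true%:R = 1 :> R). Proof. by []. Qed.
(** Evaluates every Kronecker delta produced by the Leibniz rule, leaving identities for [ring]. *)
Let idx := (kx, ky, xE, yE, xy, yx, ne, k0s, eqxx, b01).

Lemma D_lin (t : R) F G : S F -> S G ->
  Lam (D (fun v => t * F v + G v)) = t * Lam (D F) + Lam (D G).
Proof.
move=> SF SG; rewrite -Lam_lin; try exact: S_rotation.
by apply: Lam_ext => v Uv; exact: rotation_lin.
Qed.

Lemma D_ext F G : (forall v, U v -> F v = G v) -> Lam (D F) = Lam (D G).
Proof. by move=> FG; apply: Lam_ext => v; exact: rotation_ext. Qed.

(** For [k] equal to [k1] or [k2] the derivatives also fall on coordinate factors; these extra terms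
    agree on the two sides, so the identity is uniform in [k]. *)
Lemma D_coord k F : K1 k -> S F -> Lam (D (fun v => co (x k) v * F v)) = 0.
Proof.
move=> Kk SF; have S1 := S_coordM (y k1) SF; have S2 := S_coordM (y k2) SF.
rewrite (Lam_ext (G := fun v =>
  (-1) * rotation (x k) (y k2) (fun v => co (y k1) v * F v) v +
  rotation (x k) (y k1) (fun v => co (y k2) v * F v) v)).
  by rewrite Lam_lin ?inv //; [ring | exact: S_rotation | exact: S_rotation].
move=> v Uv; rewrite /D /rotation !P_coordM // !idx ![k == _]eq_sym.
by ring.
Qed.

(* [rotation (x k3) (y j)] commutes with [D] for [j = k1, k3]. *)
Lemma D_field3 j F : j \in [:: k1; k3] -> S F -> Lam (D (rotation (x k3) (y j) F)) = 0.
Proof.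
move=> jk SF; have Kj : K1 j by move: jk; rewrite !inE => /orP[] /eqP ->.
rewrite (Lam_ext (G := rotation (x k3) (y j) (D F))); first by rewrite inv //; exact: S_rotation.
move=> v Uv; apply/eqP; rewrite -subr_eq0 -opprB oppr_eq0 rotation_commutator // !idx.
by move: jk; rewrite !inE => /orP[] /eqP ->; rewrite ?idx; apply/eqP; ring.
Qed.

(* [D] is an eigenvector of [rotation (x k1) (y k1)] for the adjoint action. *)
Lemma D_weight F : S F -> Lam (D F) = Lam (D (rotation (x k1) (y k1) F)).
Proof.
move=> SF; have SE := S_rotation (x k1) (y k1) SF.
rewrite (Lam_ext (G := fun v => (-1) * rotation (x k1) (y k1) (D F) v +
   D (rotation (x k1) (y k1) F) v)).
  have SD := S_rotation (y k2) (y k1) SF.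
  rewrite (Lam_lin (-1) (S_rotation _ _ SD) (S_rotation _ _ SE)) (inv K1k1 K1k1 SD).
  by ring.
move=> v Uv; have := rotation_commutator (x k1) (y k1) (y k2) (y k1) SF Uv.
rewrite !idx -/(D F) -/(D (rotation (x k1) (y k1) F)) => h.
have -> : D (rotation (x k1) (y k1) F) v =
  rotation (x k1) (y k1) (D F) v - (rotation (x k1) (y k1) (D F) v - D (rotation (x k1) (y k1) F) v).
  by ring.
by rewrite h /D [in LHS]/rotation !idx; ring.
Qed.

(** After [D_weight], the field E_11 passes through the coordinate [x k0], and the B_1 part carries
    a factor [x k1], so [D_coord] removes it. Only the A_1 part survives. *)
Lemma D_coord0 F : S F -> Lam (D (fun v => co (x k0) v * F v)) =
  - Lam (D (fun v => co (y k1) v * rotation (x k0) (x k1) F v)).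
Proof.
move=> SF; have SA := S_rotation (x k0) (x k1) SF; have SB := S_rotation (x k0) (y k1) SF.
rewrite D_weight; last exact: S_coordM.
rewrite (D_ext (G := fun v => (-1) * (co (y k1) v * rotation (x k0) (x k1) F v) +
   co (x k1) v * rotation (x k0) (y k1) F v)).
  by rewrite D_lin ?D_coord //; [ring | exact: S_coordM | exact: S_coordM].
by move=> v Uv; rewrite /rotation !P_coordM // !idx; ring.
Qed.

(** In the four-term identity all derivatives of [G] cancel; the bare product appears because the
    y_3-derivative in E_31 hits the factor [y k3]. The terms with a factor [x k3] fall to [D_coord],
    the other two to [D_field3]. *)
Lemma D_coord0y G : S G -> Lam (D (fun v => co (x k0) v * (co (y k1) v * G v))) = 0.
Proof.
move=> SG; have S1 := S_coordM (y k1) SG; have S3 := S_coordM (y k3) SG.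
have S01 := S_coordM (x k0) S1; have S03 := S_coordM (x k0) S3.
have T1 := S_coordM (x k3) (S_rotation (x k0) (y k1) S3).
have T2 := S_rotation (x k3) (y k1) S03.
have T3 := S_coordM (x k3) (S_rotation (x k0) (y k3) S1).
have T4 := S_rotation (x k3) (y k3) S01.
rewrite (D_ext (G := fun v =>
  (-1) * (co (x k3) v * rotation (x k0) (y k3) (fun v => co (y k1) v * G v) v) +
  ((-1) * rotation (x k3) (y k1) (fun v => co (x k0) v * (co (y k3) v * G v)) v +
  (1 * (co (x k3) v * rotation (x k0) (y k1) (fun v => co (y k3) v * G v) v) +
   rotation (x k3) (y k3) (fun v => co (x k0) v * (co (y k1) v * G v)) v)))).
  have T5 := S_lin 1 T1 T4; have T6 := S_lin (-1) T2 T5.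
  rewrite (D_lin (-1) T3 T6) (D_lin (-1) T2 T5) (D_lin 1 T1 T4).
  by rewrite !D_coord ?D_field3 ?inE ?eqxx ?orbT //; [ring | exact: S_rotation | exact: S_rotation].
move=> v Uv; rewrite /rotation !P_coordM // !idx.
by ring.
Qed.

(** [D_coord0] trades one factor [x k0] for [y k1], and A_1 does not differentiate the other factor,
    so [D_coord0y] finishes. *)
Lemma D_coord00 F : S F -> Lam (D (fun v => co (x k0) v * (co (x k0) v * F v))) = 0.
Proof.
move=> SF; rewrite D_coord0; last exact: S_coordM.
rewrite (D_ext (G := fun v => co (x k0) v * (co (y k1) v * rotation (x k0) (x k1) F v))).
  by rewrite D_coord0y ?oppr0 //; exact: S_rotation.
by move=> v Uv; rewrite /rotation !P_coordM // !idx; ring.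
Qed.

(** Meant for G = F / |x|^2, which turns the vanishing on each square x_k^2 G into the vanishing on
    [F]. *)
Lemma bivector_kills (s : seq K) F G : S F -> S G -> all K1 s ->
  (forall v, U v -> F v = co (x k0) v * (co (x k0) v * G v) +
     \sum_(k <- s) co (x k) v * (co (x k) v * G v)) -> Lam (D F) = 0.
Proof.
move=> SF SG Ks /D_ext ->; elim: s Ks => [_|k s IH /= /andP[Kk Ks]].
  rewrite -[RHS](D_coord00 SG); apply: D_ext => v Uv.
  by rewrite big_nil addr0.
have S00 := S_coordM (x k0) (S_coordM (x k0) SG).
have Ss : S (fun v => co (x k0) v * (co (x k0) v * G v) +
     \sum_(k <- s) co (x k) v * (co (x k) v * G v)).
  elim: s {IH Ks} => [|j s IH].
    by move: S00; congr S; apply/funext => v; rewrite big_nil addr0.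
  have := S_add (S_coordM (x j) (S_coordM (x j) SG)) IH.
  by congr S; apply/funext => v; rewrite big_cons addrCA.
rewrite (D_ext (G := fun v => 1 * (co (x k) v * (co (x k) v * G v)) +
  (co (x k0) v * (co (x k0) v * G v) + \sum_(k <- s) co (x k) v * (co (x k) v * G v)))).
  have Skk := S_coordM (x k) SG.
  by rewrite D_lin ?D_coord ?IH //; [ring | exact: S_coordM].
by move=> v Uv; rewrite big_cons mul1r addrCA.
Qed.

End InvariantFunctionals.

(** * Coordinate multiplications and partial derivatives on extended test functions *)

Section VectorFields.
Variables (R : realType) (n : nat).

Local Notation E := (ambient R n).
Local Notation N := (1 + dimX1 n)%N.
Local Notation X := (@X1 R n).
Local Notation U := (@regular R n).
Implicit Types (F G : 'rV[R]_N -> R) (v : 'rV[R]_N).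

Definition coordinate (j : 'I_N) : 'rV[R]_N -> R := fun v => v 0 j.

Lemma coord_smooth j : smooth_on U (coordinate j). Proof. exact: smooth_coord. Qed.

Lemma partial_coordM F v i j : test_ext F -> U v ->
  partial i (fun v => coordinate j v * F v) v = coordinate j v * partial i F v + (i == j)%:R * F v.
Proof.
move=> [sF _] Uv; have dF := smooth_derivable (i := i) sF Uv.
have dc := smooth_derivable (i := i) (coord_smooth j) Uv.
have h := deriveM dc dF; apply: etrans h _.
by rewrite -[X in _ + F v *: X]/(partial i (coordinate j) v) [partial i _ v]partial_coord
  /GRing.scale /= [F v * _]mulrC.
Qed.

Lemma partial_lin F G v i (t : R) : test_ext F -> test_ext G -> U v ->
  partial i (fun v => t * F v + G v) v = t * partial i F v + partial i G v.
Proof.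
move=> [sF _] [sG _] Uv; have dF := smooth_derivable (i := i) sF Uv.
have dG := smooth_derivable (i := i) sG Uv.
have dt := derivable_cst (t : R) v (delta_mx 0 i).
have h := deriveD (derivableM dt dF) dG; apply: etrans h _.
by rewrite (deriveM dt dF) derive_cst scaler0 addr0.
Qed.

(** [K] is closed, so a point retracting outside [K] has a whole neighbourhood doing so; this is
    what lets derivatives keep the support. *)
Lemma test_ext_near F : test_ext F -> exists K : set E,
  [/\ compact K, K `<=` X &
      forall v, U v -> ~ K (unvec (retract v)) -> \forall w \near v, F w = 0].
Proof.
move=> [sF [K [cK KX FK]]]; exists K; split=> // v Uv Kv.
have cr : {for v, continuous (fun w => unvec (retract w))}.
  apply: continuous_comp; last exact: unvec_continuous.
  apply: mx_continuous => i j; rewrite (ord1 i).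
  exact: smooth_continuous (retract_smooth j) Uv.
have clK : closed K by apply: compact_closed => //; exact: norm_hausdorff.
have oK : open (~` K) by exact: closed_openC.
have nK : \forall w \near v, ~ K (unvec (retract w)).
  by have := cr _ (open_nbhs_nbhs (conj oK Kv)).
have nU : \forall w \near v, U w by apply: open_nbhs_nbhs; split=> //; exact: open_regular.
by apply: filterS (filterI nU nK) => w [Uw Kw]; exact: FK.
Qed.

Lemma test_ext_partial i F : test_ext F -> test_ext (partial i F).
Proof.
move=> test_extF; have [sF _] := test_extF; have [K [cK KX nK]] := test_ext_near test_extF.
split; first exact: (smooth_partial i sF).
exists K; split=> // v Uv Kv.
rewrite /partial (near_eq_derive _ (nK v Uv Kv)); exact: derive_cst.
Qed.

Lemma test_ext_mul (g : 'rV[R]_N -> R) F : smooth_on U g -> test_ext F -> test_ext (fun v => g v * F v).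
Proof.
move=> sg [sF [K [cK KX FK]]]; split; first exact: (smooth_mul (@open_regular R n) sg sF).
by exists K; split=> // v Uv Kv; rewrite FK // mulr0.
Qed.

Lemma test_ext_coordM j F : test_ext F -> test_ext (fun v => coordinate j v * F v).
Proof. exact: (test_ext_mul (coord_smooth j)). Qed.

Lemma test_ext_lin (t : R) F G : test_ext F -> test_ext G -> test_ext (fun v => t * F v + G v).
Proof.
move=> [sF [K [cK KX FK]]] [sG [K' [cK' KX' GK]]]; split.
  exact: (smooth_add (@open_regular R n) (smooth_mul (@open_regular R n) (@smooth_cst _ _ U t) sF) sG).
exists (K `|` K'); split; first exact: compactU.
  by move=> p [/KX|/KX'].
by move=> v Uv /not_orP [k k']; rewrite FK // GK // mulr0 addr0.
Qed.

Local Notation r := (@rshift 1 n).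
Local Notation z := (@lshift 1 n 0).

(** The maps [x] and [y] are parameters so that the upper and the lower unipotent group are obtained
    from the same statement. *)
Lemma lam_bivector (Lam : ('rV[R]_N -> R) -> R) (x y : 'I_(1 + n) -> 'I_N) :
  admissible Lam ->
  (forall i, swap (x i) = y i) -> (forall i, swap (y i) = x i) ->
  injective x -> injective y -> (forall i j, (x i == y j) = false) ->
  (forall v, U v -> \sum_i v 0 (x i) ^+ 2 != 0) ->
  (forall i j F, test_ext F -> Lam (rotation (@swap n) coordinate (@partial R _ R) (x (r i)) (y (r j)) F) = 0) ->
  (3 <= n)%N -> forall (i1 i2 : 'I_n) F, i1 != i2 -> test_ext F ->
  Lam (rotation (@swap n) coordinate (@partial R _ R) (y (r i2)) (y (r i1)) F) = 0.
Proof.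
move=> aL kx ky xI yI xy x0 inv n3 i1 i2 F i12 test_extF.
(* The third index exists because [n >= 3]. *)
have [i3 /andP[i13 i23]] : exists i3 : 'I_n, (i1 != i3) && (i2 != i3).
  have /card_gt0P [i3] : (0 < #|~: [set i1; i2]|)%N.
    by rewrite cardsCs finset.setCK card_ord cards2 i12 subn_gt0.
  by rewrite !inE negb_or ![i3 == _]eq_sym => h; exists i3.
pose q (v : 'rV[R]_N) := (\sum_i v 0 (x i) ^+ 2)^-1.
have sq : smooth_on U q.
  apply: smooth_inv; [exact: open_regular | exact: x0 |].
  apply: smooth_sum; first exact: open_regular.
  move=> i; have h := smooth_mul (@open_regular R n) (coord_smooth (x i)) (coord_smooth (x i)).
  by apply: smooth_eq (@open_regular R n) _ h => v _; rewrite expr2.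
have SG := test_ext_mul sq test_extF.
apply: (@bivector_kills R 'rV[R]_N U 'I_N (@swap n) coordinate (@partial R _ R) (@test_ext R n) Lam
  _ _ _ _ _ _ _ _ _ 'I_(1 + n) x y (fun k => k != z) kx ky _ _ xy _ _
  z (r i1) (r i2) (r i3) _ _ _ _ _ _ _ [seq r i | i <- enum 'I_n] F (fun v => q v * F v) test_extF SG).
- exact: test_ext_coordM.
- exact: test_ext_partial.
- exact: test_ext_lin.
- by move=> i j G v; exact: partial_coordM.
- by move=> i t G H v; exact: partial_lin.
- by move=> i G H v GH Uv; exact: partial_eq (@open_regular R n) Uv GH.
- by move=> i j G v [sG _] Uv; exact: smooth_partialC (@open_regular R n) sG Uv.
- by move=> t G H /test_ext_test_fun wG /test_ext_test_fun wH; exact: (lam_lin aL).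
- by move=> G H GH; apply: (lam_eq aL) => p Xp; apply: GH; exact: X1_regular.
- by move=> i j; exact: inj_eq.
- by move=> i j; exact: inj_eq.
- by move=> i j; rewrite eq_sym xy.
- move=> i j G; rewrite -(splitK i) -(splitK j).
  case: (fintype.split i) => [i'|i'] /=; first by rewrite (ord1 i') eqxx.
  case: (fintype.split j) => [j'|j'] /=; first by rewrite (ord1 j') eqxx.
  by move=> _ _; exact: inv.
- by rewrite eqxx.
- by rewrite eq_rlshift.
- by rewrite eq_rlshift.
- by rewrite eq_rlshift.
- by rewrite (inj_eq (@rshift_inj _ _)).
- by rewrite (inj_eq (@rshift_inj _ _)).
- by rewrite (inj_eq (@rshift_inj _ _)).
- by apply/allP => k /mapP [i _ ->]; rewrite eq_rlshift.
- move=> v Uv; rewrite big_map big_enum /=.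
  have E1 k : coordinate (x k) v * (coordinate (x k) v * (q v * F v)) = coordinate (x k) v ^+ 2 * (q v * F v).
    by rewrite mulrA expr2.
  under eq_bigr do rewrite E1.
  rewrite E1 -mulr_suml -mulrDl mulrA.
  have -> : coordinate (x z) v ^+ 2 + \sum_i coordinate (x (r i)) v ^+ 2 = \sum_i v 0 (x i) ^+ 2.
    by rewrite big_split_ord /= big_ord1.
  by rewrite /q divff ?mul1r //; exact: x0.
Qed.

End VectorFields.

(** * The action on coordinates *)

Section Actions.
Variables (R : realType) (n : nat).

Local Notation E := (ambient R n).
Local Notation d := (dimX1 n).
Local Notation N := (1 + dimX1 n)%N.
Local Notation X := (@X1 R n).
Local Notation TX := (@TX1 R n).
Local Notation r := (@rshift 1 n).
Local Notation z := (@lshift 1 n 0).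
Implicit Types (M : 'M[R]_(n + n)) (v w : 'rV[R]_N) (p : E).

Definition coord_act M v : 'rV[R]_N := vec (actSO M (unvec v)).

Definition rest_idx (k : 'I_(n + n)) : 'I_N :=
  match fintype.split k with inl i => x_idx (r i) | inr i => y_idx (r i) end.

Lemma rest_idx_l i : rest_idx (lshift n i) = x_idx (r i).
Proof. by rewrite /rest_idx -[lshift _ _]/(unsplit (inl i)) unsplitK. Qed.

Lemma rest_idx_r i : rest_idx (rshift n i) = y_idx (r i).
Proof. by rewrite /rest_idx -[rshift _ _]/(unsplit (inr i)) unsplitK. Qed.

Variant act_idx_spec : 'I_N -> Type :=
  | ActX : act_idx_spec (x_idx z)
  | ActY : act_idx_spec (y_idx z)
  | ActZ k : act_idx_spec (rest_idx k).

Lemma act_idxP j : act_idx_spec j.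
Proof.
case: (idxP j) => i; rewrite -(splitK i); case: (fintype.split i) => k /=.
- by rewrite (ord1 k); exact: ActX.
- by rewrite -rest_idx_l; exact: ActZ.
- by rewrite (ord1 k); exact: ActY.
- by rewrite -rest_idx_r; exact: ActZ.
Qed.

Definition rest_vec v : 'cV[R]_(n + n) := \col_k v 0 (rest_idx k).

Lemma rest_vecE v : col_mx (dsubmx (unvec v).1) (dsubmx (unvec v).2) = rest_vec v.
Proof.
apply/colP => k; rewrite -(splitK k); case: (fintype.split k) => i /=.
  by rewrite col_mxEu !mxE rest_idx_l.
by rewrite col_mxEd !mxE rest_idx_r.
Qed.

Lemma coord_act_rest_idx M v k : coord_act M v 0 (rest_idx k) = \sum_l M k l * v 0 (rest_idx l).
Proof.
rewrite /coord_act /actSO rest_vecE -(splitK k); case: (fintype.split k) => i /=.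
  rewrite rest_idx_l vec_x_idx /= col_mxEd !mxE; apply: eq_bigr => l _.
  by rewrite [rest_vec _ _ _]mxE.
rewrite rest_idx_r vec_y_idx /= col_mxEd !mxE; apply: eq_bigr => l _.
by rewrite [rest_vec _ _ _]mxE.
Qed.

Lemma coord_act_xz M v : coord_act M v 0 (x_idx z) = v 0 (x_idx z).
Proof. by rewrite /coord_act /actSO vec_x_idx /= col_mxEu !mxE. Qed.

Lemma coord_act_yz M v : coord_act M v 0 (y_idx z) = v 0 (y_idx z).
Proof. by rewrite /coord_act /actSO vec_y_idx /= col_mxEu !mxE. Qed.

Lemma rest_vec_coord_act M v : rest_vec (coord_act M v) = M *m rest_vec v.
Proof.
apply/colP => k; rewrite [LHS]mxE coord_act_rest_idx [RHS]mxE; apply: eq_bigr => l _.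
by rewrite [rest_vec _ _ _]mxE.
Qed.

Lemma rest_vec_inj v w : v 0 (x_idx z) = w 0 (x_idx z) -> v 0 (y_idx z) = w 0 (y_idx z) ->
  rest_vec v = rest_vec w -> v = w.
Proof.
move=> hx hy hz; apply/rowP => j; case: (act_idxP j) => // k.
by move/colP: hz => /(_ k); rewrite [LHS]mxE [RHS]mxE.
Qed.

Lemma coord_act_mul M M' v : coord_act (M *m M') v = coord_act M (coord_act M' v).
Proof. by apply: rest_vec_inj; rewrite ?coord_act_xz ?coord_act_yz // !rest_vec_coord_act mulmxA. Qed.

Lemma ga1 v : coord_act 1%:M v = v.
Proof. by apply: rest_vec_inj; rewrite ?coord_act_xz ?coord_act_yz // rest_vec_coord_act mul1mx. Qed.

Lemma coord_act_linear M : linear (coord_act M).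
Proof.
have linE a (v w : 'rV[R]_N) j : (a *: v + w) 0 j = a * v 0 j + w 0 j by rewrite !mxE.
move=> a v w; apply/rowP => j; rewrite linE; case: (act_idxP j) => [||k].
- by rewrite !coord_act_xz linE.
- by rewrite !coord_act_yz linE.
rewrite !coord_act_rest_idx mulr_sumr -big_split /=; apply: eq_bigr => l _.
by rewrite linE; ring.
Qed.

Lemma quad_rest_vec v : quad v = v 0 (x_idx z) * v 0 (y_idx z) + Q1 (rest_vec v).
Proof.
rewrite /quad big_split_ord /= big_ord1; congr (_ + _).
by apply: eq_bigr => i _; rewrite !mxE rest_idx_l rest_idx_r.
Qed.

Lemma O_Q1_P M : O_Q1 M -> forall v, quad (coord_act M v) = quad v.
Proof. by move=> [_ HM] v; rewrite !quad_rest_vec rest_vec_coord_act coord_act_xz coord_act_yz HM. Qed.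

Lemma O_Q1_1 : O_Q1 (1%:M : 'M[R]_(n + n)).
Proof. by split=> [|u]; rewrite ?unitmx1 // mul1mx. Qed.

Lemma O_Q1_mul M M' : O_Q1 M -> O_Q1 M' -> O_Q1 (M *m M').
Proof.
move=> [uM HM] [uM' HM']; split; first by rewrite unitmx_mul uM uM'.
by move=> u; rewrite -mulmxA HM HM'.
Qed.

Lemma O_Q1_inv M : O_Q1 M -> O_Q1 (invmx M).
Proof.
move=> [uM HM]; split; first by rewrite unitmx_inv.
by move=> u; rewrite -HM mulKVmx.
Qed.

Lemma coord_act_polar M : O_Q1 M -> forall v w, polar (coord_act M v) (coord_act M w) = polar v w.
Proof.
move=> OM v w; have h u u' : polar u u' = quad (u + u') - quad u - quad u' :> R.
  by rewrite quadD; ring.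
have gD : coord_act M (v + w) = coord_act M v + coord_act M w by have := coord_act_linear M 1 v w; rewrite !scale1r.
by rewrite !h -gD !O_Q1_P.
Qed.

Lemma coord_act_smooth M (V : set 'rV[R]_N) j : open V -> smooth_on V (fun v => coord_act M v 0 j).
Proof.
move=> oV; case: (act_idxP j) => [||k].
- rewrite (_ : (fun v => _) = fun v : 'rV[R]_N => v 0 (x_idx z)); first exact: smooth_coord.
  by apply/funext => v; rewrite coord_act_xz.
- rewrite (_ : (fun v => _) = fun v : 'rV[R]_N => v 0 (y_idx z)); first exact: smooth_coord.
  by apply/funext => v; rewrite coord_act_yz.
rewrite (_ : (fun v => _) = fun v => \sum_l M k l * v 0 (rest_idx l)).
  apply: smooth_sum => [|l]; first exact: oV.
  exact: (smooth_mul oV (@smooth_cst _ _ V (M k l)) (@smooth_coord _ _ V (rest_idx l))).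
by apply/funext => v; rewrite coord_act_rest_idx.
Qed.

Lemma coord_act_continuous M : continuous (coord_act M).
Proof.
move=> v; apply: mx_continuous => i j; rewrite (ord1 i).
by apply: (smooth_continuous (coord_act_smooth M j openT)).
Qed.

Lemma actSO_coord_act M p : actSO M p = unvec (coord_act M (vec p)).
Proof. by rewrite /coord_act !vecK. Qed.

Lemma actSO_linear M : linear (actSO M : E -> E).
Proof. by move=> a p p'; rewrite !actSO_coord_act linearP coord_act_linear linearP. Qed.

Lemma actSO_continuous M : continuous (actSO M : E -> E).
Proof.
have -> : (actSO M : E -> E) = @unvec R n \o (coord_act M \o @vec R n).
  by apply/funext => p; rewrite /= actSO_coord_act.
move=> p; apply: continuous_comp; last exact: unvec_continuous.
by apply: continuous_comp; [exact: vec_continuous | exact: coord_act_continuous].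
Qed.

Lemma derive_actSO M p (w : E) : 'D_w (actSO M : E -> E) p = actSO M w.
Proof.
pose lM := GRing.isLinear.Build _ _ _ _ _ (actSO_linear M).
pose l : {linear E -> E} := HB.pack (actSO M : E -> E) lM.
have cl : continuous l by exact: actSO_continuous.
rewrite -[actSO M : E -> E]/(l : E -> E) deriveE; last exact: linear_differentiable.
by rewrite diff_lin.
Qed.

(** With [J] the Gram matrix of [polar], preservation reads G J G^T = J. Since [J] is an involution
    its determinant can be cancelled, leaving a square equal to 1. *)
Lemma det_preserving (G : 'M[R]_N) :
  (forall v w, polar (v *m G) (w *m G) = polar v w) -> `|\det G| = 1.
Proof.
move=> pG.
pose J : 'M[R]_N := \matrix_(i, j) (j == swap i)%:R.
have bJ v w : polar v w = (v *m J *m w^T) 0 0.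
  rewrite mxE /polar (reindex_inj (can_inj (@swapK n))) /=; apply: eq_bigr => j _.
  rewrite !mxE (bigD1 (swap j)) //= big1 ?addr0 => [|i ij].
    by rewrite mxE swapK eqxx mulr1.
  rewrite mxE; have -> : (j == swap i) = false; last by rewrite mulr0.
  by apply/negbTE; apply: contra ij => /eqP ->; rewrite swapK.
have E1 : G *m J *m G^T = J.
  apply/matrixP => i j.
  have e (A : 'M[R]_N) : A i j = ((delta_mx 0 i : 'rV[R]_N) *m A *m (delta_mx 0 j : 'rV[R]_N)^T) 0 0.
    by rewrite trmx_delta -rowE -colE !mxE.
  rewrite e [in RHS]e -!bJ -(pG (delta_mx 0 i)) bJ trmx_mul !mulmxA.
  by [].
have J2 : J *m J = 1%:M.
  apply/matrixP => i j; rewrite !mxE (bigD1 (swap i)) //= big1 ?addr0 => [|k ki].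
    by rewrite !mxE eqxx mul1r swapK eq_sym.
  by rewrite !mxE (negbTE ki) mul0r.
have dJ : \det J != 0.
  apply/eqP => d0; have := congr1 determinant J2.
  by rewrite det_mulmx d0 mul0r det1 => /esym/eqP; rewrite oner_eq0.
have := congr1 determinant E1; rewrite !det_mulmx det_tr mulrAC => h.
have : \det G ^+ 2 = 1 by apply: (mulIf dJ); rewrite mul1r expr2.
by move=> /(congr1 Num.sqrt); rewrite sqrtr_sqr sqrtr1.
Qed.

(** The action multiplies the frame matrix on the right by a matrix of determinant 1 or -1, so
    [omega] is invariant and only the function is transported. *)
Lemma density_pullback_density_of M F : O_Q1 M ->
  density_pullback (actSO M) (density_of F : predensity E d) = density_of (fun v => F (coord_act M v)).
Proof.
move=> OM; apply/funext => p; apply/funext => A.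
rewrite /density_pullback /density_of; under eq_fun do rewrite derive_actSO.
have vga q : vec (actSO M q) = coord_act M (vec q) by rewrite actSO_coord_act unvecK.
rewrite vga; congr ((_ * _)%:C).
have Xg : X (actSO M p) <-> X p.
  by split=> /X1E h; apply/X1E; move: h; rewrite vga (O_Q1_P OM).
have tg : tangent_frame X TX (actSO M p) (fun i => actSO M (A i)) <-> tangent_frame X TX p A.
  split=> -[Xp tA]; split; try exact/Xg; move=> i; apply/TX1E.
    by have /TX1E := tA i; rewrite !vga (coord_act_polar OM).
  by rewrite !vga (coord_act_polar OM); exact/TX1E.
have [tA|tA] := pselect (tangent_frame X TX p A); last first.
  by rewrite !omega_not_tangent //; move/tg.
rewrite !omega_tangent //; last exact/tg.
pose lM := GRing.isLinear.Build _ _ _ _ _ (coord_act_linear M).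
pose l : {linear 'rV[R]_N -> 'rV[R]_N} := HB.pack (coord_act M) lM.
pose G := lin1_mx l.
have gG v : coord_act M v = v *m G by rewrite mul_rV_lin1.
have dG : `|\det G| = 1 by apply: det_preserving => v w; rewrite -!gG (coord_act_polar OM).
have -> : vol (actSO M p) (fun i => actSO M (A i)) = `|\det (frame_mx p A *m G)|.
  rewrite /vol /frame_mx vga gG mul_col_mx; congr `|\det (col_mx _ _)|.
  by apply/row_matrixP => i; rewrite row_mul !rowK vga gG.
by rewrite det_mulmx normrM dG mulr1.
Qed.

Lemma actSO_compact M (K : set E) : O_Q1 M -> compact K -> K `<=` X ->
  exists K' : set E, [/\ compact K', K' `<=` X & forall p, ~ K' p -> ~ K (actSO M p)].
Proof.
move=> OM cK KX; exists (actSO (invmx M) @` K); split.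
- by apply: continuous_compact => //; apply: continuous_subspaceT; exact: actSO_continuous.
- move=> _ [p Kp <-]; apply/X1E; rewrite actSO_coord_act unvecK O_Q1_P; last exact: O_Q1_inv.
  by apply/X1E; exact: KX.
move=> p Kp Kg; apply: Kp; exists (actSO M p) => //.
by rewrite !actSO_coord_act unvecK -coord_act_mul mulVmx ?ga1 ?vecK //; case: OM.
Qed.

Lemma test_fun_coord_act M F : O_Q1 M -> test_fun F -> test_fun (fun v => F (coord_act M v)).
Proof.
move=> OM [sF [K [cK KX FK]]]; have oU := @open_regular R n; split.
  apply: (smooth_comp oU oU _ sF) => [v Uv|j]; last exact: coord_act_smooth.
  by rewrite /regular /= O_Q1_P.
have [K' [cK' KX' HK]] := actSO_compact OM cK KX; exists K'; split=> // p Xp Kp.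
have -> : coord_act M (vec p) = vec (actSO M p) by rewrite actSO_coord_act unvecK.
apply: FK; last exact: HK.
by apply/X1E; rewrite actSO_coord_act unvecK O_Q1_P //; exact/X1E.
Qed.

(** Replaces [F] by the extension constant on the fibres of the retraction: the values on [X] are
    kept, and the support becomes controlled on all of [regular]. *)
Lemma test_ext_retract F : test_fun F -> test_ext (fun v => F (retract v)).
Proof.
move=> [sF [K [cK KX FK]]]; have oU := @open_regular R n; split.
  apply: (smooth_comp oU oU _ sF) => [v Uv|j]; last exact: retract_smooth.
  by rewrite /regular /= quad_retract // oner_eq0.
exists K; split=> // v Uv Kv; rewrite -[retract v]unvecK; apply: FK => //.
by apply/X1E; rewrite unvecK quad_retract.
Qed.

Lemma actGL_SO (h : 'M[R]_n) p : actGL h p = actSO (block_mx h 0 0 (invmx h)^T) p.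
Proof.
by rewrite /actGL /actSO mul_block_col !mul0mx addr0 add0r col_mxKu col_mxKd.
Qed.

End Actions.

(** * Families obtained from smooth curves in the orthogonal group *)

Section Curves.
Variables (R : realType) (n : nat).

Local Notation E := (ambient R n).
Local Notation N := (1 + dimX1 n)%N.
Local Notation U := (@regular R n).
Local Notation r := (@rshift 1 n).
Local Notation z := (@lshift 1 n 0).

Lemma sum_act_idx (f : 'I_N -> R) :
  \sum_j f j = f (x_idx z) + f (y_idx z) + \sum_k f (rest_idx k).
Proof.
rewrite sum_idx !big_split_ord /= !big_ord1 /=.
have -> : \sum_(k < n) f (rest_idx (lshift n k)) = \sum_i f (x_idx (r i)).
  by apply: eq_bigr => i _; rewrite rest_idx_l.
have -> : \sum_(k < n) f (rest_idx (rshift n k)) = \sum_i f (y_idx (r i)).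
  by apply: eq_bigr => i _; rewrite rest_idx_r.
by ring.
Qed.

(** Derivative of [F] along the linear vector field given by [B] on the coordinates other than x_0
    and y_0. *)
Definition infinitesimal (B : 'M[R]_(n + n)) (F : 'rV[R]_N -> R) : 'rV[R]_N -> R :=
  fun v => \sum_k \sum_l B k l * (v 0 (rest_idx l) * partial (rest_idx k) F v).

Variables (e : R) (M M' : R -> 'M[R]_(n + n)) (B : 'M[R]_(n + n)).
Hypothesis e0 : 0 < e.
Hypothesis OM : forall s, `|s| < e -> O_Q1 (M s).
Hypothesis MM' : forall s, `|s| < e -> M' s *m M s = 1%:M.
Hypothesis M0 : M 0 = 1%:M.
Hypothesis sM : forall k l, smooth_on (slab e U)
  (fun w : 'rV[R]_(1 + N) => M (w 0 time_idx) k l).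
Hypothesis cM' : forall k l s, `|s| < e -> {for s, continuous (fun s => M' s k l)}.
Hypothesis dM : forall k l, is_derive (0 : R) (1 : R) (fun s => M s k l) (B k l).

Definition along (F : 'rV[R]_N -> R) (w : 'rV[R]_(1 + N)) : R :=
  F (coord_act (M (w 0 time_idx)) (rsubmx w)).

Lemma along_time_row F s v : along F (time_row s v) = F (coord_act (M s) v).
Proof. by rewrite /along time_row_time_idx rsubmx_time_row. Qed.

Lemma along_smooth F : smooth_on U F -> smooth_on (slab e U) (along F).
Proof.
move=> sF; have oU := @open_regular R n; have oS := open_slab (e := e) oU.
apply: (smooth_comp oS oU _ sF) => [w [we Uw]|j].
  by rewrite /regular /= O_Q1_P //; exact: OM.
have cf i : smooth_on (slab e U) (fun w : 'rV[R]_(1 + N) => (rsubmx w : 'rV[R]_N) 0 i).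
  rewrite (_ : (fun w => _) = fun w : 'rV[R]_(1 + N) => w 0 (rshift 1 i)).
    exact: smooth_coord.
  by apply/funext => w; rewrite mxE.
case: (act_idxP j) => [||k].
- rewrite (_ : (fun w => _) = fun w : 'rV[R]_(1 + N) => (rsubmx w : 'rV[R]_N) 0 (x_idx z)).
    exact: cf.
  by apply/funext => w; rewrite coord_act_xz.
- rewrite (_ : (fun w => _) = fun w : 'rV[R]_(1 + N) => (rsubmx w : 'rV[R]_N) 0 (y_idx z)).
    exact: cf.
  by apply/funext => w; rewrite coord_act_yz.
rewrite (_ : (fun w => _) = fun w : 'rV[R]_(1 + N) =>
    \sum_l M (w 0 time_idx) k l * (rsubmx w : 'rV[R]_N) 0 (rest_idx l)).
  by apply: smooth_sum => [|l]; [exact: oS | exact: (smooth_mul oS (sM k l) (cf (rest_idx l)))].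
by apply/funext => w; rewrite coord_act_rest_idx.
Qed.

Lemma along_continuous s p : `|s| < e ->
  {for (s, p), continuous (fun q : R * E => actSO (M' q.1) q.2)}.
Proof.
move=> se; pose g (q : R * E) : 'rV[R]_N := coord_act (M' q.1) (vec q.2).
rewrite (_ : (fun q => _) = (fun q => unvec (g q))); last first.
  by apply/funext => q; rewrite actSO_coord_act.
apply: (@continuous_comp _ _ _ g (@unvec R n)); last exact: unvec_continuous.
have cv i : {for (s, p), continuous (fun q : R * E => vec q.2 0 i)}.
  apply: (@continuous_comp _ _ _ snd (fun p : E => vec p 0 i)); first exact: cvg_snd.
  apply: (@continuous_comp _ _ _ (@vec R n) (fun v : 'rV[R]_N => v 0 i)).
    exact: vec_continuous.
  exact: coord_continuous.
apply: mx_continuous => i j; rewrite (ord1 i) /g; case: (act_idxP j) => [||k].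
- rewrite (_ : (fun q => _) = fun q : R * E => vec q.2 0 (x_idx z)); first exact: cv.
  by apply/funext => q; rewrite coord_act_xz.
- rewrite (_ : (fun q => _) = fun q : R * E => vec q.2 0 (y_idx z)); first exact: cv.
  by apply/funext => q; rewrite coord_act_yz.
rewrite (_ : (fun q => _) = fun q : R * E => \sum_l M' q.1 k l * vec q.2 0 (rest_idx l)); last first.
  by apply/funext => q; rewrite coord_act_rest_idx.
apply: continuous_sum => l; apply: continuousM; last exact: cv.
apply: (@continuous_comp _ _ _ fst (fun s => M' s k l)); first exact: cvg_fst.
exact: cM'.
Qed.

(** The support at time [s] is carried by the inverse [M' s] applied to [K]. The union over the
    closed interval |s| <= e / 2 is the continuous image of a compact product, which gives one
    compact set for the whole family. *)
Lemma along_family F : test_fun F -> exists K, smooth_family (e / 2) K (along F).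
Proof.
move=> [sF [K [cK KX FK]]]; have e2 : 0 < e / 2 by rewrite divr_gt0.
have eh : e / 2 < e by rewrite ltr_pdivrMr // ltr_pMr // ltr1n.
have small s : s \in `[- (e / 2), e / 2] -> `|s| < e.
  by rewrite in_itv /= -ler_norml => h; exact: le_lt_trans h eh.
exists ((fun q : R * E => actSO (M' q.1) q.2) @` (`[- (e / 2), e / 2] `*` K)); split=> //.
- apply: smooth_subset (along_smooth sF) => w [we Uw]; split=> //.
  exact: lt_trans we eh.
- apply: continuous_compact.
    apply: continuous_in_subspaceT => -[s p] /set_mem [/= /small se _].
    exact: along_continuous.
  by apply: compact_setX => //; exact: segment_compact.
- move=> _ [[s p] /= [/small se Kp] <-]; apply/X1E.
  have := (X1E p).1 (KX p Kp); rewrite actSO_coord_act unvecK => <-.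
  rewrite -[in RHS](ga1 (vec p)) -(mulmx1C (MM' se)) coord_act_mul.
  by rewrite (O_Q1_P (OM se)).
move=> s p se Xp; apply: contra_notP => H.
have se' : `|s| < e by exact: lt_trans se eh.
exists (s, actSO (M s) p); last first.
  by rewrite /= !actSO_coord_act unvecK -coord_act_mul MM' // ga1 vecK.
split=> /=; first by rewrite in_itv /= -ler_norml ltW.
apply: contrapT => nK; apply: H; rewrite along_time_row.
have -> : coord_act (M s) (vec p) = vec (actSO (M s) p) by rewrite actSO_coord_act unvecK.
apply: FK => //; apply/X1E; rewrite actSO_coord_act unvecK (O_Q1_P (OM se')).
exact/X1E.
Qed.

Lemma along_velocity F v : smooth_on U F -> U v ->
  partial time_idx (along F) (time_row 0 v) = infinitesimal B F v.
Proof.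
move=> sF Uv; rewrite /partial derive_line0.
have -> : (fun h : R => along F (h *: delta_mx 0 time_idx + time_row 0 v)) =
    fun h : R => F (coord_act (M h) v).
  by apply/funext => h; rewrite time_row_shift_time_idx addr0 along_time_row.
have v0 : coord_act (M 0) v = v by rewrite M0 ga1.
have dF : differentiable F (coord_act (M 0) v).
  by rewrite v0; exact: smooth_differentiable (@open_regular R n) sF Uv.
have dz k : is_derive (0 : R) (1 : R) (fun s => coord_act (M s) v 0 (rest_idx k))
    (\sum_l B k l * v 0 (rest_idx l)).
  rewrite (_ : (fun s => _) = \sum_l (fun s => M s k l * v 0 (rest_idx l))); last first.
    by apply/funext => s; rewrite fct_sumE coord_act_rest_idx.
  apply: is_derive_sum => l.
  have h := is_deriveM (dM k l) (is_derive_cst (v 0 (rest_idx l)) (0 : R) (1 : R)).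
  by apply: is_derive_eq h _; rewrite scaler0 add0r /GRing.scale /= mulrC.
have dx : is_derive (0 : R) (1 : R) (fun s => coord_act (M s) v 0 (x_idx z)) 0.
  rewrite (_ : (fun s => _) = cst (v 0 (x_idx z))); first exact: is_derive_cst.
  by apply/funext => s; rewrite coord_act_xz.
have dy : is_derive (0 : R) (1 : R) (fun s => coord_act (M s) v 0 (y_idx z)) 0.
  rewrite (_ : (fun s => _) = cst (v 0 (y_idx z))); first exact: is_derive_cst.
  by apply/funext => s; rewrite coord_act_yz.
have dj j : derivable (fun s => coord_act (M s) v 0 j) (0 : R) (1 : R).
  by case: (act_idxP j) => [||k]; [have [] := dx | have [] := dy | have [] := dz k].
have [_ h] := is_derive_chain (tau := fun s : R => coord_act (M s) v) (t := 0 : R) (v := 1 : R) dF dj.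
apply: etrans h _.
pose f j := partial j F (coord_act (M 0) v) * 'D_(1 : R) (fun s => coord_act (M s) v 0 j) (0 : R).
have fx : f (x_idx z) = 0.
  by have [_ h] := dx; exact: etrans (congr1 ( *%R _) h) (mulr0 _).
have fy : f (y_idx z) = 0.
  by have [_ h] := dy; exact: etrans (congr1 ( *%R _) h) (mulr0 _).
have fz k : f (rest_idx k) = \sum_l B k l * (v 0 (rest_idx l) * partial (rest_idx k) F v).
  have [_ h] := dz k; apply: etrans (congr1 ( *%R _) h) _; rewrite v0 mulr_sumr.
  by apply: eq_bigr => l _; ring.
apply: etrans (sum_act_idx f) _.
apply: etrans (congr2 +%R (congr2 +%R fx fy) (eq_bigr _ (fun k _ => fz k))) _.
by rewrite !add0r.
Qed.

End Curves.

(** * One-parameter subgroups *)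

Section OneParameter.
Variables (R : realType) (n : nat).

Local Notation N := (1 + dimX1 n)%N.
Local Notation U := (@regular R n).

Section Pencil.
Variables (b : bool) (e : R) (P Q : 'M[R]_(n + n)).

(* If [D *m D = b *: D] then [1 - recip b s *: D] is the inverse of [1 + s *: D];
   this covers the elementary matrices, diagonal or not. *)
Definition recip (s : R) : R := s / (1 + s * b%:R).

(** With [P] and [Q] the diagonal blocks D and - D^T, this is the action of h = 1 + s D, namely h on
    x' and the inverse transpose on y'. With [b = false] and [Q = 0] it is the unipotent curve 1 + s
    P. The bound [e <= 1 / 2] below keeps the denominator of [recip] positive. *)
Definition pencil (s : R) : 'M[R]_(n + n) := 1%:M + s *: P + recip s *: Q.
Definition pencil_inv (s : R) : 'M[R]_(n + n) := 1%:M - recip s *: P - s *: Q.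

Hypotheses (e0 : 0 < e) (e1 : e <= 1 / 2).
Hypothesis OP : forall s, `|s| < e -> O_Q1 (pencil s).
Hypothesis PK : forall s, `|s| < e -> pencil_inv s *m pencil s = 1%:M.

Lemma recip_den s : `|s| < e -> 1 + s * b%:R != 0.
Proof.
move=> se; have : `|s| < 1 / 2 by exact: lt_le_trans se e1.
rewrite ltr_norml => /andP[s1 s2]; rewrite gt_eqF //.
by case: b => /=; rewrite ?mulr1 ?mulr0; lra.
Qed.

Lemma recip_smooth : smooth_on (slab e U) (fun w : 'rV[R]_(1 + N) => recip (w 0 time_idx)).
Proof.
have oS := open_slab (e := e) (@open_regular R n).
have st := @smooth_coord _ _ (slab e U) (time_idx : 'I_(1 + N)).
have sb := smooth_mul oS st (@smooth_cst _ _ (slab e U) (b%:R : R)).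
have sd := smooth_add oS (@smooth_cst _ _ (slab e U) (1 : R)) sb.
apply: (smooth_mul oS st); apply: (smooth_inv oS _ sd) => w [we _].
exact: recip_den.
Qed.

Lemma pencil_entry s k l :
  pencil s k l = (1%:M : 'M[R]_(n + n)) k l + s * P k l + recip s * Q k l.
Proof. by rewrite !mxE. Qed.

Lemma pencil_inv_entry s k l :
  pencil_inv s k l = (1%:M : 'M[R]_(n + n)) k l - recip s * P k l - s * Q k l.
Proof. by rewrite !mxE. Qed.

Lemma pencil0 : pencil 0 = 1%:M.
Proof. by rewrite /pencil /recip mul0r !scale0r !addr0. Qed.

Lemma pencil_smooth k l : smooth_on (slab e U)
  (fun w : 'rV[R]_(1 + N) => pencil (w 0 time_idx) k l).
Proof.
have oS := open_slab (e := e) (@open_regular R n).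
have st := @smooth_coord _ _ (slab e U) (time_idx : 'I_(1 + N)).
under eq_fun do rewrite pencil_entry.
have s1 := smooth_mul oS st (@smooth_cst _ _ (slab e U) (P k l)).
have s2 := smooth_mul oS recip_smooth (@smooth_cst _ _ (slab e U) (Q k l)).
exact: (smooth_add oS (smooth_add oS (@smooth_cst _ _ (slab e U) _) s1) s2).
Qed.

Lemma recip_continuous s : `|s| < e -> {for s, continuous recip}.
Proof.
move=> se; apply: continuousM; first exact: cvg_id.
apply: continuousV; first exact: recip_den.
apply: continuousD; first exact: cst_continuous.
by apply: continuousM; [exact: cvg_id | exact: cst_continuous].
Qed.

Lemma pencil_inv_continuous k l s : `|s| < e ->
  {for s, continuous (fun s => pencil_inv s k l)}.
Proof.
move=> se.
rewrite (_ : (fun s => _) = fun s =>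
  (1%:M : 'M[R]_(n + n)) k l - recip s * P k l - s * Q k l); last first.
  by apply/funext => t; rewrite pencil_inv_entry.
apply: continuousB.
  apply: continuousB; first exact: cst_continuous.
  by apply: continuousM; [exact: recip_continuous | exact: cst_continuous].
by apply: continuousM; [exact: cvg_id | exact: cst_continuous].
Qed.

Lemma is_derive_recip : is_derive (0 : R) (1 : R) recip 1.
Proof.
have d0 : (1 + (0 : R) * b%:R) != 0 by rewrite mul0r addr0 oner_eq0.
have di := is_derive_id (0 : R) (1 : R).
have dd := is_deriveD (is_derive_cst (1 : R) (0 : R) (1 : R))
   (is_deriveM di (is_derive_cst (b%:R : R) (0 : R) (1 : R))).
have dv : derivable (fun s : R => (1 + s * b%:R)^-1) 0 1.
  by apply: derivableV => //; have [] := dd.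
have := is_deriveM di (derivableP dv).
move=> h; apply: (is_derive_eq h).
by rewrite scale0r add0r mul0r addr0 invr1 /GRing.scale /= mulr1.
Qed.

Lemma is_derive_pencil k l :
  is_derive (0 : R) (1 : R) (fun s => pencil s k l) ((P + Q) k l).
Proof.
rewrite (_ : (fun s => _) = fun s =>
  (1%:M : 'M[R]_(n + n)) k l + s * P k l + recip s * Q k l); last first.
  by apply/funext => t; rewrite pencil_entry.
have d1 := is_deriveM (is_derive_id (0 : R) (1 : R)) (is_derive_cst (P k l) (0 : R) (1 : R)).
have d2 := is_deriveM is_derive_recip (is_derive_cst (Q k l) (0 : R) (1 : R)).
have h := is_deriveD (is_deriveD (is_derive_cst ((1%:M : 'M[R]_(n + n)) k l) (0 : R) (1 : R)) d1) d2.
apply: (is_derive_eq h).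
by rewrite !scaler0 !add0r mxE /GRing.scale /= !mulr1.
Qed.

Lemma pencil_family F : test_fun F -> exists K, smooth_family (e / 2) K (along pencil F).
Proof. exact: (along_family e0 OP PK pencil_smooth pencil_inv_continuous). Qed.

Lemma pencil_velocity F v : smooth_on U F -> U v ->
  partial time_idx (along pencil F) (time_row 0 v) = infinitesimal (P + Q) F v.
Proof. exact: (along_velocity pencil0 is_derive_pencil). Qed.

End Pencil.

(** Turns the estimate of [lam_expand], once the velocity term is zero, into a vanishing
    derivative. *)
Lemma is_derive_quadratic (f : R -> R) (s C e : R) : 0 < e ->
  (forall h, `|h| <= e -> `|f (s + h) - f s| <= C * h ^+ 2) -> is_derive s (1 : R) f 0.
Proof.
move=> e0 fC.
have cv : (fun h : R => h^-1 *: ((f \o shift s) (h *: 1) - f s)) @ 0^' --> (0 : R).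
  apply/cvgrPdist_le => /= eps eps0.
  have C1 : 0 < `|C| + 1 by rewrite ltr_wpDl.
  near=> h.
  have h0 : h != 0 by near: h; exact: nbhs_dnbhs_neq.
  have he : `|h| <= e by near: h; exact: dnbhs0_le.
  have hr : `|h| <= eps / (`|C| + 1) by near: h; apply: dnbhs0_le; rewrite divr_gt0.
  rewrite sub0r normrN [h *: 1]mulr1 normrM normfV ler_pdivrMl ?normr_gt0 //.
  rewrite [h + s]addrC; apply: le_trans (fC h he) _.
  rewrite -[h ^+ 2]real_normK ?num_real // expr2 mulrA mulrC ler_wpM2l //.
  apply: le_trans (ler_wpM2r (normr_ge0 h) (ler_norm C)) _.
  apply: le_trans (ler_wpM2r (normr_ge0 h) (_ : `|C| <= `|C| + 1)) _; first by rewrite lerDl.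
  by rewrite mulrC -ler_pdivlMr.
apply: DeriveDef; last exact: cvg_lim cv.
by apply/cvg_ex; exists 0.
Unshelve. all: by end_near.
Qed.

Section Nilpotent.
Variables (Lam : ('rV[R]_N -> R) -> R) (P : 'M[R]_(n + n)).
Hypothesis aL : admissible Lam.
Hypothesis PP : P *m P = 0.
Hypothesis OP : forall s : R, O_Q1 (1%:M + s *: P).
Hypothesis lamP : forall F, test_ext F -> Lam (infinitesimal P F) = 0.

Let OPp s : O_Q1 (pencil false P 0 s).
Proof. by rewrite /pencil scaler0 addr0. Qed.

Lemma nilpotent_mul (s t : R) : (1%:M + s *: P) *m (1%:M + t *: P) = 1%:M + (s + t) *: P.
Proof.
rewrite mulmxDl mulmxDr !mul1mx mulmxDr mulmx1 -scalemxAl -scalemxAr PP !scaler0 addr0.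
by rewrite scalerDl -addrA; congr (_ + _); rewrite addrC.
Qed.

Let PKp (s : R) : pencil_inv false P 0 s *m pencil false P 0 s = 1%:M.
Proof.
rewrite /pencil /pencil_inv !scaler0 addr0 subr0 /recip mulr0 addr0 divr1 -scaleNr.
by rewrite nilpotent_mul addNr scale0r addr0.
Qed.

(** The group law moves the derivative at time [s] to time 0 for the translated function, where
    [lamP] makes it vanish. The function [f] therefore has derivative zero everywhere, and its
    values at 1 and 0 are compared. *)
Lemma lam_nilpotent F : test_fun F -> Lam (fun v => F (coord_act (1%:M + P) v)) = Lam F.
Proof.
move=> test_funF.
pose f s := Lam (fun v => F (coord_act (1%:M + s *: P) v)).
have h2 : (0 : R) < 1 / 2 by rewrite divr_gt0.
have df s : is_derive s (1 : R) f 0.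
  (* [G \o retract] agrees with [G] on [X] and has ambient support control. *)
  pose G v := F (coord_act (1%:M + s *: P) v).
  have SG : test_ext (fun v => G (retract v)) by apply: test_ext_retract; exact: test_fun_coord_act.
  have [K fK] := @pencil_family false _ P 0 h2 (lexx _) (fun t _ => OPp t) (fun t _ => PKp t)
    _ (test_ext_test_fun SG).
  have fE h : f (s + h) = Lam (fun v => along (pencil false P 0) (fun v => G (retract v)) (time_row h v)).
    apply: (lam_eq aL) => p Xp; rewrite along_time_row retract_id; last first.
      by rewrite (O_Q1_P (OPp h)); exact/X1E.
    by rewrite /G -coord_act_mul /pencil scaler0 addr0 nilpotent_mul.
  have V0 : Lam (fun v => partial time_idx (along (pencil false P 0) (fun v => G (retract v))) (time_row 0 v)) = 0.
    apply: etrans _ (lamP SG); apply: (lam_eq aL) => p Xp.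
    have V := pencil_velocity false P 0 SG.1 (X1_regular Xp).
    rewrite (addr0 P) in V.
    exact: V.
  have [C HC] := lam_expand aL fK.
  (* The pencil lives on |h| < 1/2; [pencil_family] halves this radius, and [lam_expand] halves it
     again. *)
  have e4 : (0 : R) < 1 / 2 / 2 / 2 by rewrite !divr_gt0.
  apply: (is_derive_quadratic (C := C) e4) => h he.
  have fs0 : f s = _ := etrans (congr1 f (esym (addr0 s))) (fE 0).
  have aux (a b c x y m : R) : x = a -> y = b -> c = 0 ->
      `|a - b - h * c| <= m -> `|x - y| <= m.
    by move=> -> -> ->; rewrite mulr0 subr0.
  exact: aux (fE h) fs0 V0 (HC h he).
have h := is_derive_0_is_cst 1 0 df.
have E1 : f 1 = Lam (fun v => F (coord_act (1%:M + P) v)) by rewrite /f scale1r.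
have E0 : f 0 = Lam F.
  by rewrite /f scale0r addr0; apply: (lam_eq aL) => p _; rewrite ga1.
by rewrite -E1 -E0.
Qed.

End Nilpotent.
End OneParameter.

(** * Pairings, antisymmetric matrices and elements of the orthogonal group *)

Section MatrixFacts.
Variables (R : realType).

Lemma continuous_prod (T : topologicalType) (I : Type) (s : seq I)
    (f : I -> T -> R) (x : T) :
  (forall i, {for x, continuous (f i)}) ->
  {for x, continuous (fun t => \prod_(i <- s) f i t)}.
Proof.
move=> cf; elim: s => [|i s IH].
  rewrite (_ : (fun t => _) = cst 1); first exact: cst_continuous.
  by apply/funext => t; rewrite big_nil.
rewrite (_ : (fun t => _) = (fun t => f i t * \prod_(j <- s) f j t)).
  exact: continuousM.
by apply/funext => t; rewrite big_cons.
Qed.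

Lemma continuous_det (T : topologicalType) (m : nat) (A : T -> 'M[R]_m) (x : T) :
  (forall i j, {for x, continuous (fun t => A t i j)}) ->
  {for x, continuous (fun t => \det (A t))}.
Proof.
move=> cA; rewrite /determinant; apply: continuous_sum => s.
apply: continuousM; first exact: cst_continuous.
exact: continuous_prod.
Qed.

Lemma dotvE (m : nat) (u w : 'cV[R]_m) : dotv u w = (u^T *m w) 0 0.
Proof. by rewrite mxE; apply: eq_bigr => i _; rewrite mxE. Qed.

Lemma dotvC (m : nat) (u w : 'cV[R]_m) : dotv u w = dotv w u.
Proof. by apply: eq_bigr => i _; rewrite mulrC. Qed.

Lemma dotvDl (m : nat) (u u' w : 'cV[R]_m) : dotv (u + u') w = dotv u w + dotv u' w.
Proof. by rewrite !dotvE linearD mulmxDl mxE. Qed.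

Lemma dotvDr (m : nat) (u w w' : 'cV[R]_m) : dotv u (w + w') = dotv u w + dotv u w'.
Proof. by rewrite !dotvE mulmxDr mxE. Qed.

Lemma dotvZl (m : nat) a (u w : 'cV[R]_m) : dotv (a *: u) w = a * dotv u w.
Proof. by rewrite !dotvE linearZ -scalemxAl mxE. Qed.

Lemma dotvZr (m : nat) a (u w : 'cV[R]_m) : dotv u (a *: w) = a * dotv u w.
Proof. by rewrite dotvC dotvZl dotvC. Qed.

Lemma dotv_mul (m : nat) (B : 'M[R]_m) (u w : 'cV[R]_m) : dotv (B *m u) w = dotv u (B^T *m w).
Proof. by rewrite !dotvE trmx_mul mulmxA. Qed.

Lemma dotv_delta (m : nat) (B : 'M[R]_m) i j :
  dotv (delta_mx i 0) (B *m delta_mx j 0) = B i j.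
Proof. by rewrite dotvE trmx_delta mulmxA -rowE -colE !mxE. Qed.

Lemma antisymP (m : nat) (B : 'M[R]_m) :
  B^T = - B <-> forall u : 'cV[R]_m, dotv u (B *m u) = 0.
Proof.
split=> [aB u|H].
  have : dotv u (B *m u) = - dotv u (B *m u).
    rewrite -[in RHS]mulN1r -dotvZr scaleN1r -mulNmx -aB -dotv_mul.
    exact: dotvC.
  by move/eqP; rewrite -addr_eq0 -mulr2n mulrn_eq0 /= => /eqP.
apply/matrixP => i j; rewrite !mxE; apply/eqP; rewrite -addr_eq0; apply/eqP.
have := H (delta_mx i 0 + delta_mx j 0).
rewrite mulmxDr !dotvDl !dotvDr !H !dotv_delta add0r addr0 => <-.
by rewrite addrC.
Qed.

Lemma scalar_block (n : nat) : (1%:M : 'M[R]_(n + n)) = block_mx 1%:M 0 0 1%:M.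
Proof. exact: scalar_mx_block. Qed.

Lemma block_delta_ul (n : nat) (i j : 'I_n) :
  block_mx (delta_mx i j) 0 0 0 = delta_mx (lshift n i) (lshift n j) :> 'M[R]_(n + n).
Proof.
apply/matrixP => k l; case: (split_ordP k) => k' ->; case: (split_ordP l) => l' ->;
  rewrite ?block_mxEul ?block_mxEur ?block_mxEdl ?block_mxEdr !mxE
    ?(inj_eq (@lshift_inj _ _)) ?eq_lrshift ?eq_rlshift ?andbF //.
Qed.

Lemma block_delta_dr (n : nat) (i j : 'I_n) :
  block_mx 0 0 0 (delta_mx i j) = delta_mx (rshift n i) (rshift n j) :> 'M[R]_(n + n).
Proof.
apply/matrixP => k l; case: (split_ordP k) => k' ->; case: (split_ordP l) => l' ->;
  rewrite ?block_mxEul ?block_mxEur ?block_mxEdl ?block_mxEdr !mxE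
    ?(inj_eq (@rshift_inj _ _)) ?eq_lrshift ?eq_rlshift ?andbF //.
Qed.

Lemma Q1_col (n : nat) (u w : 'cV[R]_n) : Q1 (col_mx u w) = dotv u w.
Proof. by rewrite /Q1 col_mxKu col_mxKd. Qed.

Lemma O_Q1_levi (n : nat) (h : 'M[R]_n) : h \in unitmx ->
  O_Q1 (block_mx h 0 0 (invmx h)^T).
Proof.
move=> uh; split.
  by rewrite unitmxE det_ublock unitrM -!unitmxE unitmx_tr unitmx_inv uh.
move=> z; rewrite -[z]vsubmxK mul_block_col !mul0mx addr0 add0r !Q1_col.
by rewrite dotv_mul mulmxA -trmx_mul mulVmx // trmx1 mul1mx.
Qed.

Lemma O_Q1_upper (n : nat) (B : 'M[R]_n) (s : R) : B^T = - B ->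
  O_Q1 (1%:M + s *: block_mx 0 B 0 0).
Proof.
move=> aB; have PP : block_mx 0 B 0 0 *m block_mx 0 B 0 0 = 0 :> 'M[R]_(n + n).
  by rewrite mulmx_block !(mul0mx, mulmx0, addr0) block_mx0.
split.
  have := nilpotent_mul PP s (- s); rewrite addrN scale0r addr0.
  by move/mulmx1_unit => [].
move=> z; rewrite -[z]vsubmxK mulmxDl mul1mx -scalemxAl mul_block_col.
rewrite !mul0mx addr0 add0r scale_col_mx add_col_mx !Q1_col scaler0 addr0.
by rewrite dotvDl dotvZl dotvC [dotv (_ *m _) _]dotvC (antisymP B).1 // mulr0 addr0 dotvC.
Qed.

Lemma O_Q1_lower (n : nat) (B : 'M[R]_n) (s : R) : B^T = - B ->
  O_Q1 (1%:M + s *: block_mx 0 0 B 0).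
Proof.
move=> aB; have PP : block_mx 0 0 B 0 *m block_mx 0 0 B 0 = 0 :> 'M[R]_(n + n).
  by rewrite mulmx_block !(mul0mx, mulmx0, addr0, add0r) block_mx0.
split.
  have := nilpotent_mul PP s (- s); rewrite addrN scale0r addr0.
  by move/mulmx1_unit => [].
move=> z; rewrite -[z]vsubmxK mulmxDl mul1mx -scalemxAl mul_block_col.
rewrite !mul0mx !addr0 scale_col_mx add_col_mx !Q1_col scaler0 addr0.
by rewrite dotvDr dotvZr (antisymP B).1 // mulr0 addr0.
Qed.

End MatrixFacts.

(** * From invariance under GL^+ to the vector fields E_ij *)

Section LieAlgebra.
Variables (R : realType) (n : nat).

Local Notation E := (ambient R n).
Local Notation N := (1 + dimX1 n)%N.
Local Notation r := (@rshift 1 n).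
Local Notation fld := (rotation (@swap n) (@coordinate R n) (@partial R N R)).

Variable (Lam : ('rV[R]_N -> R) -> R).
Hypothesis aL : admissible Lam.
Hypothesis lam_levi : forall (h : 'M[R]_n), 0 < \det h -> forall F, test_fun F ->
  Lam (fun v => F (coord_act (block_mx h 0 0 (invmx h)^T) v)) = Lam F.

Lemma infinitesimal_delta a b F v :
  infinitesimal (delta_mx a b : 'M[R]_(n + n)) F v = v 0 (rest_idx b) * partial (rest_idx a) F v.
Proof.
rewrite /infinitesimal (bigD1 a) //= (bigD1 b) //= mxE !eqxx mul1r.
rewrite big1 => [|l lb]; last by rewrite mxE (negbTE lb) andbF mul0r.
rewrite big1 ?addr0 // => k ka; rewrite big1 // => l _.
by rewrite mxE (negbTE ka) mul0r.
Qed.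

Lemma infinitesimalB (A B : 'M[R]_(n + n)) F v :
  infinitesimal (A - B) F v = infinitesimal A F v - infinitesimal B F v.
Proof.
rewrite /infinitesimal -sumrB; apply: eq_bigr => k _; rewrite -sumrB.
by apply: eq_bigr => l _; rewrite !mxE; ring.
Qed.

Lemma elementary_inv (b : bool) (D : 'M[R]_n) s : 1 + s * b%:R != 0 -> D *m D = b%:R *: D ->
  (1%:M + s *: D) *m (1%:M - recip b s *: D) = 1%:M /\
  (1%:M - recip b s *: D) *m (1%:M + s *: D) = 1%:M.
Proof.
move=> sb DD.
have E : (1%:M + s *: D) *m (1%:M - recip b s *: D) = 1%:M.
  rewrite mulmxDl mul1mx -scalemxAl mulmxBr mulmx1 -scalemxAr DD.
  have -> : 1%:M - recip b s *: D + s *: (D - recip b s *: (b%:R *: D)) =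
      1%:M + (s - recip b s * (1 + s * b%:R)) *: D.
    by apply/matrixP => i j; rewrite !mxE; ring.
  by rewrite /recip divfK // subrr scale0r addr0.
by split=> //; exact: mulmx1C.
Qed.

(** Invariance is available only for positive determinant; by continuity a short interval around s =
    0 stays inside GL^+. *)
Lemma elementary_det (D : 'M[R]_n) : exists2 e : R, 0 < e <= 1 / 2 &
  forall s, `|s| < e -> 0 < \det (1%:M + s *: D).
Proof.
have cd : {for 0, continuous (fun s : R => \det (1%:M + s *: D))}.
  apply: continuous_det => i j.
  rewrite (_ : (fun t => _) = fun s : R => (1%:M : 'M[R]_n) i j + s * D i j).
    apply: continuousD; first exact: cst_continuous.
    by apply: continuousM; [exact: cvg_id | exact: cst_continuous].
  by apply/funext => s; rewrite !mxE.
have : \forall s \near (0 : R), 0 < \det (1%:M + s *: D).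
  apply: (cvgr_gt _ cd); by rewrite scale0r addr0 det1 ltr01.
move=> /nbhs_ballP [e1 e10 H]; exists (Num.min e1 (1 / 2)).
  by rewrite lt_min e10 ge_min lexx orbT divr_gt0.
move=> s; rewrite lt_min => /andP[s1 _]; apply: H.
by rewrite -ball_normE /= sub0r normrN.
Qed.

(** The field E_ij is the velocity at 0 of an explicit curve in GL^+, along which the functional is
    constant, so [lam_velocity] applies. *)
Lemma lam_rotation i j F : test_ext F -> Lam (fld (x_idx (r i)) (y_idx (r j)) F) = 0.
Proof.
(* The curve 1 + s D adds s x_i to x_j, whence the transposed indices; [D] squares to itself when
   [i = j] and to zero otherwise, which [b] records. *)
move=> test_extF; pose D : 'M[R]_n := delta_mx j i; pose b := i == j.
pose P : 'M[R]_(n + n) := block_mx D 0 0 0.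
pose Q : 'M[R]_(n + n) := block_mx 0 0 0 (- D^T).
have DD : D *m D = b%:R *: D.
  rewrite /D mul_delta_mx_cond /b; case: eqP => [->|_]; first by rewrite mulr1n scale1r.
  by rewrite mulr0n scale0r.
have trD c : (1%:M + c *: D)^T = 1%:M + c *: D^T.
  by apply/matrixP => k l; rewrite !mxE eq_sym.
have trB c : (1%:M - c *: D)^T = 1%:M - c *: D^T.
  by apply/matrixP => k l; rewrite !mxE eq_sym.
have [e /andP[e0 e1] He] := elementary_det D.
have PE s : pencil b P Q s = block_mx (1%:M + s *: D) 0 0 (1%:M - recip b s *: D)^T.
  rewrite /pencil scalar_block !scale_block_mx !add_block_mx !scaler0 !addr0.
  by rewrite scalerN trB.
have IE s : pencil_inv b P Q s = block_mx (1%:M - recip b s *: D) 0 0 (1%:M + s *: D)^T.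
  rewrite /pencil_inv scalar_block !scale_block_mx !opp_block_mx !add_block_mx.
  by rewrite !scaler0 !oppr0 !addr0 scalerN opprK trD.
have inv s : `|s| < e -> invmx (1%:M + s *: D) = 1%:M - recip b s *: D.
  move=> se; have [E1 E2] := elementary_inv (recip_den b e1 se) DD.
  have [us _] := mulmx1_unit E1.
  by rewrite -[RHS](mulKmx us) E1 mulmx1.
have OP s : `|s| < e -> O_Q1 (pencil b P Q s).
  move=> se; rewrite PE -inv //; apply: O_Q1_levi.
  by rewrite unitmxE unitfE gt_eqF // He.
have PK s : `|s| < e -> pencil_inv b P Q s *m pencil b P Q s = 1%:M.
  move=> se; have [E1 E2] := elementary_inv (recip_den b e1 se) DD.
  rewrite PE IE mulmx_block !(mul0mx, mulmx0, addr0, add0r) E2 -trmx_mul E2 trmx1.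
  by rewrite scalar_block.
have [K fK] := pencil_family e0 e1 OP PK (test_ext_test_fun test_extF).
have e2 : 0 < e / 2 by rewrite divr_gt0.
have eh : e / 2 < e by rewrite ltr_pdivrMr // ltr_pMr // ltr1n.
have L s : `|s| < e / 2 -> Lam (fun v => along (pencil b P Q) F (time_row s v)) = Lam F.
  move=> se; have se' : `|s| < e by exact: lt_trans se eh.
  apply: etrans (lam_levi (He s se') (test_ext_test_fun test_extF)); apply: (lam_eq aL) => p _.
  by rewrite along_time_row PE (inv _ se').
have L0 := lam_velocity aL fK (fun s se => etrans (L s se)
  (esym (L 0 (eq_ind_r (fun t => t < e / 2) e2 (normr0 R))))).
apply: etrans _ L0; apply: (lam_eq aL) => p Xp.
apply: etrans _ (esym (pencil_velocity b P Q test_extF.1 (X1_regular Xp))).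
have -> : P + Q = delta_mx (lshift n j) (lshift n i) - delta_mx (rshift n i) (rshift n j).
  by rewrite -block_delta_ul -block_delta_dr /P /Q /D trmx_delta opp_block_mx !oppr0.
rewrite infinitesimalB !infinitesimal_delta !rest_idx_l !rest_idx_r /rotation /coordinate.
by rewrite swap_x_idx swap_y_idx.
Qed.

End LieAlgebra.

(** * Fields of antisymmetric matrices *)

Section Stabilizer.
Variables (R : realType) (n : nat).

Local Notation N := (1 + dimX1 n)%N.
Local Notation X := (@X1 R n).
Local Notation U := (@regular R n).
Local Notation r := (@rshift 1 n).
Local Notation fld := (rotation (@swap n) (@coordinate R n) (@partial R N R)).

Variable (Lam : ('rV[R]_N -> R) -> R).
Hypothesis aL : admissible Lam.

Lemma test_ext_rotation a b F : test_ext F -> test_ext (fld a b F).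
Proof.
exact: (S_rotation _ (@test_ext_coordM R n) (@test_ext_partial R n) (@test_ext_lin R n)).
Qed.

Lemma SF0 : @test_ext R n (fun=> 0).
Proof.
split; first exact: (@smooth_cst _ _ U 0).
by exists set0; split=> //; exact: compact0.
Qed.

Lemma lam_ext F G : (forall v, U v -> F v = G v) -> Lam F = Lam G.
Proof. by move=> FG; apply: (lam_eq aL) => p Xp; apply: FG; exact: X1_regular. Qed.

Lemma lam_lin_test_ext (a : R) F G : test_ext F -> test_ext G ->
  Lam (fun v => a * F v + G v) = a * Lam F + Lam G.
Proof. by move=> /test_ext_test_fun wF /test_ext_test_fun wG; exact: (lam_lin aL). Qed.

Lemma lam0 : Lam (fun=> 0) = 0.
Proof.
have h := lam_lin_test_ext (-1) SF0 SF0.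
have : Lam (fun=> 0) = -1 * Lam (fun=> 0) + Lam (fun=> 0).
  by apply: etrans h; apply: lam_ext => v _; rewrite mulr0 addr0.
by rewrite mulN1r addNr.
Qed.

Lemma lam_sum0 (I : Type) (s : seq I) (c : I -> R) (g : I -> 'rV[R]_N -> R) :
  (forall i, test_ext (g i)) -> (forall i, c i * Lam (g i) = 0) ->
  test_ext (fun v => \sum_(i <- s) c i * g i v) /\ Lam (fun v => \sum_(i <- s) c i * g i v) = 0.
Proof.
move=> Sg Lg; elim: s => [|i s [IHS IHL]].
  have E0 : (fun v => \sum_(i <- [::]) c i * g i v) = (fun=> 0 : R).
    by apply/funext => v; rewrite big_nil.
  by split; rewrite E0; [exact: SF0 | exact: lam0].
have E0 : (fun v => \sum_(j <- i :: s) c j * g j v) =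
    (fun v => c i * g i v + \sum_(j <- s) c j * g j v).
  by apply/funext => v; rewrite big_cons.
split; rewrite E0; first exact: test_ext_lin.
by apply: etrans (lam_lin_test_ext (c i) (Sg i) IHS) _; rewrite IHL Lg addr0.
Qed.

(** Antisymmetry of [B] rewrites its field as half the sum of B_kl times the bivector fields for [k]
    and [l]; each off-diagonal one is killed by hypothesis, and the diagonal of [B] is zero. *)
Lemma lam_antisym (x y : 'I_(1 + n) -> 'I_N) (B : 'M[R]_n) F :
  (forall i, swap (y i) = x i) ->
  (forall (i1 i2 : 'I_n) F, i1 != i2 -> test_ext F -> Lam (fld (y (r i2)) (y (r i1)) F) = 0) ->
  B^T = - B -> test_ext F ->
  Lam (fun v => \sum_k \sum_l B k l * (v 0 (y (r l)) * partial (x (r k)) F v)) = 0.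
Proof.
move=> ky biv aB test_extF.
have aBe k l : B l k = - B k l by have /matrixP /(_ k l) := aB; rewrite !mxE.
have Sg (kl : 'I_n * 'I_n) : test_ext (fld (y (r kl.2)) (y (r kl.1)) F) by exact: test_ext_rotation.
have Lg (kl : 'I_n * 'I_n) : B kl.1 kl.2 / 2 * Lam (fld (y (r kl.2)) (y (r kl.1)) F) = 0.
  case: kl => k l /=; have [<-|kl] := eqVneq k l; last by rewrite biv // mulr0.
  suff -> : B k k = 0 by rewrite mul0r mul0r.
  by have /eqP := aBe k k; rewrite -addr_eq0 -mulr2n mulrn_eq0 /= => /eqP.
have [_ h] := lam_sum0 (index_enum _) Sg Lg.
apply: etrans _ h; apply: lam_ext => v Uv.
pose t k l := v 0 (y (r l)) * partial (x (r k)) F v.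
have fE k l : fld (y (r l)) (y (r k)) F v = t k l - t l k by rewrite /rotation !ky.
have sE : \sum_k \sum_l B k l * t l k = - \sum_k \sum_l B k l * t k l.
  rewrite exchange_big -sumrN; apply: eq_bigr => k _; rewrite -sumrN.
  by apply: eq_bigr => l _; rewrite aBe mulNr.
apply: etrans (pair_bigA _ (fun k l => B k l / 2 * fld (y (r l)) (y (r k)) F v)).
have half (c : R) : c = (c - - c) / 2 by lra.
transitivity ((\sum_k \sum_l B k l * t k l - \sum_k \sum_l B k l * t l k) / 2).
  by rewrite sE; exact: half.
rewrite -sumrB mulr_suml; apply: eq_bigr => k _; rewrite -sumrB mulr_suml.
by apply: eq_bigr => l _; rewrite fE; ring.
Qed.

End Stabilizer.

(** * The stabilizer *)

Section BigCell.
Variables (R : realType) (n : nat).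

Local Notation N := (1 + dimX1 n)%N.
Local Notation X := (@X1 R n).
Local Notation U := (@regular R n).
Local Notation r := (@rshift 1 n).

Variable (Lam : ('rV[R]_N -> R) -> R).
Hypothesis aL : admissible Lam.
Hypothesis n3 : (3 <= n)%N.
Hypothesis lam_levi : forall (h : 'M[R]_n), 0 < \det h -> forall F, test_fun F ->
  Lam (fun v => F (coord_act (block_mx h 0 0 (invmx h)^T) v)) = Lam F.

Definition stab (M : 'M[R]_(n + n)) : Prop :=
  O_Q1 M /\ forall F, test_fun F -> Lam (fun v => F (coord_act M v)) = Lam F.

Lemma stab_mul M M' : stab M -> stab M' -> stab (M *m M').
Proof.
move=> [OM sM] [OM' sM']; split; first exact: O_Q1_mul.
move=> F test_funF; apply: etrans (sM _ test_funF); apply: etrans _ (sM' _ (test_fun_coord_act OM test_funF)).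
by apply: (lam_eq aL) => p _; rewrite coord_act_mul.
Qed.

Lemma stab_inv M : stab M -> stab (invmx M).
Proof.
move=> [OM sM]; have OI := O_Q1_inv OM; split=> // F test_funF.
apply: etrans (esym (sM _ (test_fun_coord_act OI test_funF))) _; apply: (lam_eq aL) => p _.
by rewrite -coord_act_mul mulVmx ?ga1 //; case: OM.
Qed.

(** Strips a known left factor; the Gauss decomposition is carried out one factor at a time with
    it. *)
Lemma stab_cancel M M' : O_Q1 M' -> stab M -> stab (M *m M') -> stab M'.
Proof.
move=> OM' sM sMM'; have [[uM _] _] := sM.
by rewrite -[M'](mulKmx uM); exact: stab_mul (stab_inv sM) sMM'.
Qed.

Lemma sum_blocks (f : 'I_(n + n) -> 'I_(n + n) -> R) :
  \sum_k \sum_l f k l =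
  \sum_k (\sum_l f (lshift n k) (lshift n l) + \sum_l f (lshift n k) (rshift n l)) +
  \sum_k (\sum_l f (rshift n k) (lshift n l) + \sum_l f (rshift n k) (rshift n l)).
Proof.
by rewrite big_split_ord /=; congr (_ + _); apply: eq_bigr => k _; rewrite big_split_ord.
Qed.

Lemma infinitesimal_blocks (P : 'M[R]_(n + n)) F v :
  infinitesimal P F v =
  \sum_k (\sum_l P (lshift n k) (lshift n l) * (v 0 (x_idx (r l)) * partial (x_idx (r k)) F v) +
          \sum_l P (lshift n k) (rshift n l) * (v 0 (y_idx (r l)) * partial (x_idx (r k)) F v)) +
  \sum_k (\sum_l P (rshift n k) (lshift n l) * (v 0 (x_idx (r l)) * partial (y_idx (r k)) F v) +
          \sum_l P (rshift n k) (rshift n l) * (v 0 (y_idx (r l)) * partial (y_idx (r k)) F v)).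
Proof.
pose f k l := P k l * (v 0 (rest_idx l) * partial (rest_idx k) F v).
apply: etrans (sum_blocks f) _.
apply: congr2; apply: eq_bigr => k _; apply: congr2; apply: eq_bigr => l _.
- by rewrite /f (rest_idx_l k) (rest_idx_l l).
- by rewrite /f (rest_idx_l k) (rest_idx_r l).
- by rewrite /f (rest_idx_r k) (rest_idx_l l).
- by rewrite /f (rest_idx_r k) (rest_idx_r l).
Qed.

Lemma sum_x_idx_neq0 (v : 'rV[R]_N) : U v -> \sum_i v 0 (x_idx i) ^+ 2 != 0.
Proof.
move=> Uv; apply/eqP => s0; case/negP: Uv; apply/eqP; apply: big1 => i _.
have /psumr_eq0P h : forall i, true -> 0 <= v 0 (x_idx i) ^+ 2 by move=> j _; exact: sqr_ge0.
by have /eqP := h s0 i isT; rewrite sqrf_eq0 => /eqP ->; rewrite mul0r.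
Qed.

Lemma sum_y_idx_neq0 (v : 'rV[R]_N) : U v -> \sum_i v 0 (y_idx i) ^+ 2 != 0.
Proof.
move=> Uv; apply/eqP => s0; case/negP: Uv; apply/eqP; apply: big1 => i _.
have /psumr_eq0P h : forall i, true -> 0 <= v 0 (y_idx i) ^+ 2 by move=> j _; exact: sqr_ge0.
by have /eqP := h s0 i isT; rewrite sqrf_eq0 => /eqP ->; rewrite mulr0.
Qed.

Lemma stab_upper (B : 'M[R]_n) : B^T = - B -> stab (1%:M + block_mx 0 B 0 0).
Proof.
move=> aB; have OP s := O_Q1_upper s aB.
split; first by have := OP 1; rewrite scale1r.
have PP : block_mx 0 B 0 0 *m block_mx 0 B 0 0 = 0 :> 'M[R]_(n + n).
  by rewrite mulmx_block !(mul0mx, mulmx0, addr0) block_mx0.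
move=> F test_funF; apply: (lam_nilpotent aL PP OP) => // G SG.
have biv := lam_bivector aL (@swap_x_idx n) (@swap_y_idx n) (@x_idx_inj n) (@y_idx_inj n)
  (@x_idx_neq_y_idx n) sum_x_idx_neq0 (fun i j F tF => lam_rotation aL lam_levi i j tF) n3.
apply: etrans _ (lam_antisym aL (@swap_y_idx n) biv aB SG); apply: (lam_eq aL) => p _.
rewrite infinitesimal_blocks [X in _ + X]big1 ?addr0 => [|k _].
  apply: eq_bigr => k _; rewrite [X in X + _]big1 ?add0r => [|l _].
    by apply: eq_bigr => l _; rewrite block_mxEur.
  by rewrite block_mxEul mxE mul0r.
rewrite !big1 ?addr0 // => l _; first by rewrite block_mxEdr mxE mul0r.
by rewrite block_mxEdl mxE mul0r.
Qed.

(** The argument of [stab_upper] with the roles of x and y exchanged. *)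
Lemma stab_lower (B : 'M[R]_n) : B^T = - B -> stab (1%:M + block_mx 0 0 B 0).
Proof.
move=> aB; have OP s := O_Q1_lower s aB.
split; first by have := OP 1; rewrite scale1r.
have PP : block_mx 0 0 B 0 *m block_mx 0 0 B 0 = 0 :> 'M[R]_(n + n).
  by rewrite mulmx_block !(mul0mx, mulmx0, addr0, add0r) block_mx0.
move=> F test_funF; apply: (lam_nilpotent aL PP OP) => // G SG.
(* [rotation] is antisymmetric in its two indices, so this is the negative of a field already
   killed. *)
have inv i j F' : test_ext F' ->
    Lam (rotation (@swap n) (@coordinate R n) (@partial R N R) (y_idx (r i)) (x_idx (r j)) F') = 0.
  move=> tF'; have SE := test_ext_rotation (x_idx (r j)) (y_idx (r i)) tF'.
  have h := lam_lin_test_ext aL (-1) SE (SF0 R n).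
  rewrite (lam_rotation aL lam_levi j i tF') mulr0 add0r (lam0 aL) in h.
  apply: etrans _ h; apply: (lam_eq aL) => p _; rewrite /rotation.
  by rewrite mulN1r addr0 opprB.
have biv := lam_bivector aL (@swap_y_idx n) (@swap_x_idx n) (@y_idx_inj n) (@x_idx_inj n)
  (@y_idx_neq_x_idx n) sum_y_idx_neq0 inv n3.
apply: etrans _ (lam_antisym aL (@swap_x_idx n) biv aB SG); apply: (lam_eq aL) => p _.
rewrite infinitesimal_blocks [X in X + _]big1 ?add0r => [|k _].
  apply: eq_bigr => k _; rewrite [X in _ + X]big1 ?addr0 => [|l _].
    by apply: eq_bigr => l _; rewrite block_mxEdl.
  by rewrite block_mxEdr mxE mul0r.
rewrite !big1 ?addr0 // => l _; first by rewrite block_mxEur mxE mul0r.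
by rewrite block_mxEul mxE mul0r.
Qed.

Lemma O_Q1_dotv (a b c e : 'M[R]_n) : O_Q1 (block_mx a b c e) ->
  forall u w, dotv (a *m u + b *m w) (c *m u + e *m w) = dotv u w.
Proof. by move=> [_ H] u w; have := H (col_mx u w); rewrite mul_block_col !Q1_col. Qed.

(* Gauss decomposition of [M] with respect to the two Lagrangian subspaces
   [y' = 0] and [x' = 0]. *)
Lemma stab_big_cell (M : 'M[R]_(n + n)) : O_Q1 M -> 0 < \det (drsubmx M) -> stab M.
Proof.
rewrite -[M]submxK block_mxKdr.
set a := ulsubmx M; set b := ursubmx M; set c := dlsubmx M; set e := drsubmx M.
move=> OM de; have ue : e \in unitmx by rewrite unitmxE unitfE gt_eqF.
pose B := b *m invmx e.
have aB : B^T = - B.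
  (* The image of (0, e^-1 w) is (B w, w), and Q_1 vanishes on (0, e^-1 w). *)
  apply/antisymP => w; have := O_Q1_dotv OM 0 (invmx e *m w).
  rewrite !mulmx0 !add0r mulKVmx // mulmxA -/B => h.
  rewrite dotvC h dotvE trmx0 mul0mx mxE //.
have aNB : (- B)^T = - - B by rewrite linearN /= aB.
apply: (stab_cancel OM (stab_upper aNB)).
have E1 : (1%:M + block_mx 0 (- B) 0 0) *m block_mx a b c e = block_mx (a - B *m c) 0 c e.
  rewrite mulmxDl mul1mx mulmx_block !mul0mx !add0r !mulNmx add_block_mx !addr0.
  by rewrite /B mulmxKV // subrr.
have O1 : O_Q1 (block_mx (a - B *m c) 0 c e).
  by rewrite -E1; apply: O_Q1_mul => //; case: (stab_upper aNB).
rewrite E1; set h := a - B *m c in O1 *.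
have D1 := O_Q1_dotv O1.
have hc u : dotv (h *m u) (c *m u) = 0.
  by have := D1 u 0; rewrite !mulmx0 !addr0 => ->; rewrite dotvE mulmx0 mxE.
have he : h^T *m e = 1%:M.
  apply/matrixP => i j; have := D1 (delta_mx i 0) (delta_mx j 0).
  rewrite mul0mx addr0 dotvDr.
  have -> : dotv (h *m delta_mx i 0) (c *m delta_mx i 0) = 0 by exact: hc.
  rewrite add0r dotv_mul mulmxA dotv_delta => ->.
  by rewrite -[delta_mx j 0]mul1mx dotv_delta.
have uh : h \in unitmx by have [] := mulmx1_unit he; rewrite unitmx_tr.
have Ee : e = (invmx h)^T by rewrite trmx_inv -[RHS]mulmx1 -he mulKmx // unitmx_tr.
(* Since det h and det e are inverse to each other, the hypothesis on the lower right block puts the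
   remaining diagonal factor in GL^+. *)
have dh : 0 < \det h.
  have := congr1 determinant he; rewrite det_mulmx det_tr det1 => h1.
  by rewrite -(pmulr_lgt0 _ de) h1 ltr01.
pose C := c *m invmx h.
have aC : C^T = - C.
  by apply/antisymP => w; have := hc (invmx h *m w); rewrite mulKVmx // mulmxA.
have aNC : (- C)^T = - - C by rewrite linearN /= aC.
apply: (stab_cancel O1 (stab_lower aNC)).
have E2 : (1%:M + block_mx 0 0 (- C) 0) *m block_mx h 0 c e = block_mx h 0 0 (invmx h)^T.
  rewrite mulmxDl mul1mx mulmx_block !mul0mx !mulmx0 !addr0 !mulNmx add_block_mx !addr0.
  by rewrite /C mulmxKV // subrr -Ee.
rewrite E2; split; first exact: O_Q1_levi.
exact: lam_levi.
Qed.

(** Left translates of the big cell; the translate by [g] corresponds to [K = invmx g] and contains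
    [g]. *)
Lemma open_cell (K : 'M[R]_(n + n)) : open [set M : 'M[R]_(n + n) | 0 < \det (drsubmx (K *m M))].
Proof.
have cd (M : 'M[R]_(n + n)) :
    {for M, continuous (fun M : 'M[R]_(n + n) => \det (drsubmx (K *m M)))}.
  apply: continuous_det => i j.
  rewrite (_ : (fun M => _) = fun M : 'M[R]_(n + n) =>
    \sum_k K (rshift n i) k * M k (rshift n j)).
    apply: continuous_sum => k; apply: continuousM; first exact: cst_continuous.
    exact: coord_continuous.
  by apply/funext => M'; rewrite !mxE.
have := @open_comp _ _ (fun M : 'M[R]_(n + n) => \det (drsubmx (K *m M))) [set x | 0 < x]
  (fun M _ => cd M) (@open_gt _ _).
by [].
Qed.

(* An open subgroup is closed, so it contains the connected component of 1. *)
Lemma stab_SO0 M : SO0_Q1 M -> stab M.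
Proof.
have cell1 : 0 < \det (drsubmx (1%:M : 'M[R]_(n + n))).
  by rewrite scalar_block block_mxKdr det1 ltr01.
have stab1 : stab 1%:M by apply: stab_big_cell => //; exact: O_Q1_1.
move=> [C [C1 CO cC] CM].
suff E0 : C `&` [set M | stab M] = C by move: CM; rewrite -E0 => -[].
apply: cC.
- by exists 1%:M.
(* Relatively open: around each stabilizing [g], the translate of the cell meets O(Q_1) only in
   products of [g] with stabilizing elements. *)
- exists (\bigcup_(g in [set g | stab g]) [set M : 'M[R]_(n + n) | 0 < \det (drsubmx (invmx g *m M))]).
    by apply: bigcup_open => g _; exact: open_cell.
  apply/seteqP; split=> M' [CM' H]; split=> //.
    by exists M' => //=; rewrite mulVmx //; case: H => -[].
  case: H => g sg /= dg; have [Og _] := sg.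
  have sgM : stab (invmx g *m M').
    by apply: stab_big_cell => //; apply: O_Q1_mul; [exact: O_Q1_inv | exact: CO].
  exact: stab_cancel (CO _ CM') (stab_inv sg) sgM.
(* Relatively closed: if a stabilizing [M'] lay in the translate around some other [g] of O(Q_1),
   then g = M' (g^-1 M')^-1 would stabilize as well. *)
exists (~` \bigcup_(g in [set g | O_Q1 g /\ ~ stab g]) [set M : 'M[R]_(n + n) | 0 < \det (drsubmx (invmx g *m M))]).
  by apply: open_closedC; apply: bigcup_open => g _; exact: open_cell.
apply/seteqP; split=> M' [CM' H]; split=> //.
  move=> [g [Og ng] /= dg]; apply: ng.
  have sgM : stab (invmx g *m M').
    by apply: stab_big_cell => //; apply: O_Q1_mul; [exact: O_Q1_inv | exact: CO].
  have [ug _] := Og; have [uM _] := CO _ CM'.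
  have -> : g = M' *m invmx (invmx g *m M').
    have uK : invmx g *m M' \in unitmx by rewrite unitmx_mul unitmx_inv ug.
    by rewrite -{1}(mulKVmx ug M') mulmxK.
  exact: stab_mul H (stab_inv sgM).
apply: contrapT => ns; apply: H; exists M' => //=; first by split=> //; exact: CO.
by rewrite mulVmx //; case: (CO _ CM').
Qed.

End BigCell.

Theorem theorem2 (R : realType) (n : nat) (hn : (3 <= n)%N)
    (T : predensity (ambient R n) (dimX1 n) -> R[i]) (hT : distribution_X1 T)
    (hinv : GLplus_invariant T) :
  SO0_invariant T.
Proof.
(* [invariant_under] pulls densities back by the inverse element, so the hypothesis is applied to
   [invmx h]. *)
have levi (h : 'M[R]_n) : 0 < \det h -> forall F, test_fun F ->
    T (density_of (fun v => F (coord_act (block_mx h 0 0 (invmx h)^T) v))) = T (density_of F).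
  move=> dh F test_funF; have uh : h \in unitmx by rewrite unitmxE unitfE gt_eqF.
  have dI : GLplus (invmx h) by rewrite /GLplus /= det_inv invr_gt0.
  have := hinv _ dI _ (density_of_test test_funF); rewrite /distribution_pullback invmxK => <-.
  congr (T _); rewrite -density_pullback_density_of; last exact: O_Q1_levi.
  suff -> : actGL h = actSO (block_mx h 0 0 (invmx h)^T) by [].
  by apply/funext => p; exact: actGL_SO.
have [aRe aIm] := distribution_admissible hT.
(* The stabilizer argument runs once for the real part and once for the imaginary part of [T]. *)
have inv (M : 'M[R]_(n + n)) : SO0_Q1 M -> O_Q1 M /\ forall F, test_fun F ->
    T (density_of (fun v => F (coord_act M v))) = T (density_of F).
  move=> sM.
  have [OM HRe] := stab_SO0 aRe hn (fun h dh F test_funF => congr1 (@complex.Re R) (levi h dh F test_funF)) sM.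
  have [_ HIm] := stab_SO0 aIm hn (fun h dh F test_funF => congr1 (@complex.Im R) (levi h dh F test_funF)) sM.
  split=> // F test_funF; apply/eqP; rewrite eq_complex; apply/andP.
  by split; apply/eqP; [exact: HRe | exact: HIm].
move=> M sM mu tmu; have [OM iM] := inv _ sM.
have OI := O_Q1_inv OM.
(* Invariance under [M], applied to the function already transported by [invmx M], gives invariance
   under the inverse, which the definition of [SO0_invariant] asks for. *)
have invI F : test_fun F -> T (density_of (fun v => F (coord_act (invmx M) v))) = T (density_of F).
  move=> test_funF; apply: etrans (esym (iM _ (test_fun_coord_act OI test_funF))) _; congr (T _).
  by apply: density_of_eq => p _; rewrite -coord_act_mul mulVmx ?ga1 //; case: OM.
have [F [G [test_extF SGG ->]]] := test_density_repr tmu.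
have test_funF := test_ext_test_fun test_extF; have WGG := test_ext_test_fun SGG; have [lT _] := hT.
rewrite /distribution_pullback.
have -> : density_pullback (actSO (invmx M)) (fun p A => 'i%C * density_of G p A + density_of F p A) =
    fun p A => 'i%C * density_pullback (actSO (invmx M)) (density_of G) p A +
      density_pullback (actSO (invmx M)) (density_of F) p A by [].
rewrite !density_pullback_density_of //.
have tF := density_of_test test_funF; have tG := density_of_test WGG.
have tF' := density_of_test (test_fun_coord_act OI test_funF); have tG' := density_of_test (test_fun_coord_act OI WGG).
by rewrite (lT _ _ _ tG' tF') (lT _ _ _ tG tF) (invI _ test_funF) (invI _ WGG).
Qed.
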